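(* The model category $\mathrm{bCh}_{\mathrm{CE}}$ (bicomplexes with the Cartan--Eilenberg model structure) is a monoidal model category with respect to the tensor product of bicomplexes, has cofibrant tensor unit, and satisfies the monoid axiom of Schwede and Shipley.
   Context: $k$ is a commutative ring; modules are $k$-modules and $\otimes$ is over $k$. A bicomplex $X$ is a bigraded module $X=\{X_{p,q}\}_{p,q\in\mathbb Z}$ with $X_{p,q}=0$ for $p<0$, equipped with $d_h\colon X_{p,q}\to X_{p-1,q}$ and $d_v\colon X_{p,q}\to X_{p,q-1}$ satisfying $d_h^2=0$, $d_v^2=0$ and $d_vd_h+d_hd_v=0$. Morphisms commute with $d_h$ and $d_v$. The category is denoted $\mathrm{bCh}$. $Z^v(X)=\ker d_v$ are the vertical cycles and $H^v(X)=\ker d_v/\operatorname{im}d_v$ the vertical homology, both regarded as complexes in the horizontal direction with the differential induced by $d_h$; $H^h$ denotes homology with respect to the horizontal differential. Cartan--Eilenberg model structure on $\mathrm{bCh}$: $f$ is a weak equivalence iff $H^h_{p,q}(H^v(f))$ is an isomorphism for all $p\geq 0$, $q\in\mathbb Z$; $f$ is a fibration iff it is surjective in each bidegree, $Z^v_{p,q}(f)$ is surjective for all $p>0$ and $q\in\mathbb Z$, and $H^h_{p,q}(f)$ is an isomorphism for all $p,q$; cofibrations are the maps with the left lifting property with respect to trivial fibrations. Tensor product: $(X\otimes Y)_{p,q}=\bigoplus_{m+s=p,\ n+t=q}X_{m,n}\otimes Y_{s,t}$ with $d_h(x\otimes y)=d_h(x)\otimes y+(-1)^{|x|}x\otimes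 d_h(y)$ and $d_v(x\otimes y)=d_v(x)\otimes y+(-1)^{|x|}x\otimes d_v(y)$, where $|x|=p+q$ is the total degree of $x\in X_{p,q}$. This is a closed symmetric monoidal structure with unit $k$ concentrated in bidegree $(0,0)$ and symmetry $x\otimes y\mapsto(-1)^{|x||y|}y\otimes x$. Monoid axiom (Schwede--Shipley): every transfinite composition of pushouts of maps of the form $f\otimes Z$, with $f$ a trivial cofibration and $Z$ an arbitrary object, is a weak equivalence. *)

(* Defs.v *)
From HB Require Import structures.
From mathcomp Require Import all_boot all_order all_algebra.
From mathcomp Require Import boolp.

Set Implicit Arguments.
Unset Strict Implicit.
Unset Printing Implicit Defensive.

Import Order.TTheory GRing.Theory Num.Theory.
Local Open Scope ring_scope.
Local Open Scope quotient_scope.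

Record submodule (k : comPzRingType) (M : lmodType k) := Submodule {
  smem :> M -> Prop;
  smem0 : smem 0;
  smem_lin : forall (a : k) (x y : M), smem x -> smem y -> smem (a *: x + y) }.

Section QuotientModule.
Variables (k : comPzRingType) (M : lmodType k) (S : submodule M).

Lemma smemD x y : S x -> S y -> S (x + y).
Proof. by move=> Sx Sy; have := smem_lin 1 Sx Sy; rewrite scale1r. Qed.

Lemma smemZ a x : S x -> S (a *: x).
Proof. by move=> Sx; have := smem_lin a Sx (smem0 S); rewrite addr0. Qed.

Lemma smemN x : S x -> S (- x).
Proof. by move=> Sx; rewrite -scaleN1r; apply: smemZ. Qed.

Definition qm_rel (x y : M) : bool := `[< S (x - y) >].

Lemma qm_rel_refl : reflexive qm_rel.
Proof. by move=> x; apply/asboolP; rewrite subrr; apply: smem0. Qed.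

Lemma qm_rel_sym : symmetric qm_rel.
Proof.
move=> x y; apply/idP/idP => /asboolP h; apply/asboolP;
  by rewrite -opprB; apply: smemN.
Qed.

Lemma qm_rel_trans : transitive qm_rel.
Proof.
move=> y x z /asboolP h1 /asboolP h2; apply/asboolP.
by have := smemD h1 h2; rewrite addrA subrK.
Qed.

Canonical qm_equiv :=
  EquivRel qm_rel qm_rel_refl qm_rel_sym qm_rel_trans.

Definition quotmod := {eq_quot qm_equiv}.
HB.instance Definition _ := Choice.on quotmod.

Definition qm_class (x : M) : quotmod := \pi x.
Definition qm_repr (u : quotmod) : M := repr u.

Lemma qm_reprK u : qm_class (qm_repr u) = u.
Proof. exact: reprK. Qed.

Lemma qm_eqP x y : qm_class x = qm_class y <-> S (x - y).
Proof.
split=> [/eqP|h]; first by rewrite /qm_class eqmodE => /asboolP.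
by apply/eqP; rewrite /qm_class eqmodE; apply/asboolP.
Qed.

Lemma qm_repr_class x : S (qm_repr (qm_class x) - x).
Proof. by apply/qm_eqP; rewrite qm_reprK. Qed.

Definition qm_add (u v : quotmod) := qm_class (qm_repr u + qm_repr v).
Definition qm_opp (u : quotmod) := qm_class (- qm_repr u).
Definition qm_scale (a : k) (u : quotmod) := qm_class (a *: qm_repr u).

Lemma qm_addE x y : qm_add (qm_class x) (qm_class y) = qm_class (x + y).
Proof.
apply/qm_eqP; rewrite opprD addrACA.
by apply: smemD; apply: qm_repr_class.
Qed.

Lemma qm_oppE x : qm_opp (qm_class x) = qm_class (- x).
Proof.
by apply/qm_eqP; rewrite -opprD; apply: smemN; apply: qm_repr_class.
Qed.

Lemma qm_scaleE a x : qm_scale a (qm_class x) = qm_class (a *: x).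
Proof.
by apply/qm_eqP; rewrite -scalerBr; apply: smemZ; apply: qm_repr_class.
Qed.

Lemma qm_addA : associative qm_add.
Proof.
move=> u v w; rewrite -[u]qm_reprK -[v]qm_reprK -[w]qm_reprK.
by rewrite !qm_addE addrA.
Qed.
Lemma qm_addC : commutative qm_add.
Proof.
by move=> u v; rewrite -[u]qm_reprK -[v]qm_reprK !qm_addE addrC.
Qed.
Lemma qm_add0 : left_id (qm_class 0) qm_add.
Proof. by move=> u; rewrite -[u]qm_reprK qm_addE add0r. Qed.
Lemma qm_addN : left_inverse (qm_class 0) qm_opp qm_add.
Proof. by move=> u; rewrite -[u]qm_reprK qm_oppE qm_addE addNr. Qed.

HB.instance Definition _ :=
  GRing.isZmodule.Build quotmod qm_addA qm_addC qm_add0 qm_addN.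

Lemma qm_classD x y : qm_class x + qm_class y = qm_class (x + y).
Proof. exact: qm_addE. Qed.

Lemma qm_scaleA a b u : qm_scale a (qm_scale b u) = qm_scale (a * b) u.
Proof. by rewrite -[u]qm_reprK !qm_scaleE scalerA. Qed.
Lemma qm_scale1 : left_id 1 qm_scale.
Proof. by move=> u; rewrite -[u]qm_reprK qm_scaleE scale1r. Qed.
Lemma qm_scaleDr : right_distributive qm_scale +%R.
Proof.
move=> a u v; rewrite -[u]qm_reprK -[v]qm_reprK.
by rewrite qm_classD !qm_scaleE qm_classD scalerDr.
Qed.
Lemma qm_scaleDl u : {morph qm_scale^~ u : a b / a + b}.
Proof.
move=> a b; rewrite -[u]qm_reprK !qm_scaleE.
by rewrite qm_classD scalerDl.
Qed.

HB.instance Definition _ :=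
  GRing.Zmodule_isLmodule.Build k quotmod
    qm_scaleA qm_scale1 qm_scaleDr qm_scaleDl.

Lemma qm_class_linear : linear qm_class.
Proof.
move=> a x y; symmetry.
by rewrite [a *: _]qm_scaleE qm_classD.
Qed.
HB.instance Definition _ :=
  GRing.isLinear.Build k M quotmod _ qm_class qm_class_linear.

Section Lift.
Variables (N : lmodType k) (f : {linear M -> N}).
Hypothesis f0 : forall x, S x -> f x = 0.

Definition qm_lift of (forall x, S x -> f x = 0) :=
  fun u : quotmod => f (qm_repr u).

Lemma qm_liftE x : qm_lift f0 (qm_class x) = f x.
Proof.
by apply/eqP; rewrite -subr_eq0 /qm_lift -linearB f0 //;
  apply: qm_repr_class.
Qed.

Lemma qm_lift_linear : linear (qm_lift f0).
Proof.
move=> a u v; rewrite -[u]qm_reprK -[v]qm_reprK -linearP !qm_liftE.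
exact: linearP.
Qed.
HB.instance Definition _ :=
  GRing.isLinear.Build k quotmod N _ (qm_lift f0) qm_lift_linear.
End Lift.

End QuotientModule.

(* The universal module with an admissible map from G.  An element is a  *)
(* formal linear combination of elements of G, and two combinations are  *)
(* identified when every admissible map into every module takes the same *)
(* value on them.  When admissibility is an equational condition, um_gen *)
(* is itself admissible by um_gen_eq; um_lift and um_ext then say that   *)
(* it is initial among admissible maps.                                  *)
Section UniversalModule.
Variables (k : comPzRingType) (G : choiceType).
Variable Adm : forall P : lmodType k, (G -> P) -> Prop.

Definition um_eval (P : lmodType k) (b : G -> P) (l : seq (k * G)) : P :=
  \sum_(c <- l) c.1 *: b c.2.

Definition um_rel (l l' : seq (k * G)) : bool :=
  `[< forall (P : lmodType k) (b : G -> P), Adm b ->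
        um_eval b l = um_eval b l' >].

Lemma um_rel_refl : reflexive um_rel.
Proof. by move=> l; apply/asboolP. Qed.

Lemma um_rel_sym : symmetric um_rel.
Proof.
by move=> l l'; apply/idP/idP => /asboolP h; apply/asboolP => P b hb;
  rewrite h.
Qed.

Lemma um_rel_trans : transitive um_rel.
Proof.
move=> y x z /asboolP h1 /asboolP h2; apply/asboolP => P b hb.
by rewrite h1 // h2.
Qed.

Canonical um_equiv := EquivRel um_rel um_rel_refl um_rel_sym um_rel_trans.

Definition umod := {eq_quot um_equiv}.
HB.instance Definition _ := Choice.on umod.

Definition um_class (l : seq (k * G)) : umod := \pi l.

Lemma um_eqP l l' : um_class l = um_class l' <->
  (forall (P : lmodType k) (b : G -> P), Adm b ->
     um_eval b l = um_eval b l').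
Proof.
split=> [/eqP|h]; first by rewrite /um_class eqmodE => /asboolP.
by apply/eqP; rewrite /um_class eqmodE; apply/asboolP.
Qed.

Lemma um_reprK u : um_class (repr u) = u.
Proof. exact: reprK. Qed.

Lemma um_repr_class (P : lmodType k) (b : G -> P) l :
  Adm b -> um_eval b (repr (um_class l)) = um_eval b l.
Proof. by move=> hb; apply: (um_eqP _ _).1 => //; rewrite um_reprK. Qed.

Definition um_smul (a : k) (l : seq (k * G)) := [seq (a * c.1, c.2) | c <- l].

Lemma um_eval_cat (P : lmodType k) (b : G -> P) l l' :
  um_eval b (l ++ l') = um_eval b l + um_eval b l'.
Proof. by rewrite /um_eval big_cat. Qed.

Lemma um_eval_smul (P : lmodType k) (b : G -> P) a l :
  um_eval b (um_smul a l) = a *: um_eval b l.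
Proof.
rewrite /um_eval /um_smul big_map scaler_sumr.
by apply: eq_bigr => c _; rewrite scalerA.
Qed.

Lemma um_eval_nil (P : lmodType k) (b : G -> P) : um_eval b [::] = 0.
Proof. by rewrite /um_eval big_nil. Qed.

Definition um_add (u v : umod) := um_class (repr u ++ repr v).
Definition um_opp (u : umod) := um_class (um_smul (-1) (repr u)).
Definition um_scale (a : k) (u : umod) := um_class (um_smul a (repr u)).

Lemma um_addA : associative um_add.
Proof.
move=> u v w; apply/um_eqP => P b hb.
by rewrite !um_eval_cat !um_repr_class // !um_eval_cat addrA.
Qed.
Lemma um_addC : commutative um_add.
Proof. by move=> u v; apply/um_eqP => P b hb; rewrite !um_eval_cat addrC. Qed.
Lemma um_add0 : left_id (um_class [::]) um_add.
Proof.
move=> u; rewrite -[RHS]um_reprK; apply/um_eqP => P b hb.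
by rewrite um_eval_cat um_repr_class // um_eval_nil add0r.
Qed.
Lemma um_addN : left_inverse (um_class [::]) um_opp um_add.
Proof.
move=> u; apply/um_eqP => P b hb.
by rewrite um_eval_cat um_repr_class // um_eval_smul um_eval_nil
  scaleN1r addNr.
Qed.

HB.instance Definition _ :=
  GRing.isZmodule.Build umod um_addA um_addC um_add0 um_addN.

Lemma um_scaleA a b u : um_scale a (um_scale b u) = um_scale (a * b) u.
Proof.
apply/um_eqP => P f hf.
by rewrite !um_eval_smul um_repr_class // um_eval_smul scalerA.
Qed.
Lemma um_scale1 : left_id 1 um_scale.
Proof.
move=> u; rewrite -[RHS]um_reprK; apply/um_eqP => P b hb.
by rewrite um_eval_smul scale1r.
Qed.
Lemma um_scaleDr : right_distributive um_scale +%R.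
Proof.
move=> a u v; apply/um_eqP => P b hb.
rewrite um_eval_smul um_eval_cat !um_repr_class // um_eval_cat !um_eval_smul.
by rewrite scalerDr.
Qed.
Lemma um_scaleDl u : {morph um_scale^~ u : a b / a + b}.
Proof.
move=> a b; apply/um_eqP => P f hf.
by rewrite um_eval_smul um_eval_cat !um_repr_class // !um_eval_smul scalerDl.
Qed.

HB.instance Definition _ :=
  GRing.Zmodule_isLmodule.Build k umod
    um_scaleA um_scale1 um_scaleDr um_scaleDl.

Definition um_gen (g : G) : umod := um_class [:: (1, g)].

Section Lift.
Variables (P : lmodType k) (b : G -> P) (hb : Adm b).

(* The proof of Adm b is an unused argument: it lets linearity, which   *)
(* depends on it, be declared as an instance.                           *)
Definition um_lift of Adm b := fun u : umod => um_eval b (repr u).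

Lemma um_lift_linear : linear (um_lift hb).
Proof.
move=> a u v; rewrite /um_lift um_repr_class // um_eval_cat.
by rewrite um_repr_class // um_eval_smul.
Qed.
HB.instance Definition _ :=
  GRing.isLinear.Build k umod P _ (um_lift hb) um_lift_linear.

Lemma um_lift_gen g : um_lift hb (um_gen g) = b g.
Proof.
by rewrite /um_lift um_repr_class // /um_eval big_seq1 scale1r.
Qed.
End Lift.

Lemma um_ext (P : lmodType k) (f f' : {linear umod -> P}) :
  (forall g, f (um_gen g) = f' (um_gen g)) -> f =1 f'.
Proof.
have cl1 a g : um_class [:: (a, g)] = a *: um_gen g.
  apply/um_eqP => Q b hb; rewrite um_eval_smul um_repr_class //.
  by rewrite /um_eval !big_seq1 scale1r.
have clc c l : um_class (c :: l) = um_class [:: c] + um_class l.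
  apply/um_eqP => Q b hb; rewrite um_eval_cat !um_repr_class //.
  by rewrite /um_eval big_cons big_seq1.
move=> ff' u; rewrite -[u]um_reprK; elim: (repr u) => [|[a g] l IH].
  by rewrite [um_class _](_ : _ = 0) ?raddf0.
by rewrite clc cl1 !raddfD /= !linearZ /= ff' IH.
Qed.

Lemma um_gen_eq (s : seq (k * G)) :
  (forall (P : lmodType k) (b : G -> P), Adm b -> um_eval b s = 0) ->
  um_eval um_gen s = 0.
Proof.
have cl1 a g : um_class [:: (a, g)] = a *: um_gen g.
  apply/um_eqP => Q b hb; rewrite um_eval_smul um_repr_class //.
  by rewrite /um_eval !big_seq1 scale1r.
have clc c l : um_class (c :: l) = um_class [:: c] + um_class l.
  apply/um_eqP => Q b hb; rewrite um_eval_cat !um_repr_class //.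
  by rewrite /um_eval big_cons big_seq1.
move=> h; have -> : um_eval um_gen s = um_class s.
  elim: s {h} => [|[a g] s IH]; first by rewrite um_eval_nil.
  by rewrite clc cl1 -IH /um_eval big_cons.
by apply/um_eqP => P b hb; rewrite um_eval_nil h.
Qed.

End UniversalModule.

Section DirectSum.
Variables (k : comPzRingType) (I : choiceType) (M : I -> lmodType k).

Definition dsum_adm (P : lmodType k) (b : {i : I & M i} -> P) : Prop :=
  forall i, linear (fun x : M i => b (existT _ i x)).

Definition dsum : lmodType k := umod dsum_adm.

Definition dsum_in (i : I) (x : M i) : dsum :=
  um_gen dsum_adm (existT _ i x).

Lemma dsum_in_linear i : linear (dsum_in (i := i)).
Proof.
move=> a x y; apply/eqP; rewrite -subr_eq0; apply/eqP.
pose s := [:: (1, existT (fun i => M i) i (a *: x + y));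
              (- a, existT (fun i => M i) i x);
              (-1, existT (fun i => M i) i y)] : seq (k * {i : I & M i}).
have := @um_gen_eq k _ dsum_adm s; rewrite /um_eval !big_cons !big_nil /=.
rewrite !scale1r !scaleN1r addr0 scaleNr opprD; apply=> P b hb.
by rewrite !big_cons big_nil /= hb scale1r scaleN1r addr0 scaleNr -opprD
  subrr.
Qed.
HB.instance Definition _ i :=
  GRing.isLinear.Build k (M i) dsum _ (dsum_in (i := i)) (@dsum_in_linear i).

Section Lift.
Variables (P : lmodType k) (f : forall i, {linear M i -> P}).

Lemma dsum_lift_adm :
  dsum_adm (fun u : {i : I & M i} => f (projT1 u) (projT2 u)).
Proof. by move=> i a x y; rewrite linearP. Qed.

Definition dsum_lift : {linear dsum -> P} := um_lift dsum_lift_adm.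

Lemma dsum_liftE i x : dsum_lift (dsum_in (i := i) x) = f i x.
Proof. by rewrite /dsum_lift /= um_lift_gen. Qed.
End Lift.

Lemma dsum_ext (P : lmodType k) (f f' : {linear dsum -> P}) :
  (forall i x, f (dsum_in (i := i) x) = f' (dsum_in x)) -> f =1 f'.
Proof. by move=> h; apply: um_ext => -[i x]; apply: h. Qed.
End DirectSum.

(* Only the universal properties are meant to be used from here on;      *)
(* unfolding these constants makes unification very slow.                *)
#[global] Opaque dsum dsum_in dsum_lift.

Section Tensor.
Variable k : comPzRingType.

Definition bilinear2 (M N P : lmodType k) (b : M -> N -> P) : Prop :=
  (forall y, linear (b^~ y)) /\ (forall x, linear (b x)).

Variables M N : lmodType k.

Definition tensor_adm (P : lmodType k) (b : M * N -> P) : Prop :=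
  bilinear2 (fun x y => b (x, y)).

Definition tensor : lmodType k := umod tensor_adm.

Definition tmk (x : M) (y : N) : tensor := um_gen tensor_adm (x, y).

Lemma tmk_bilinear : bilinear2 tmk.
Proof.
split=> [y a x x'|x a y y']; apply/eqP; rewrite -subr_eq0; apply/eqP.
  pose s := [:: (1, (a *: x + x', y)); (- a, (x, y)); (-1, (x', y))].
  have := @um_gen_eq k _ tensor_adm s; rewrite /um_eval !big_cons !big_nil /=.
  rewrite !scale1r !scaleN1r addr0 scaleNr opprD; apply=> P b [hb _].
  by rewrite !big_cons big_nil /= hb scale1r scaleN1r addr0 scaleNr -opprD
    subrr.
pose s := [:: (1, (x, a *: y + y')); (- a, (x, y)); (-1, (x, y'))].
have := @um_gen_eq k _ tensor_adm s; rewrite /um_eval !big_cons !big_nil /=.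
rewrite !scale1r !scaleN1r addr0 scaleNr opprD; apply=> P b [_ hb].
by rewrite !big_cons big_nil /= hb scale1r scaleN1r addr0 scaleNr -opprD
  subrr.
Qed.

Section Lift.
Variables (P : lmodType k) (b : M -> N -> P) (hb : bilinear2 b).

Lemma tensor_lift_adm : tensor_adm (fun u => b u.1 u.2).
Proof. exact: hb. Qed.

Definition tensor_lift : {linear tensor -> P} := um_lift tensor_lift_adm.

Lemma tensor_liftE x y : tensor_lift (tmk x y) = b x y.
Proof. by rewrite /tensor_lift /= um_lift_gen. Qed.
End Lift.

Lemma tensor_ext (P : lmodType k) (f f' : {linear tensor -> P}) :
  (forall x y, f (tmk x y) = f' (tmk x y)) -> f =1 f'.
Proof. by move=> h; apply: um_ext => -[x y]; apply: h. Qed.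
End Tensor.

#[global] Opaque tensor tmk tensor_lift.

(* The differential C_n -> C_n' takes a proof of n = n' + 1 as argument, *)
(* which avoids transports along equations between indices.              *)
Record cplx (k : comPzRingType) := Cplx {
  cobj :> int -> lmodType k;
  cd : forall n n' : int, n = n' + 1 -> {linear cobj n -> cobj n'};
  cdd : forall (n n' n'' : int) (e : n = n' + 1) (e' : n' = n'' + 1) (x : cobj n),
    cd e' (cd e x) = 0 }.

Lemma predK (n : int) : n = (n - 1) + 1.
Proof. by rewrite subrK. Qed.

Section Homology.
Variables (k : comPzRingType) (C : cplx k) (n : int).

Definition is_cycle : {pred C n} := fun x => cd C (predK n) x == 0.

Lemma is_cycle_closed : submod_closed is_cycle.
Proof.
split; first by rewrite unfold_in linear0.
by move=> a x y /eqP hx /eqP hy; rewrite unfold_in linearP hx hy scaler0 addr0.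
Qed.
HB.instance Definition _ :=
  GRing.isSubmodClosed.Build k (C n) is_cycle is_cycle_closed.

Record cycle := Cycle { cyc_val : C n; cycP : cyc_val \in is_cycle }.
HB.instance Definition _ := [isSub for cyc_val].
HB.instance Definition _ := [Choice of cycle by <:].
HB.instance Definition _ := [SubChoice_isSubLmodule of cycle by <:].

Definition is_boundary (z : cycle) : Prop :=
  exists y : C (n + 1), cyc_val z = cd C (erefl (n + 1)) y.

Lemma is_boundary0 : is_boundary 0.
Proof. by exists 0; rewrite linear0. Qed.

Lemma is_boundary_lin a x y :
  is_boundary x -> is_boundary y -> is_boundary (a *: x + y).
Proof.
move=> [u hu] [v hv]; exists (a *: u + v).
by rewrite linearP -hu -hv.
Qed.

Definition boundaries : submodule cycle :=
  Submodule is_boundary0 is_boundary_lin.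

Definition homology : lmodType k := quotmod boundaries.
End Homology.

Arguments is_cycle {k} C n _.
Arguments cycle {k} C n.
Arguments boundaries {k} C n.
Arguments homology {k} C n.

(* The map f need not be a component of a chain map: on vertical homology *)
(* dh is induced by a map that anticommutes with dv.                      *)
Section Induced.
Variables (k : comPzRingType) (C D : cplx k) (n m : int).
Variable f : {linear C n -> D m}.
Hypothesis fZ : forall x, x \in is_cycle C n -> f x \in is_cycle D m.

Definition cycle_map (z : cycle C n) : cycle D m := Cycle (fZ (cycP z)).

Lemma cycle_map_linear : linear (cycle_map).
Proof. by move=> a x y; apply: val_inj => /=; rewrite linearP. Qed.
HB.instance Definition _ :=
  GRing.isLinear.Build k (cycle C n) (cycle D m) _ (cycle_map)
    cycle_map_linear.

Hypothesis fB : forall z : cycle C n,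
  is_boundary z -> is_boundary (cycle_map z).

Lemma homology_map_subproof (z : cycle C n) :
  boundaries C n z ->
  (qm_class (boundaries D m) \o cycle_map) z = 0.
Proof.
move=> hz /=; rewrite -[0](linear0 (qm_class (boundaries D m))).
by apply/qm_eqP; rewrite subr0; apply: fB.
Qed.

Definition homology_map : {linear homology C n -> homology D m} :=
  qm_lift homology_map_subproof.

Lemma homology_mapE z :
  homology_map (qm_class _ z) = qm_class _ (cycle_map z).
Proof. exact: qm_liftE. Qed.
End Induced.

Record bicomplex (k : comPzRingType) := Bicomplex {
  bobj :> int -> int -> lmodType k;
  dh : forall p p' q : int, p = p' + 1 -> {linear bobj p q -> bobj p' q};
  dv : forall p q q' : int, q = q' + 1 -> {linear bobj p q -> bobj p q'};
  bobj0 : forall (p q : int) (x : bobj p q), p < 0 -> x = 0;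
  dhdh : forall (p p' p'' q : int) (e : p = p' + 1) (e' : p' = p'' + 1)
    (x : bobj p q), dh q e' (dh q e x) = 0;
  dvdv : forall (p q q' q'' : int) (e : q = q' + 1) (e' : q' = q'' + 1)
    (x : bobj p q), dv p e' (dv p e x) = 0;
  dvdh : forall (p p' q q' : int) (e : p = p' + 1) (e' : q = q' + 1)
    (x : bobj p q), dv p' e' (dh q e x) + dh q' e (dv p e' x) = 0 }.

Arguments dh {k} b {p p' q} e.
Arguments dv {k} b {p q q'} e.

Record bimor (k : comPzRingType) (X Y : bicomplex k) := Bimor {
  bmap :> forall p q, X p q -> Y p q;
  bmap_linear : forall p q, linear (bmap (p := p) (q := q));
  bmap_dh : forall (p p' q : int) (e : p = p' + 1) (x : X p q),
    bmap (dh X e x) = dh Y e (bmap x);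
  bmap_dv : forall (p q q' : int) (e : q = q' + 1) (x : X p q),
    bmap (dv X e x) = dv Y e (bmap x) }.

Arguments bmap {k X Y} b {p q} x.

HB.instance Definition _ (k : comPzRingType) (X Y : bicomplex k)
    (f : bimor X Y) p q :=
  GRing.isLinear.Build k (X p q) (Y p q) _ (@bmap k X Y f p q)
    (@bmap_linear k X Y f p q).

Definition bmap_lin (k : comPzRingType) (X Y : bicomplex k) (f : bimor X Y)
  p q : {linear X p q -> Y p q} := @bmap k X Y f p q.

Lemma bimor_eq (k : comPzRingType) (X Y : bicomplex k) (f g : bimor X Y) :
  (forall p q (x : X p q), f p q x = g p q x) -> f = g.
Proof.
case: f g => [f lf hf vf] [g lg hg vg] /= fg.
have {}fg : f = g by do 3![apply: functional_extensionality_dep => ?].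
by case: _ / fg lg hg vg => lg hg vg; congr Bimor; apply: Prop_irrelevance.
Qed.

Section BimorId.
Variables (k : comPzRingType) (X : bicomplex k).

Lemma bid_linear p q : linear (fun x : X p q => x).
Proof. by []. Qed.

Definition bid : bimor X X :=
  @Bimor k X X (fun p q x => x) bid_linear
    (fun _ _ _ _ _ => erefl) (fun _ _ _ _ _ => erefl).
End BimorId.

Section BimorComp.
Variables (k : comPzRingType) (X Y Z : bicomplex k).
Variables (g : bimor Y Z) (f : bimor X Y).

Lemma bcomp_linear p q : linear (fun x : X p q => g p q (f p q x)).
Proof. by move=> a x y; rewrite !linearP. Qed.

Lemma bcomp_dh p p' q (e : p = p' + 1) (x : X p q) :
  g p' q (f p' q (dh X e x)) = dh Z e (g p q (f p q x)).
Proof. by rewrite !bmap_dh. Qed.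

Lemma bcomp_dv p q q' (e : q = q' + 1) (x : X p q) :
  g p q' (f p q' (dv X e x)) = dv Z e (g p q (f p q x)).
Proof. by rewrite !bmap_dv. Qed.

Definition bcomp : bimor X Z := Bimor bcomp_linear bcomp_dh bcomp_dv.
End BimorComp.

Section VerticalHorizontal.
Variables (k : comPzRingType).

Definition col (X : bicomplex k) (p : int) : cplx k :=
  @Cplx k (X p) (fun q q' e => dv X e) (@dvdv k X p).

Definition row (X : bicomplex k) (q : int) : cplx k :=
  @Cplx k (X^~ q) (fun p p' e => dh X e) (fun p p' p'' => @dhdh k X p p' p'' q).

Definition Zv (X : bicomplex k) (p q : int) : lmodType k := cycle (col X p) q.

Definition Hv (X : bicomplex k) (p q : int) : lmodType k :=
  homology (col X p) q.

Definition Hh (X : bicomplex k) (p q : int) : lmodType k :=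
  homology (row X q) p.

Section InducedDifferential.
Variables (X : bicomplex k) (q p p' : int) (e : p = p' + 1).

Lemma dh_Zv (x : col X p q) :
  x \in is_cycle (col X p) q -> dh X e x \in is_cycle (col X p') q.
Proof.
move=> /eqP /= hx; apply/eqP => /=.
by have := dvdh e (predK q) x; rewrite hx linear0 addr0.
Qed.

Lemma dh_Bv (z : cycle (col X p) q) :
  is_boundary z -> is_boundary (@cycle_map k (col X p) (col X p') q q (dh X e) dh_Zv z).
Proof.
move=> [y /= hy]; exists (- dh X e y) => /=.
apply/eqP; rewrite hy linearN -addr_eq0 addrC; apply/eqP.
exact: (dvdh e (erefl (q + 1)) y).
Qed.

Definition Hv_dh : {linear Hv X p q -> Hv X p' q} :=
  @homology_map k (col X p) (col X p') q q (dh X e) dh_Zv dh_Bv.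

Lemma Hv_dhE z : Hv_dh (qm_class _ z) = 
  qm_class _ (@cycle_map k (col X p) (col X p') q q (dh X e) dh_Zv z).
Proof. exact: homology_mapE. Qed.
End InducedDifferential.

Lemma Hv_dhdh (X : bicomplex k) q p p' p'' (e : p = p' + 1)
  (e' : p' = p'' + 1) (u : Hv X p q) :
  Hv_dh X q e' (Hv_dh X q e u) = 0.
Proof.
rewrite -[u]qm_reprK !Hv_dhE -[0](linear0 (qm_class _)); congr qm_class.
by apply: val_inj => /=; rewrite dhdh.
Qed.

Definition Hv_row (X : bicomplex k) (q : int) : cplx k :=
  @Cplx k (fun p => Hv X p q) (@Hv_dh X q) (@Hv_dhdh X q).

Definition HhHv (X : bicomplex k) (p q : int) : lmodType k :=
  homology (Hv_row X q) p.

Section InducedMorphism.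
Variables (X Y : bicomplex k) (f : bimor X Y) (p q : int).

Lemma bmap_Zv (x : col X p q) :
  x \in is_cycle (col X p) q -> f p q x \in is_cycle (col Y p) q.
Proof.
by move=> /eqP /= hx; apply/eqP => /=; rewrite -bmap_dv hx linear0.
Qed.

Definition Zv_map : {linear Zv X p q -> Zv Y p q} :=
  @cycle_map k (col X p) (col Y p) q q (bmap_lin f p q) bmap_Zv.

Lemma bmap_Bv (z : cycle (col X p) q) :
  is_boundary z -> is_boundary (@cycle_map k (col X p) (col Y p) q q (bmap_lin f p q) bmap_Zv z).
Proof. by move=> [y /= hy]; exists (f _ _ y) => /=; rewrite hy bmap_dv. Qed.

Definition Hv_map : {linear Hv X p q -> Hv Y p q} :=
  @homology_map k (col X p) (col Y p) q q (bmap_lin f p q) bmap_Zv bmap_Bv.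

Lemma Hv_mapE z : Hv_map (qm_class _ z) = 
  qm_class _ (@cycle_map k (col X p) (col Y p) q q (bmap_lin f p q) bmap_Zv z).
Proof. exact: homology_mapE. Qed.

Lemma bmap_Zh (x : row X q p) :
  x \in is_cycle (row X q) p -> f p q x \in is_cycle (row Y q) p.
Proof.
by move=> /eqP /= hx; apply/eqP => /=; rewrite -bmap_dh hx linear0.
Qed.

Lemma bmap_Bh (z : cycle (row X q) p) :
  is_boundary z -> is_boundary (@cycle_map k (row X q) (row Y q) p p (bmap_lin f p q) bmap_Zh z).
Proof. by move=> [y /= hy]; exists (f _ _ y) => /=; rewrite hy bmap_dh. Qed.

Definition Hh_map : {linear Hh X p q -> Hh Y p q} :=
  @homology_map k (row X q) (row Y q) p p (bmap_lin f p q) bmap_Zh bmap_Bh.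
End InducedMorphism.

Lemma Hv_map_dh (X Y : bicomplex k) (f : bimor X Y) p p' q
  (e : p = p' + 1) (u : Hv X p q) :
  Hv_map f p' q (Hv_dh X q e u) = Hv_dh Y q e (Hv_map f p q u).
Proof.
rewrite -[u]qm_reprK Hv_dhE !Hv_mapE Hv_dhE; congr qm_class.
by apply: val_inj => /=; rewrite bmap_dh.
Qed.

Section InducedHhHv.
Variables (X Y : bicomplex k) (f : bimor X Y) (p q : int).

Lemma Hv_map_Zh (x : Hv_row X q p) :
  x \in is_cycle (Hv_row X q) p -> Hv_map f p q x \in is_cycle (Hv_row Y q) p.
Proof.
move=> /eqP hx; apply/eqP.
by rewrite -[LHS]/(Hv_dh Y q (predK p) (Hv_map f p q x)) -Hv_map_dh
  [X in Hv_map f _ _ X]hx linear0.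
Qed.

Lemma Hv_map_Bh (z : cycle (Hv_row X q) p) :
  is_boundary z -> is_boundary (
    @cycle_map k (Hv_row X q) (Hv_row Y q) p p (Hv_map f p q) Hv_map_Zh z).
Proof.
move=> [y hy]; exists (Hv_map f _ _ y).
by rewrite [cyc_val _]/(Hv_map f p q (cyc_val z)) hy; apply: Hv_map_dh.
Qed.

Definition HhHv_map : {linear HhHv X p q -> HhHv Y p q} :=
  @homology_map k (Hv_row X q) (Hv_row Y q) p p (Hv_map f p q)
    Hv_map_Zh Hv_map_Bh.
End InducedHhHv.
End VerticalHorizontal.

Definition ksign (k : comPzRingType) (d : int) : k := (-1) ^+ `|d|%N.

Lemma ksignS (k : comPzRingType) (d : int) : ksign k (d + 1) = - ksign k d.
Proof.
rewrite /ksign; case: d => n; first by rewrite -PoszD addn1 exprS mulN1r.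
case: n => [|n]; first by rewrite expr1 opprK.
have -> : (Negz n.+1 + 1)%R = - n.+1%:Z by rewrite NegzE -[n.+2]addn1 PoszD opprD addrNK.
by rewrite NegzE !abszN !absz_nat [in RHS]exprS mulN1r opprK.
Qed.

Section TensorObject.
Variables (k : comPzRingType) (X Y : bicomplex k).

(* The element ((m, n), (s, t)) indexes the summand X_{m,n} (x) Y_{s,t}. *)
Definition tidx (p q : int) := {u : (int * int) * (int * int) |
  (u.1.1 + u.2.1 == p) && (u.1.2 + u.2.2 == q)}.

Definition tobj (p q : int) : lmodType k :=
  dsum (fun u : tidx p q =>
          tensor (X (val u).1.1 (val u).1.2) (Y (val u).2.1 (val u).2.2)).

Lemma tidx_subproof (p q m n s t : int) (e : m + s = p) (e' : n + t = q) :
  (m + s == p) && (n + t == q).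
Proof. by rewrite e e' !eqxx. Qed.

Definition tidx_mk (p q m n s t : int) (e : m + s = p) (e' : n + t = q) :
  tidx p q := exist _ ((m, n), (s, t)) (tidx_subproof e e').

Definition tpure p q m n s t (e : m + s = p) (e' : n + t = q)
    (x : X m n) (y : Y s t) : tobj p q :=
  @dsum_in k (tidx p q) _ (tidx_mk e e') (tmk x y).

Lemma tpure_bilinear p q m n s t (e : m + s = p) (e' : n + t = q) :
  bilinear2 (tpure (m := m) (n := n) (s := s) (t := t) e e').
Proof.
have [h1 h2] := tmk_bilinear (X m n) (Y s t).
by split=> [y a x x'|x a y y']; rewrite /tpure ?h1 ?h2 linearP.
Qed.

Lemma tpure_linl p q m n s t (e : m + s = p) (e' : n + t = q) a x x' y :
  tpure (m := m) (n := n) (s := s) (t := t) e e' (a *: x + x') y =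
  a *: tpure e e' x y + tpure e e' x' y.
Proof. exact: (tpure_bilinear e e').1. Qed.

Lemma tpure_linr p q m n s t (e : m + s = p) (e' : n + t = q) x a y y' :
  tpure (m := m) (n := n) (s := s) (t := t) e e' x (a *: y + y') =
  a *: tpure e e' x y + tpure e e' x y'.
Proof. exact: (tpure_bilinear e e').2. Qed.

Lemma tpure_irr p q m n s t (e e1 : m + s = p) (e' e1' : n + t = q) x y :
  tpure (m := m) (n := n) (s := s) (t := t) e e' x y = tpure e1 e1' x y.
Proof. by rewrite (eq_irrelevance e e1) (eq_irrelevance e' e1'). Qed.

Section Lift.
Variables (p q : int) (P : lmodType k).
Variable b : forall m n s t, m + s = p -> n + t = q -> X m n -> Y s t -> P.
Hypothesis hb : forall m n s t (e : m + s = p) (e' : n + t = q),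
  bilinear2 (@b m n s t e e').

Lemma tidx_eq1 (u : tidx p q) : (val u).1.1 + (val u).2.1 = p.
Proof. by case: u => u /= /andP [/eqP]. Qed.

Lemma tidx_eq2 (u : tidx p q) : (val u).1.2 + (val u).2.2 = q.
Proof. by case: u => u /= /andP [_ /eqP]. Qed.

Definition tlift : {linear tobj p q -> P} :=
  dsum_lift (fun u : tidx p q => tensor_lift (hb (tidx_eq1 u) (tidx_eq2 u))).

Lemma tliftE m n s t (e : m + s = p) (e' : n + t = q) x y :
  tlift (tpure (m := m) (n := n) (s := s) (t := t) e e' x y) = b e e' x y.
Proof.
rewrite /tlift /tpure dsum_liftE tensor_liftE.
by congr (b _ _ x y); apply: eq_irrelevance.
Qed.
End Lift.

Lemma tobj_ext p q (P : lmodType k) (f f' : {linear tobj p q -> P}) :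
  (forall m n s t (e : m + s = p) (e' : n + t = q) x y,
     f (tpure (m := m) (n := n) (s := s) (t := t) e e' x y) =
     f' (tpure e e' x y)) ->
  f =1 f'.
Proof.
move=> h; apply: dsum_ext => -[[[m n] [s t]] /= i] x.
pose g := f \o dsum_in (i := exist _ ((m, n), (s, t)) i).
pose g' := f' \o dsum_in (i := exist _ ((m, n), (s, t)) i).
apply: (tensor_ext (f := g) (f' := g')) => {}x y.
have e := tidx_eq1 (exist _ ((m, n), (s, t)) i).
have e' := tidx_eq2 (exist _ ((m, n), (s, t)) i).
have := h m n s t e e' x y; rewrite /tpure /tidx_mk /g /g' /=.
by rewrite (bool_irrelevance (tidx_subproof e e') i).
Qed.

Opaque tobj tpure tlift.

Lemma tidx_predl (m s p p' : int) : m + s = p -> p = p' + 1 -> (m - 1) + s = p'.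
Proof. by rewrite addrAC => -> ->; rewrite addrK. Qed.

Lemma tidx_predr (m s p p' : int) : m + s = p -> p = p' + 1 -> m + (s - 1) = p'.
Proof. by rewrite addrA => -> ->; rewrite addrK. Qed.

Section Differentials.
Variables (p q : int).

Definition tdh_fun p' (e : p = p' + 1) m n s t
    (e1 : m + s = p) (e2 : n + t = q) (x : X m n) (y : Y s t) : tobj p' q :=
  tpure (tidx_predl e1 e) e2 (dh X (predK m) x) y +
  ksign k (m + n) *: tpure (tidx_predr e1 e) e2 x (dh Y (predK s) y).

Definition tdv_fun q' (e : q = q' + 1) m n s t
    (e1 : m + s = p) (e2 : n + t = q) (x : X m n) (y : Y s t) : tobj p q' :=
  tpure e1 (tidx_predl e2 e) (dv X (predK n) x) y +
  ksign k (m + n) *: tpure e1 (tidx_predr e2 e) x (dv Y (predK t) y).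

Lemma tdh_fun_bilinear p' (e : p = p' + 1) m n s t
  (e1 : m + s = p) (e2 : n + t = q) :
  bilinear2 (tdh_fun e (m := m) (n := n) (s := s) (t := t) e1 e2).
Proof.
split=> [y a x x'|x a y y']; rewrite /tdh_fun linearP.
  rewrite !tpure_linl.
  by rewrite scalerDr [ksign _ _ *: (a *: _)]scalerA mulrC -scalerA
    addrACA -scalerDr.
rewrite !tpure_linr.
by rewrite scalerDr [ksign _ _ *: (a *: _)]scalerA mulrC -scalerA
  addrACA -scalerDr.
Qed.

Lemma tdv_fun_bilinear q' (e : q = q' + 1) m n s t
  (e1 : m + s = p) (e2 : n + t = q) :
  bilinear2 (tdv_fun e (m := m) (n := n) (s := s) (t := t) e1 e2).
Proof.
split=> [y a x x'|x a y y']; rewrite /tdv_fun linearP.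
  rewrite !tpure_linl.
  by rewrite scalerDr [ksign _ _ *: (a *: _)]scalerA mulrC -scalerA
    addrACA -scalerDr.
rewrite !tpure_linr.
by rewrite scalerDr [ksign _ _ *: (a *: _)]scalerA mulrC -scalerA
  addrACA -scalerDr.
Qed.

Definition tdh p' (e : p = p' + 1) : {linear tobj p q -> tobj p' q} :=
  tlift (tdh_fun_bilinear e).

Definition tdv q' (e : q = q' + 1) : {linear tobj p q -> tobj p q'} :=
  tlift (tdv_fun_bilinear e).
End Differentials.

Lemma tdhE p q p' (e : p = p' + 1) m n s t
    (e1 : m + s = p) (e2 : n + t = q) (x : X m n) (y : Y s t) :
  tdh q e (tpure e1 e2 x y) =
  tpure (tidx_predl e1 e) e2 (dh X (predK m) x) y +
  ksign k (m + n) *: tpure (tidx_predr e1 e) e2 x (dh Y (predK s) y).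
Proof. exact: tliftE. Qed.

Lemma tdvE p q q' (e : q = q' + 1) m n s t
    (e1 : m + s = p) (e2 : n + t = q) (x : X m n) (y : Y s t) :
  tdv p e (tpure e1 e2 x y) =
  tpure e1 (tidx_predl e2 e) (dv X (predK n) x) y +
  ksign k (m + n) *: tpure e1 (tidx_predr e2 e) x (dv Y (predK t) y).
Proof. exact: tliftE. Qed.

Opaque tdh tdv.

Lemma tpure0l p q m n s t (e : m + s = p) (e' : n + t = q) y :
  tpure (m := m) (n := n) (s := s) (t := t) e e' 0 y = 0.
Proof.
have := tpure_linl e e' (-1) 0 0 y.
by rewrite !scaleN1r oppr0 addr0 addNr.
Qed.

Lemma tpure0r p q m n s t (e : m + s = p) (e' : n + t = q) x :
  tpure (m := m) (n := n) (s := s) (t := t) e e' x 0 = 0.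
Proof.
have := tpure_linr e e' x (-1) 0 0.
by rewrite !scaleN1r oppr0 addr0 addNr.
Qed.

Lemma tpureDl p q m n s t (e : m + s = p) (e' : n + t = q) x x' y :
  tpure (m := m) (n := n) (s := s) (t := t) e e' (x + x') y =
  tpure e e' x y + tpure e e' x' y.
Proof.
by have := tpure_linl e e' 1 x x' y; rewrite !scale1r.
Qed.

Lemma tpureDr p q m n s t (e : m + s = p) (e' : n + t = q) x y y' :
  tpure (m := m) (n := n) (s := s) (t := t) e e' x (y + y') =
  tpure e e' x y + tpure e e' x y'.
Proof.
by have := tpure_linr e e' x 1 y y'; rewrite !scale1r.
Qed.

Lemma ksign_pred (d d' : int) : d' + 1 = d -> ksign k d' = - ksign k d.
Proof. by move=> <-; rewrite ksignS opprK. Qed.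

Lemma tobj0 p q (x : tobj p q) : p < 0 -> x = 0.
Proof.
move=> p0; apply: (tobj_ext (f := idfun) (f' := \0)) => m n s t e e' {}x y /=.
case: (ltP m 0) => [m0|m0]; first by rewrite (bobj0 x m0) tpure0l.
have s0 : s < 0.
  by rewrite -(ltrD2l m) addr0 e; apply: lt_le_trans p0 m0.
by rewrite (bobj0 y s0) tpure0r.
Qed.

Lemma tdhdh p p' p'' q (e : p = p' + 1) (e' : p' = p'' + 1) (x : tobj p q) :
  tdh q e' (tdh q e x) = 0.
Proof.
apply: (tobj_ext (f := tdh q e' \o tdh q e) (f' := \0)).
move=> m n s t e1 e2 {}x y /=; rewrite tdhE linearD linearZ /= !tdhE.
rewrite !dhdh tpure0l tpure0r scaler0 add0r addr0.
rewrite (@ksign_pred (m + n) (m - 1 + n)); last by rewrite addrAC subrK.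
rewrite scaleNr (tpure_irr _ (tidx_predl (tidx_predr e1 e) e') _ e2).
by rewrite addNr.
Qed.

Lemma tdvdv p q q' q'' (e : q = q' + 1) (e' : q' = q'' + 1) (x : tobj p q) :
  tdv p e' (tdv p e x) = 0.
Proof.
apply: (tobj_ext (f := tdv p e' \o tdv p e) (f' := \0)).
move=> m n s t e1 e2 {}x y /=; rewrite tdvE linearD linearZ /= !tdvE.
rewrite !dvdv tpure0l tpure0r scaler0 add0r addr0.
rewrite (@ksign_pred (m + n) (m + (n - 1))); last by rewrite -addrA subrK.
rewrite scaleNr (tpure_irr _ e1 _ (tidx_predl (tidx_predr e2 e) e')).
by rewrite addNr.
Qed.

Let sign_cancel (V : lmodType k) (c : k) (a a' b b' d d' f f' : V) :
  a + a' = 0 -> b = b' -> d = d' -> f + f' = 0 ->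
  (a + - c *: b) + c *: (d + c *: f) +
  ((a' + - c *: d') + c *: (b' + c *: f')) = 0.
Proof.
move=> h <- <- h'; rewrite addrACA [X in X + _]addrACA h add0r.
rewrite -!scalerDr addrACA -scalerDr h' scaler0 addr0 [d + b]addrC.
by rewrite scaleNr addNr.
Qed.

Lemma tdvdh p p' q q' (e : p = p' + 1) (e' : q = q' + 1) (x : tobj p q) :
  tdv p' e' (tdh q e x) + tdh q' e (tdv p e' x) = 0.
Proof.
pose f1 : {linear tobj p q -> tobj p' q'} := tdv p' e' \o tdh q e.
pose f2 : {linear tobj p q -> tobj p' q'} := tdh q' e \o tdv p e'.
apply: (tobj_ext (f := f1 \+ f2) (f' := \0)).
move=> m n s t e1 e2 {}x y; rewrite /f1 /f2 /=.
rewrite tdhE tdvE !linearD !linearZ /= !tdhE !tdvE.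
rewrite (@ksign_pred (m + n) (m - 1 + n)); last by rewrite addrAC subrK.
rewrite (@ksign_pred (m + n) (m + (n - 1))); last by rewrite -addrA subrK.
apply: sign_cancel.
- by rewrite -tpureDl dvdh tpure0l.
- exact: tpure_irr.
- exact: tpure_irr.
- by rewrite -tpureDr dvdh tpure0r.
Qed.

Definition btensor : bicomplex k :=
  @Bicomplex k tobj (fun p p' q => @tdh p q p') (@tdv)
    tobj0 tdhdh tdvdv tdvdh.
End TensorObject.

#[global] Opaque tobj tpure tlift tdh tdv.

Arguments tpure {k X Y p q m n s t} e e' x y.

Section TensorMap.
Variables (k : comPzRingType) (X X' Y Y' : bicomplex k).
Variables (f : bimor X X') (g : bimor Y Y').

Lemma tmap_bilinear p q m n s t (e : m + s = p) (e' : n + t = q) :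
  bilinear2 (fun (x : X m n) (y : Y s t) =>
               tpure e e' (f m n x) (g s t y) : btensor X' Y' p q).
Proof.
by split=> [y a x x'|x a y y']; rewrite linearP ?tpure_linl ?tpure_linr.
Qed.

Definition tmap p q : {linear btensor X Y p q -> btensor X' Y' p q} :=
  tlift (@tmap_bilinear p q).

Lemma tmapE p q m n s t (e : m + s = p) (e' : n + t = q) x y :
  tmap p q (tpure e e' x y) = tpure e e' (f m n x) (g s t y).
Proof. exact: tliftE. Qed.

Lemma tmap_linear p q : linear (tmap p q).
Proof. exact: linearP. Qed.

Lemma tmap_dh p p' q (e : p = p' + 1) (x : btensor X Y p q) :
  tmap p' q (dh _ e x) = dh _ e (tmap p q x).
Proof.
pose F : {linear tobj X Y p q -> tobj X' Y' p' q} := tmap p' q \o tdh X Y q e.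
pose F' : {linear tobj X Y p q -> tobj X' Y' p' q} :=
    tdh X' Y' q e \o tmap p q.
apply: (tobj_ext (f := F) (f' := F')) => m n s t e1 e2 {}x y.
rewrite /F /F' /= tmapE !tdhE linearD linearZ /= !tmapE.
by rewrite !bmap_dh.
Qed.

Lemma tmap_dv p q q' (e : q = q' + 1) (x : btensor X Y p q) :
  tmap p q' (dv _ e x) = dv _ e (tmap p q x).
Proof.
pose F : {linear tobj X Y p q -> tobj X' Y' p q'} := tmap p q' \o tdv X Y p e.
pose F' : {linear tobj X Y p q -> tobj X' Y' p q'} :=
    tdv X' Y' p e \o tmap p q.
apply: (tobj_ext (f := F) (f' := F')) => m n s t e1 e2 {}x y.
rewrite /F /F' /= tmapE !tdvE linearD linearZ /= !tmapE.
by rewrite !bmap_dv.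
Qed.

Definition btensor_map : bimor (btensor X Y) (btensor X' Y') :=
  @Bimor k (btensor X Y) (btensor X' Y') (fun p q => tmap p q)
    tmap_linear tmap_dh tmap_dv.

Lemma btensor_mapE p q m n s t (e : m + s = p) (e' : n + t = q) x y :
  btensor_map p q (tpure e e' x y) = tpure e e' (f m n x) (g s t y).
Proof. exact: tmapE. Qed.
End TensorMap.

#[global] Opaque tmap.

Section TensorFunctor.
Variable k : comPzRingType.

Lemma btensor_map_id (X Y : bicomplex k) :
  btensor_map (bid X) (bid Y) = bid (btensor X Y).
Proof.
apply: bimor_eq => p q x.
apply: (tobj_ext (f := tmap (bid X) (bid Y) p q) (f' := idfun)).
by move=> m n s t e e' {}x y; rewrite tmapE.
Qed.

Lemma btensor_map_comp (X X' X'' Y Y' Y'' : bicomplex k)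
  (f' : bimor X' X'') (f : bimor X X') (g' : bimor Y' Y'') (g : bimor Y Y') :
  btensor_map (bcomp f' f) (bcomp g' g) =
  bcomp (btensor_map f' g') (btensor_map f g).
Proof.
apply: bimor_eq => p q x.
apply: (tobj_ext (f := tmap (bcomp f' f) (bcomp g' g) p q)
  (f' := tmap f' g' p q \o tmap f g p q)).
by move=> m n s t e e' {}x y; rewrite /= !tmapE.
Qed.
End TensorFunctor.

Section ZeroUnit.
Variable k : comPzRingType.

Definition zero_module : lmodType k := 'rV[k]_0.

Lemma zero_moduleP (x : zero_module) : x = 0.
Proof. by apply/rowP => -[]. Qed.

Definition bzero : bicomplex k.
Proof.
by refine (@Bicomplex k (fun _ _ => zero_module) (fun _ _ _ _ => \0)
  (fun _ _ _ _ => \0) _ _ _ _) => *; rewrite ?addr0 //; apply: zero_moduleP.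
Defined.

Lemma bzero_mor_linear (X : bicomplex k) p q :
  linear (fun _ : bzero p q => 0 : X p q).
Proof. by move=> a x y; rewrite scaler0 addr0. Qed.

Lemma bzero_mor_dh (X : bicomplex k) p p' q (e : p = p' + 1)
  (x : bzero p q) : 0 = dh X e (0 : X p q).
Proof. by rewrite linear0. Qed.

Lemma bzero_mor_dv (X : bicomplex k) p q q' (e : q = q' + 1)
  (x : bzero p q) : 0 = dv X e (0 : X p q).
Proof. by rewrite linear0. Qed.

Definition bzero_mor (X : bicomplex k) : bimor bzero X :=
  @Bimor k bzero X (fun p q _ => 0) (bzero_mor_linear X)
    (bzero_mor_dh X) (bzero_mor_dv X).

Definition unit_obj (p q : int) : lmodType k :=
  if (p == 0) && (q == 0) then (k^o : lmodType k) else zero_module.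

Lemma unit_obj0 p q (x : unit_obj p q) : p < 0 -> x = 0.
Proof.
move=> p0; move: x; rewrite /unit_obj (lt_eqF p0) /=; exact: zero_moduleP.
Qed.

Definition bunit : bicomplex k.
Proof.
by refine (@Bicomplex k unit_obj (fun _ _ _ _ => \0) (fun _ _ _ _ => \0)
  unit_obj0 _ _ _) => *; rewrite //= addr0.
Defined.
End ZeroUnit.

Section ModelStructure.
Variable k : comPzRingType.

Definition mclass := forall X Y : bicomplex k, bimor X Y -> Prop.

Definition has_lift (A B X Y : bicomplex k) (i : bimor A B) (p : bimor X Y) :=
  forall (u : bimor A X) (v : bimor B Y), bcomp p u = bcomp v i ->
  exists h : bimor B X, bcomp h i = u /\ bcomp p h = v.

Definition CE_weq : mclass := fun X Y f =>
  forall p q : int, 0 <= p -> bijective (HhHv_map f p q).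

Definition CE_fib : mclass := fun X Y f =>
  [/\ forall p q (y : Y p q), exists x, f p q x = y,
      forall p q : int, 0 < p ->
        forall y : Zv Y p q, exists x, Zv_map f p q x = y &
      forall p q, bijective (Hh_map f p q)].

Definition CE_cof : mclass := fun A B i =>
  forall (X Y : bicomplex k) (p : bimor X Y),
    CE_fib p -> CE_weq p -> has_lift i p.

Definition CE_triv_cof : mclass := fun A B i => CE_cof i /\ CE_weq i.

Definition CE_cofibrant (X : bicomplex k) := CE_cof (bzero_mor X).

Definition is_pushout (A B C P : bicomplex k) (f : bimor A B) (g : bimor A C)
    (i : bimor B P) (j : bimor C P) : Prop :=
  bcomp i f = bcomp j g /\
  forall (Q : bicomplex k) (u : bimor B Q) (v : bimor C Q),
    bcomp u f = bcomp v g ->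
    exists! w : bimor P Q, bcomp w i = u /\ bcomp w j = v.

(* Existence of pushouts, so that quantifying over all pushout squares   *)
(* below is not vacuous.                                                 *)
Section PushoutConstruction.
Variables (A B C : bicomplex k) (f : bimor A B) (g : bimor A C).

Definition po_adm p q (P : lmodType k) (b : B p q + C p q -> P) : Prop :=
  [/\ linear (fun x => b (inl x)), linear (fun y => b (inr y)) &
      forall a, b (inl (f p q a)) = b (inr (g p q a))].

Definition po_obj p q : lmodType k := umod (@po_adm p q).

Definition po_inl p q (x : B p q) : po_obj p q := um_gen (@po_adm p q) (inl x).
Definition po_inr p q (y : C p q) : po_obj p q := um_gen (@po_adm p q) (inr y).

Lemma po_inl_linear p q : linear (@po_inl p q).
Proof.
move=> a x y; apply/eqP; rewrite -subr_eq0; apply/eqP.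
pose s : seq (k * (B p q + C p q)) :=
  [:: (1, inl (a *: x + y)); (- a, inl x); (-1, inl y)].
have := @um_gen_eq k _ (@po_adm p q) s; rewrite /um_eval !big_cons !big_nil /=.
rewrite !scale1r !scaleN1r addr0 scaleNr opprD; apply=> P b [hb _ _].
by rewrite !big_cons big_nil /= hb scale1r scaleN1r addr0 scaleNr -opprD
  subrr.
Qed.

Lemma po_inr_linear p q : linear (@po_inr p q).
Proof.
move=> a x y; apply/eqP; rewrite -subr_eq0; apply/eqP.
pose s : seq (k * (B p q + C p q)) :=
  [:: (1, inr (a *: x + y)); (- a, inr x); (-1, inr y)].
have := @um_gen_eq k _ (@po_adm p q) s; rewrite /um_eval !big_cons !big_nil /=.
rewrite !scale1r !scaleN1r addr0 scaleNr opprD; apply=> P b [_ hb _].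
by rewrite !big_cons big_nil /= hb scale1r scaleN1r addr0 scaleNr -opprD
  subrr.
Qed.

HB.instance Definition _ p q :=
  GRing.isLinear.Build k (B p q) (po_obj p q) _ (@po_inl p q)
    (@po_inl_linear p q).
HB.instance Definition _ p q :=
  GRing.isLinear.Build k (C p q) (po_obj p q) _ (@po_inr p q)
    (@po_inr_linear p q).

Lemma po_glue p q (a : A p q) : po_inl (f p q a) = po_inr (g p q a).
Proof.
apply/eqP; rewrite -subr_eq0; apply/eqP.
pose s : seq (k * (B p q + C p q)) :=
  [:: (1, inl (f p q a)); (-1, inr (g p q a))].
have := @um_gen_eq k _ (@po_adm p q) s; rewrite /um_eval !big_cons !big_nil /=.
rewrite scale1r scaleN1r addr0; apply=> P b [_ _ hb].
by rewrite !big_cons big_nil /= hb scale1r scaleN1r addr0 subrr.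
Qed.

Lemma po_ext p q (P : lmodType k) (h h' : {linear po_obj p q -> P}) :
  (forall x, h (po_inl x) = h' (po_inl x)) ->
  (forall y, h (po_inr y) = h' (po_inr y)) -> h =1 h'.
Proof. by move=> hl hr; apply: um_ext => -[x|y]; [apply: hl|apply: hr]. Qed.

Section Lift.
Variables (p q : int) (P : lmodType k).
Variables (u : {linear B p q -> P}) (v : {linear C p q -> P}).
Hypothesis uv : forall a, u (f p q a) = v (g p q a).

Lemma po_lift_adm :
  po_adm (fun z : B p q + C p q =>
            match z with inl x => u x | inr y => v y end).
Proof. by split=> // a x y; rewrite linearP. Qed.

Definition po_lift : {linear po_obj p q -> P} := um_lift po_lift_adm.

Lemma po_lift_inl x : po_lift (po_inl x) = u x.
Proof. by rewrite /po_lift /= um_lift_gen. Qed.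
Lemma po_lift_inr y : po_lift (po_inr y) = v y.
Proof. by rewrite /po_lift /= um_lift_gen. Qed.
End Lift.

Opaque po_obj po_inl po_inr po_lift.

Lemma po_dh_subproof p p' q (e : p = p' + 1) a :
  (@po_inl p' q \o dh B e) (f p q a) = (@po_inr p' q \o dh C e) (g p q a).
Proof. by rewrite /= -!bmap_dh po_glue. Qed.

Lemma po_dv_subproof p q q' (e : q = q' + 1) a :
  (@po_inl p q' \o dv B e) (f p q a) = (@po_inr p q' \o dv C e) (g p q a).
Proof. by rewrite /= -!bmap_dv po_glue. Qed.

Definition po_dh p p' q (e : p = p' + 1) : {linear po_obj p q -> po_obj p' q} :=
  po_lift (@po_dh_subproof p p' q e).
Definition po_dv p q q' (e : q = q' + 1) : {linear po_obj p q -> po_obj p q'} :=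
  po_lift (@po_dv_subproof p q q' e).

Lemma po_dh_inl p p' q (e : p = p' + 1) x :
  po_dh q e (po_inl x) = po_inl (dh B e x).
Proof. by rewrite /po_dh po_lift_inl. Qed.
Lemma po_dh_inr p p' q (e : p = p' + 1) x :
  po_dh q e (po_inr x) = po_inr (dh C e x).
Proof. by rewrite /po_dh po_lift_inr. Qed.
Lemma po_dv_inl p q q' (e : q = q' + 1) x :
  po_dv p e (po_inl x) = po_inl (dv B e x).
Proof. by rewrite /po_dv po_lift_inl. Qed.
Lemma po_dv_inr p q q' (e : q = q' + 1) x :
  po_dv p e (po_inr x) = po_inr (dv C e x).
Proof. by rewrite /po_dv po_lift_inr. Qed.

Let poE := (po_dh_inl, po_dh_inr, po_dv_inl, po_dv_inr).
Opaque po_dh po_dv.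

Definition bpushout : bicomplex k.
Proof.
refine (@Bicomplex k po_obj po_dh po_dv _ _ _ _).
- by move=> p q x p0; apply: (po_ext (h := idfun) (h' := \0)) => y /=;
    rewrite (bobj0 y p0) linear0.
- move=> p p' p'' q e e' x.
  by apply: (po_ext (h := po_dh q e' \o po_dh q e) (h' := \0)) => y /=;
    rewrite !poE dhdh linear0.
- move=> p q q' q'' e e' x.
  by apply: (po_ext (h := po_dv p e' \o po_dv p e) (h' := \0)) => y /=;
    rewrite !poE dvdv linear0.
- move=> p p' q q' e e' x.
  pose h : {linear po_obj p q -> po_obj p' q'} := po_dv p' e' \o po_dh q e.
  pose h' : {linear po_obj p q -> po_obj p' q'} := po_dh q' e \o po_dv p e'.
  by apply: (po_ext (h := h \+ h') (h' := \0)) => y; rewrite /h /h' /=;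
    rewrite !poE -linearD dvdh linear0.
Defined.

Definition bpo_inl : bimor B bpushout.
Proof.
by refine (@Bimor k B bpushout (fun p q => @po_inl p q) po_inl_linear _ _) => *;
  rewrite /= poE.
Defined.

Definition bpo_inr : bimor C bpushout.
Proof.
by refine (@Bimor k C bpushout (fun p q => @po_inr p q) po_inr_linear _ _) => *;
  rewrite /= poE.
Defined.

Lemma bpushoutP : is_pushout f g bpo_inl bpo_inr.
Proof.
split=> [|Q u v uv]; first by apply: bimor_eq => p q x /=; apply: po_glue.
have uvE p q a : bmap_lin u p q (f p q a) = bmap_lin v p q (g p q a).
  exact: (congr1 (fun h : bimor A Q => h p q a) uv).
have w_dh p p' q (e : p = p' + 1) (x : bpushout p q) :
    po_lift (@uvE p' q) (dh bpushout e x) = dh Q e (po_lift (@uvE p q) x).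
  apply: (po_ext (h := po_lift (@uvE p' q) \o po_dh q e)
    (h' := dh Q e \o po_lift (@uvE p q))) => y /=.
    by rewrite /= poE !po_lift_inl /bmap_lin /= bmap_dh.
  by rewrite /= poE !po_lift_inr /bmap_lin /= bmap_dh.
have w_dv p q q' (e : q = q' + 1) (x : bpushout p q) :
    po_lift (@uvE p q') (dv bpushout e x) = dv Q e (po_lift (@uvE p q) x).
  apply: (po_ext (h := po_lift (@uvE p q') \o po_dv p e)
    (h' := dv Q e \o po_lift (@uvE p q))) => y /=.
    by rewrite /= poE !po_lift_inl /bmap_lin /= bmap_dv.
  by rewrite /= poE !po_lift_inr /bmap_lin /= bmap_dv.
have w_lin p q : linear (po_lift (@uvE p q)) by exact: linearP.
exists (@Bimor k bpushout Q (fun p q => po_lift (@uvE p q)) w_lin w_dh w_dv).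
split=> [|w' [wi wj]].
  by split; apply: bimor_eq => p q x /=; [apply: po_lift_inl|apply: po_lift_inr].
apply: bimor_eq => p q x.
apply: (po_ext (h := po_lift (@uvE p q)) (h' := bmap_lin w' p q)) => y.
  by rewrite po_lift_inl /bmap_lin /= -wi.
by rewrite po_lift_inr /bmap_lin /= -wj.
Qed.
End PushoutConstruction.

Section Transfinite.
Variables (d : Order.disp_t) (W : orderType d).
Variable D : W -> bicomplex k.
Variable t : forall i j : W, (i <= j)%O -> bimor (D i) (D j).

(* The predicate P cuts out a subdiagram: {i | i < j} at a limit j, and  *)
(* all of W for the composition of the whole sequence.                   *)
Definition is_cocone (P : pred W) (Y : bicomplex k)
    (c : forall i, P i -> bimor (D i) Y) : Prop :=
  forall i j (h : (i <= j)%O) (hi : P i) (hj : P j),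
    bcomp (c j hj) (t h) = c i hi.

Definition is_colimit (P : pred W) (Y : bicomplex k)
    (c : forall i, P i -> bimor (D i) Y) : Prop :=
  is_cocone c /\
  forall (Z : bicomplex k) (c' : forall i, P i -> bimor (D i) Z),
    is_cocone c' ->
    exists! u : bimor Y Z, forall i (hi : P i), bcomp u (c i hi) = c' i hi.

Definition is_succ (i j : W) : Prop :=
  (i < j)%O /\ forall l : W, (i < l)%O -> (j <= l)%O.

Definition is_limit (j : W) : Prop :=
  (exists i : W, (i < j)%O) /\ forall i : W, ~ is_succ i j.

Record transfinite_sequence (S : mclass) : Prop := {
  ts_wf : well_founded (fun i j : W => (i < j)%O);
  ts_id : forall i (h : (i <= i)%O), t h = bid (D i);
  ts_comp : forall i j l (h : (i <= j)%O) (h' : (j <= l)%O)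
    (h'' : (i <= l)%O), bcomp (t h') (t h) = t h'';
  ts_succ : forall i j (h : (i <= j)%O), is_succ i j -> S _ _ (t h);
  ts_limit : forall j, is_limit j ->
    is_colimit (P := fun i => (i < j)%O) (fun i (h : (i < j)%O) => t (ltW h)) }.
End Transfinite.

(* Ordinals are encoded as well-ordered types; i0 is the least element.  *)
Inductive transfinite_composition (S : mclass) : mclass :=
  TransfiniteComposition (d : Order.disp_t) (W : orderType d)
    (D : W -> bicomplex k)
    (t : forall i j : W, (i <= j)%O -> bimor (D i) (D j))
    (Y : bicomplex k) (c : forall i, bimor (D i) Y) (i0 : W) of
    transfinite_sequence t S & (forall i, (i0 <= i)%O) &
    is_colimit t (P := xpredT) (fun i _ => c i) :
  transfinite_composition S (c i0).

Inductive pushout_of (S : mclass) : mclass :=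
  PushoutOf (A B X Y : bicomplex k) (f : bimor A B) (u : bimor A X)
    (v : bimor B Y) (g : bimor X Y) of S _ _ f & is_pushout f u v g :
  pushout_of S g.

Inductive tensor_with_object (S : mclass) : mclass :=
  TensorWithObject (A B : bicomplex k) (f : bimor A B) (Z : bicomplex k) of
    S _ _ f :
  tensor_with_object S (btensor_map f (bid Z)).

(* The object P is any pushout of the span A (x) L <- A (x) K -> B (x) K, *)
(* and w is the pushout-product of f and g.                               *)
Definition pushout_product_axiom : Prop :=
  forall (A B K L : bicomplex k) (f : bimor A B) (g : bimor K L),
    CE_cof f -> CE_cof g ->
  forall (P : bicomplex k) (i : bimor (btensor B K) P)
    (j : bimor (btensor A L) P),
    is_pushout (btensor_map f (bid K)) (btensor_map (bid A) g) i j ->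
  forall w : bimor P (btensor B L),
    bcomp w i = btensor_map (bid B) g -> bcomp w j = btensor_map f (bid L) ->
    CE_cof w /\ (CE_weq f \/ CE_weq g -> CE_weq w).

(* Hovey's form of the unit axiom, where e is a cofibrant replacement of  *)
(* the unit; together with the pushout-product axiom this is what being   *)
(* a monoidal model category requires of a model structure on a closed    *)
(* symmetric monoidal category.                                           *)
Definition unit_axiom : Prop :=
  forall (Q : bicomplex k) (e : bimor Q (bunit k)),
    CE_cofibrant Q -> CE_fib e -> CE_weq e ->
  forall X : bicomplex k, CE_cofibrant X ->
    CE_weq (btensor_map e (bid X)) /\ CE_weq (btensor_map (bid X) e).

Definition monoid_axiom : Prop :=
  forall (X Y : bicomplex k) (g : bimor X Y),
    transfinite_composition (pushout_of (tensor_with_object CE_triv_cof)) g ->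
    CE_weq g.
End ModelStructure.

(* Main.v *)
(* The cofibrations are characterised without factorisations: f : A -> B is a
   cofibration iff, column by column and compatibly with d_v only, B is A plus a
   bicomplex C whose columns are projective relative to the vertical maps that
   are surjective on elements and on vertical cycles.  For the "only if" part,
   the functor forgetting d_h has a right adjoint M |-> (M_p x M_{p-1})_p, which
   sends such vertical maps to trivial fibrations.  For the "if" part, the kernel
   of a trivial fibration has H^h = 0 and H^h(Z^v) = 0, so lifts can be built one
   column at a time.

   Such an f is a weak equivalence iff H^h H^v(C) = 0, and then C is contractible
   in the following strong sense: there are t of bidegree (1,0) and s of
   bidegree (0,1) with [d_v,t] = 0 and [d_h,t] + [d_v,s] = 1.  These equations
   survive tensoring with any bicomplex, while relative projectivity survives
   tensor products.  Split cokernels are C (x) E for a pushout-product, C (x) Z for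
   f (x) Z, and do not change under pushouts, which gives the pushout-product
   axiom and makes pushouts of f (x) Z weak equivalences; the latter are closed
   under transfinite composition because directed colimits are computed on
   elements.  For the unit axiom, a trivial fibration Q -> k has a section, whose
   cokernel is again contractible. *)
From HB Require Import structures.
From mathcomp Require Import all_boot all_order all_algebra.
From mathcomp Require Import boolp.
Require Import Defs.

Set Implicit Arguments.
Unset Strict Implicit.
Unset Printing Implicit Defensive.

Import Order.TTheory GRing.Theory Num.Theory.
Local Open Scope ring_scope.

(** * Identities in additive groups *)

(** Over a general ring there is no Künneth formula, so the vanishing of H^h H^v(C) cannot be
    carried through a tensor product; operators and equations between them can. The obstacle to
    finding them is that q is unbounded: inside a column there is no place to start an induction.
    Relative projectivity replaces it by 1 = r + [d_v, s] with d_v r = r d_v = 0, valid for all q at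
    once; lifts are then chosen through vertical cycles on the r-part and arbitrarily on the rest.
    Induction runs over p only and starts from the zero columns p < 0. The equation [d_v, t] = 0
    makes 1 - [d_h, t] commute with d_v, and such a map, once it is zero on vertical homology, has
    the form [d_v, s]. Nothing is asked of [d_h, s]. Fibrations are surjective on vertical cycles
    only for p > 0, so column 0 has to be recovered from the weak equivalence. The cofree bicomplex
    serves a second purpose: since forgetting d_h is a left adjoint, pushouts keep their universal
    property for vertical maps, and splittings of pushouts are found without describing their
    elements. *)

Inductive zexpr := ZVar of nat | ZAdd of zexpr & zexpr | ZOpp of zexpr | ZZero.

Fixpoint zeval (V : zmodType) (env : seq V) (e : zexpr) : V :=
  match e with
  | ZVar n => nth 0 env n
  | ZAdd a b => zeval env a + zeval env b
  | ZOpp a => - zeval env a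
  | ZZero => 0
  end.

Fixpoint zcoef (e : zexpr) (i : nat) : int :=
  match e with
  | ZVar n => if n == i then 1 else 0
  | ZAdd a b => zcoef a i + zcoef b i
  | ZOpp a => - zcoef a i
  | ZZero => 0
  end.

Lemma zeval_zcoef (V : zmodType) (env : seq V) e :
  zeval env e = \sum_(i < size env) nth 0 env i *~ zcoef e i.
Proof.
elim: e => [n|a IHa b IHb|a IHa|] /=.
- have [lt_n|ge_n] := ltnP n (size env).
    rewrite (bigD1 (Ordinal lt_n)) //= eqxx mulr1z big1 ?addr0 // => i.
    case: (eqVneq n i) => [En /eqP[]|_ _]; last exact: mulr0z.
    by apply: val_inj; rewrite /= En.
  rewrite nth_default // big1 // => i _; case: eqVneq => [En|].
    by move: ge_n; rewrite En leqNgt ltn_ord.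
  by rewrite mulr0z.
- by rewrite IHa IHb -big_split; apply: eq_bigr => i _; rewrite mulrzDr.
- by rewrite IHa -sumrN; apply: eq_bigr => i _; rewrite mulrNz.
- by rewrite big1 // => i _; rewrite mulr0z.
Qed.

Lemma zeval_eq (V : zmodType) (env : seq V) e1 e2 :
  all (fun i => zcoef e1 i == zcoef e2 i) (iota 0 (size env)) ->
  zeval env e1 = zeval env e2.
Proof.
move=> /allP h; rewrite !zeval_zcoef; apply: eq_bigr => i _.
by rewrite (eqP (h i _)) // mem_iota ltn_ord.
Qed.

(** The dummy [match goal] makes [unify] run while a term is being built, so atoms are identified up
    to unification and not only syntactically. *)
Ltac zmod_find x env :=
  match env with
  | ?y :: _ => let _ := match goal with _ => unify x y end in constr:(0%N)
  | _ :: ?env' => let n := zmod_find x env' in constr:(S n)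
  end.
Ltac zmod_mem x env :=
  match env with
  | ?y :: _ => let _ := match goal with _ => unify x y end in constr:(true)
  | _ :: ?env' => zmod_mem x env'
  | _ => constr:(false)
  end.
Ltac zmod_vars t env :=
  lazymatch t with
  | @Algebra.add _ ?a ?b => let e := zmod_vars a env in zmod_vars b e
  | @Algebra.opp _ ?a => zmod_vars a env
  | @Algebra.zero _ => env
  | ?x => lazymatch zmod_mem x env with true => env | false => constr:(x :: env) end
  end.
Ltac zmod_expr t env :=
  lazymatch t with
  | @Algebra.add _ ?a ?b =>
    let e := zmod_expr a env in let e' := zmod_expr b env in constr:(ZAdd e e')
  | @Algebra.opp _ ?a => let e := zmod_expr a env in constr:(ZOpp e)
  | @Algebra.zero _ => constr:(ZZero)
  | ?x => let n := zmod_find x env in constr:(ZVar n)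
  end.

Ltac zmod_identity :=
  lazymatch goal with
  | |- @eq ?T ?a ?b =>
    let env := zmod_vars a (@nil T) in
    let env := zmod_vars b env in
    let e1 := zmod_expr a env in
    let e2 := zmod_expr b env in
    refine (@zeval_eq _ env e1 e2 _); vm_compute; reflexivity
  end.

(** * Weak equivalences on elements *)

Lemma bijective_of_inj_surj (T U : Type) (f : T -> U) :
  injective f -> (forall y, exists x, f x = y) -> bijective f.
Proof.
move=> fI fS; have [g gK] := choice fS.
by exists g => // x; apply: fI; rewrite gK.
Qed.

Lemma bijective_surj (T U : Type) (f : T -> U) :
  bijective f -> forall y, exists x, f x = y.
Proof. by case=> g _ gK y; exists (g y). Qed.

Lemma pred_eq (m m' : int) : m = m' + 1 -> m' = m - 1.
Proof. by move=> ->; rewrite addrK. Qed.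

Section HomologyElements.
Variables (k : comPzRingType) (C D : cplx k) (n m : int).
Variable f : {linear C n -> D m}.
Hypothesis fZ : forall x, x \in is_cycle C n -> f x \in is_cycle D m.
Hypothesis fB : forall z : cycle C n,
  is_boundary z -> is_boundary (@cycle_map k C D n m f fZ z).

Lemma homology_class_eq0 (E : cplx k) i (z : cycle E i) :
  qm_class (boundaries E i) z = 0 <-> is_boundary z.
Proof.
rewrite -[0](linear0 (qm_class (boundaries E i))) qm_eqP subr0.
by split.
Qed.

Lemma homology_map_bijP :
  bijective (homology_map fB) <->
  (forall z, is_boundary (cycle_map fZ z) -> is_boundary z) /\
  (forall w, exists z, is_boundary (w - cycle_map fZ z)).
Proof.
split=> [hb | [hI hS]].
  split=> [z hz | w].
    apply/homology_class_eq0; apply: (bij_inj hb); rewrite linear0.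
    by rewrite homology_mapE; apply/homology_class_eq0.
  have [u hu] := bijective_surj hb (qm_class _ w).
  exists (qm_repr u); apply/homology_class_eq0.
  by rewrite linearB /= -(homology_mapE fB) qm_reprK hu subrr.
apply: bijective_of_inj_surj => [u v|u].
  rewrite -[u]qm_reprK -[v]qm_reprK !homology_mapE => /qm_eqP h.
  by apply/qm_eqP/hI; rewrite linearB.
have [z hz] := hS (qm_repr u); exists (qm_class _ z).
rewrite homology_mapE -[RHS]qm_reprK; apply/qm_eqP.
by rewrite -opprB; apply: smemN.
Qed.
End HomologyElements.

Section ElementwiseHomology.
Variable k : comPzRingType.

(** Here and below the neighbouring indices are variables tied by equations, so that the statements
    apply at any bidegree without transports. *)
Definition hor_injective (X Y : bicomplex k) (f : bimor X Y) : Prop :=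
  forall (p p1 pm q : int) (e1 : p1 = p + 1) (em : p = pm + 1)
    (x : X p q) (z : Y p1 q),
  dh X em x = 0 -> f _ _ x = dh Y e1 z -> exists z', x = dh X e1 z'.

Definition hor_surjective (X Y : bicomplex k) (f : bimor X Y) : Prop :=
  forall (p p1 pm q : int) (e1 : p1 = p + 1) (em : p = pm + 1) (y : Y p q),
  dh Y em y = 0 ->
  exists x z, dh X em x = 0 /\ y = f _ _ x + dh Y e1 z.

(** H^h H^v is the second page of the spectral sequence that starts with vertical homology. A class
    is given by x with d_v x = 0 and d_h x = d_v y, and it vanishes when x = d_h z + d_v w with d_v
    z = 0. *)
Definition E2_injective (X Y : bicomplex k) (f : bimor X Y) : Prop :=
  forall (p p1 pm q q1 qm : int) (e1 : p1 = p + 1) (em : p = pm + 1)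
    (d1 : q1 = q + 1) (dm : q = qm + 1)
    (x : X p q) (y : X pm q1) (z : Y p1 q) (w : Y p q1),
  dv X dm x = 0 -> dh X em x = dv X d1 y ->
  dv Y dm z = 0 -> f _ _ x = dh Y e1 z + dv Y d1 w ->
  exists z' w', dv X dm z' = 0 /\ x = dh X e1 z' + dv X d1 w'.

Definition E2_surjective (X Y : bicomplex k) (f : bimor X Y) : Prop :=
  forall (p p1 pm q q1 qm : int) (e1 : p1 = p + 1) (em : p = pm + 1)
    (d1 : q1 = q + 1) (dm : q = qm + 1) (y : Y p q) (v : Y pm q1),
  dv Y dm y = 0 -> dh Y em y = dv Y d1 v ->
  exists x u z w, [/\ dv X dm x = 0, dh X em x = dv X d1 u, dv Y dm z = 0 &
    y = f _ _ x + dh Y e1 z + dv Y d1 w].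

Lemma Hh_map_bijP (X Y : bicomplex k) (f : bimor X Y) :
  (forall p q, bijective (Hh_map f p q)) <-> hor_injective f /\ hor_surjective f.
Proof.
split=> [h | [hI hS] p q].
  split=> p p1 pm q e1 em; have pmE := pred_eq em; subst pm p1.
    rewrite (eq_irrelevance em (predK p)) => x z hx hz.
    have [hI _] := (homology_map_bijP _).1 (h p q).
    have xZ : x \in is_cycle (row X q) p by apply/eqP.
    by have [|z' /= ->] := hI (Cycle xZ); [exists z | exists z'].
  rewrite (eq_irrelevance em (predK p)) => y hy.
  have [_ hS] := (homology_map_bijP _).1 (h p q).
  have yZ : y \in is_cycle (row Y q) p by apply/eqP.
  have [[x xZ] [z /= hz]] := hS (Cycle yZ).
  exists x, z; split; first exact/eqP.
  by rewrite -hz addrC subrK.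
apply/homology_map_bijP; split=> [[x xZ] [z /= hz] | [y yZ]].
  exact: hI _ _ _ _ erefl (predK p) x z (eqP xZ) hz.
have [x [z [xZ hz]]] := hS _ _ _ _ (erefl (p + 1)) (predK p) y (eqP yZ).
have {}xZ : x \in is_cycle (row X q) p by apply/eqP.
by exists (Cycle xZ), z; rewrite /= hz addrC addKr.
Qed.

Lemma Hv_class_eq0 (X : bicomplex k) p q (z : cycle (col X p) q) :
  qm_class (boundaries (col X p) q) z = 0 <->
  exists y, cyc_val z = dv X (erefl (q + 1)) y.
Proof. exact: homology_class_eq0. Qed.

Lemma Hv_row_cycleP (X : bicomplex k) p q (z : cycle (col X p) q) :
  (qm_class _ z : Hv_row X q p) \in is_cycle (Hv_row X q) p <->
  exists y, dh X (predK p) (cyc_val z) = dv X (erefl (q + 1)) y.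
Proof.
rewrite -[_ \in _]/(Hv_dh X q (predK p) (qm_class _ z) == 0) Hv_dhE.
by split=> [/eqP/Hv_class_eq0 // | h]; apply/eqP/Hv_class_eq0.
Qed.

Lemma Hv_row_boundaryP (X : bicomplex k) p q (z : cycle (col X p) q)
    (zP : (qm_class _ z : Hv_row X q p) \in is_cycle (Hv_row X q) p) :
  is_boundary (Cycle zP) <->
  exists y w, dv X (predK q) y = 0 /\
    cyc_val z = dh X (erefl (p + 1)) y + dv X (erefl (q + 1)) w.
Proof.
split=> [[u /=] | [y [w [yZ zE]]]].
  move=> /qm_eqP [w /= hw]; exists (cyc_val (qm_repr u)), w; split.
    exact/eqP/(cycP (qm_repr u)).
  by rewrite -hw addrC subrK.
have {}yZ : y \in is_cycle (col X (p + 1)) q by apply/eqP.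
exists (qm_class _ (Cycle yZ)).
apply: etrans (esym (Hv_dhE _ _)).
by apply/qm_eqP; exists w; rewrite /= zE addrC addKr.
Qed.

Lemma HhHv_map_bijP (X Y : bicomplex k) (f : bimor X Y) p q :
  bijective (HhHv_map f p q) <->
  (forall (z : cycle (col X p) q)
      (zP : (qm_class _ z : Hv_row X q p) \in is_cycle (Hv_row X q) p),
    (exists y w, dv Y (predK q) y = 0 /\
       f _ _ (cyc_val z) = dh Y (erefl (p + 1)) y + dv Y (erefl (q + 1)) w) ->
    is_boundary (Cycle zP)) /\
  (forall (w : cycle (col Y p) q)
     (wP : (qm_class _ w : Hv_row Y q p) \in is_cycle (Hv_row Y q) p),
   exists (z : cycle (col X p) q),
     (qm_class _ z : Hv_row X q p) \in is_cycle (Hv_row X q) p /\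
     exists y v, dv Y (predK q) y = 0 /\
       cyc_val w - f _ _ (cyc_val z) =
         dh Y (erefl (p + 1)) y + dv Y (erefl (q + 1)) v).
Proof.
have mapE z (zP : (qm_class _ z : Hv_row X q p) \in is_cycle (Hv_row X q) p)
    (fzP : (qm_class _ (cycle_map (@bmap_Zv _ _ _ f p q) z) : Hv_row Y q p)
       \in is_cycle (Hv_row Y q) p) :
    @cycle_map k (Hv_row X q) (Hv_row Y q) p p (Hv_map f p q)
      (@Hv_map_Zh _ _ _ f p q) (Cycle zP) = Cycle fzP.
  by apply: val_inj; apply: Hv_mapE.
have mapP z (zP : (qm_class _ z : Hv_row X q p) \in is_cycle (Hv_row X q) p) :
    (qm_class _ (cycle_map (@bmap_Zv _ _ _ f p q) z) : Hv_row Y q p)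
       \in is_cycle (Hv_row Y q) p.
  by rewrite -(Hv_mapE f) ; apply: Hv_map_Zh.
have subE (a b : cycle (col Y p) q)
    (aP : (qm_class _ a : Hv_row Y q p) \in is_cycle (Hv_row Y q) p)
    (bP : (qm_class _ b : Hv_row Y q p) \in is_cycle (Hv_row Y q) p)
    (abP : (qm_class _ (a - b) : Hv_row Y q p) \in is_cycle (Hv_row Y q) p) :
    Cycle aP - Cycle bP = Cycle abP.
  by apply: val_inj; rewrite /= linearB.
have subP (a b : cycle (col Y p) q)
    (aP : (qm_class _ a : Hv_row Y q p) \in is_cycle (Hv_row Y q) p)
    (bP : (qm_class _ b : Hv_row Y q p) \in is_cycle (Hv_row Y q) p) :
    (qm_class _ (a - b) : Hv_row Y q p) \in is_cycle (Hv_row Y q) p.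
  by rewrite linearB rpredB.
split=> [/homology_map_bijP [hI hS] | [hI hS]]; [|apply/homology_map_bijP].
  split=> [z zP h | w wP].
    apply: hI; rewrite (mapE _ _ (mapP _ zP)); apply/Hv_row_boundaryP.
    exact: h.
  have [[u uP]] := hS (Cycle wP); move: uP; rewrite -[u]qm_reprK => uP.
  rewrite (mapE _ _ (mapP _ uP)) (subE _ _ _ _ (subP _ _ wP (mapP _ uP))).
  by move=> /Hv_row_boundaryP h; exists (qm_repr u).
split=> [[u uP] | [w wP]].
  move: uP; rewrite -[u]qm_reprK => uP.
  by rewrite (mapE _ _ (mapP _ uP)) => /Hv_row_boundaryP h; apply: hI.
move: wP; rewrite -[w]qm_reprK => wP.
have [z [zP h]] := hS _ wP; exists (Cycle zP).
by rewrite (mapE _ _ (mapP _ zP)) (subE _ _ _ _ (subP _ _ wP (mapP _ zP)));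
  apply/Hv_row_boundaryP.
Qed.

Lemma CE_weqP (X Y : bicomplex k) (f : bimor X Y) :
  CE_weq f <-> E2_injective f /\ E2_surjective f.
Proof.
split=> [h | [hI hS] p q _].
  split=> p p1 pm q q1 qm e1 em d1 dm; have pmE := pred_eq em;
      have qmE := pred_eq dm; subst pm p1 qm q1;
      rewrite (eq_irrelevance em (predK p)) (eq_irrelevance dm (predK q)).
    (* [CE_weq] speaks only of p >= 0; in negative columns every element is 0. *)
    move=> x y z w hx hy hz fx; case: (ltP p 0) => [p0 | p0].
      exists 0, 0; rewrite !linear0 addr0; split=> //; exact: bobj0.
    have [hI _] := (HhHv_map_bijP f p q).1 (h p q p0).
    have xZ : x \in is_cycle (col X p) q by apply/eqP.
    have xP := (Hv_row_cycleP (Cycle xZ)).2 (ex_intro _ y hy).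
    by apply/(Hv_row_boundaryP xP); apply: hI; exists z, w.
  move=> y v hy hv; case: (ltP p 0) => [p0 | p0].
    exists 0, 0, 0, 0; rewrite !linear0 !addr0; split=> //; exact: bobj0.
  have [_ hS] := (HhHv_map_bijP f p q).1 (h p q p0).
  have yZ : y \in is_cycle (col Y p) q by apply/eqP.
  have yP := (Hv_row_cycleP (Cycle yZ)).2 (ex_intro _ v hv).
  have [[x xZ] [/Hv_row_cycleP [u hu] [z [w [hz hw]]]]] := hS _ yP.
  exists x, u, z, w; split=> //; first exact/eqP.
  by rewrite -addrA -hw addrC subrK.
apply/HhHv_map_bijP; split=> [[x xZ] xP [z [w [hz hw]]] | [y yZ] yP].
  have /Hv_row_cycleP [y hy] := xP; apply/Hv_row_boundaryP.
  exact: (hI _ _ _ _ _ _ erefl (predK p) erefl (predK q) x y z w (eqP xZ)).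
have /Hv_row_cycleP [v hv] := yP.
have [x [u [z [w [hx hu hz hw]]]]] := hS _ _ _ _ _ _ (erefl (p + 1)) (predK p)
  (erefl (q + 1)) (predK q) y v (eqP yZ) hv.
have xZ : x \in is_cycle (col X p) q by apply/eqP.
exists (Cycle xZ); split; first by apply/Hv_row_cycleP; exists u.
by exists z, w; split=> //; apply/eqP; rewrite /= subr_eq hw -addrA addrC.
Qed.
End ElementwiseHomology.

(** * Vertical maps and the cofree bicomplex *)

Definition linear_of (k : comPzRingType) (U V : lmodType k) (f : U -> V)
    (fl : linear f) : {linear U -> V} :=
  HB.pack f (GRing.isLinear.Build k U V _ f fl).

Lemma dv_dh (k : comPzRingType) (X : bicomplex k) p p' q q' (e : p = p' + 1)
    (d : q = q' + 1) (x : X p q) :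
  dv X d (dh X e x) = - dh X e (dv X d x).
Proof. by apply/eqP; rewrite -addr_eq0 dvdh. Qed.

Lemma dh_dv (k : comPzRingType) (X : bicomplex k) p p' q q' (e : p = p' + 1)
    (d : q = q' + 1) (x : X p q) :
  dh X e (dv X d x) = - dv X d (dh X e x).
Proof. by rewrite dv_dh opprK. Qed.

Section VerticalMaps.
Variable k : comPzRingType.

Record vmor (X Y : bicomplex k) := Vmor {
  vmap :> forall p q, {linear X p q -> Y p q};
  vmap_dv : forall p q q' (e : q = q' + 1) (x : X p q),
    vmap p q' (dv X e x) = dv Y e (vmap p q x) }.

Definition vert (X Y : bicomplex k) (f : bimor X Y) : vmor X Y :=
  @Vmor X Y (bmap_lin f) (@bmap_dv k X Y f).

Lemma vcomp_dv (X Y Z : bicomplex k) (g : vmor Y Z) (f : vmor X Y)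
    p q q' (e : q = q' + 1) (x : X p q) :
  (g p q' \o f p q') (dv X e x) = dv Z e ((g p q \o f p q) x).
Proof. by rewrite /= !vmap_dv. Qed.

Definition vcomp (X Y Z : bicomplex k) (g : vmor Y Z) (f : vmor X Y) :=
  Vmor (vcomp_dv g f).

Lemma vadd_dv (X Y : bicomplex k) (f g : vmor X Y)
    p q q' (e : q = q' + 1) (x : X p q) :
  (f p q' \+ g p q') (dv X e x) = dv Y e ((f p q \+ g p q) x).
Proof. by rewrite /= !vmap_dv linearD. Qed.

Definition vadd (X Y : bicomplex k) (f g : vmor X Y) := Vmor (vadd_dv f g).

Lemma vzero_dv (X Y : bicomplex k) p q q' (e : q = q' + 1) (x : X p q) :
  (\0 : {linear X p q' -> Y p q'}) (dv X e x) =
  dv Y e ((\0 : {linear X p q -> Y p q}) x).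
Proof. by rewrite /= linear0. Qed.

Definition vzero (X Y : bicomplex k) := Vmor (@vzero_dv X Y).

Definition vepi (M N : bicomplex k) (e : vmor M N) : Prop :=
  (forall p q (y : N p q), exists x, e p q x = y) /\
  (forall p q q' (d : q = q' + 1) (y : N p q), dv N d y = 0 ->
    exists x, dv M d x = 0 /\ e p q x = y).

Definition hcast (M : bicomplex k) p p' q (e : p = p') :
    {linear M p q -> M p' q} :=
  match e in _ = p'' return {linear M p q -> M p'' q} with
  | erefl => idfun end.

Lemma hcast_id (M : bicomplex k) p q (e : p = p) (x : M p q) : hcast M q e x = x.
Proof. by rewrite (eq_irrelevance e erefl). Qed.

Lemma hcastK (M : bicomplex k) p p' q (e : p = p') (e' : p' = p) (x : M p q) :
  hcast M q e' (hcast M q e x) = x.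
Proof. by subst p'; rewrite !hcast_id. Qed.

Lemma hcast_dv (M : bicomplex k) p p' q q' (e : p = p') (d : q = q' + 1)
    (x : M p q) :
  hcast M q' e (dv M d x) = dv M d (hcast M q e x).
Proof. by subst p'. Qed.

End VerticalMaps.

(* The right adjoint of the functor forgetting the horizontal differential. *)
Section Cofree.
Variables (k : comPzRingType) (M : bicomplex k).

Definition cofree_obj (p q : int) : lmodType k := (M p q * M (p - 1) q)%type.

Lemma cofree_dh_linear p p' q (e : p = p' + 1) :
  linear (fun x : cofree_obj p q =>
    (hcast M q (esym (pred_eq e)) x.2, 0) : cofree_obj p' q).
Proof.
move=> a x y; apply: injective_projections; first exact: linearP.
by rewrite /= scaler0 addr0.
Qed.

(** The sign on the second factor makes the differentials anticommute, because d_h moves that factor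
    to the first. *)
Lemma cofree_dv_linear p q q' (e : q = q' + 1) :
  linear (fun x : cofree_obj p q =>
    (dv M e x.1, - dv M e x.2) : cofree_obj p q').
Proof.
move=> a x y; apply: injective_projections; first exact: linearP.
by rewrite /= linearP opprD scalerN.
Qed.

Definition cofree_dh p p' q (e : p = p' + 1) := linear_of (@cofree_dh_linear p p' q e).
Definition cofree_dv p q q' (e : q = q' + 1) := linear_of (@cofree_dv_linear p q q' e).

Definition cofree : bicomplex k.
Proof.
refine (@Bicomplex k cofree_obj cofree_dh cofree_dv _ _ _ _).
- move=> p q [x y] p0; rewrite (bobj0 x p0) (bobj0 y) //.
  by apply: lt_trans p0; rewrite gtrDl.
- by move=> p p' p'' q e e' x; apply: injective_projections; rewrite /= ?linear0.
- by move=> p q q' q'' e e' x; apply: injective_projections;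
    rewrite /= ?linearN !dvdv /= ?oppr0.
- move=> p p' q q' e e' x; apply: injective_projections; rewrite /= ?linear0.
    by rewrite linearN hcast_dv subrr.
  by rewrite addr0.
Defined.

Lemma cofree_dhE p p' q (e : p = p' + 1) (x : cofree p q) :
  dh cofree e x = (hcast M q (esym (pred_eq e)) x.2, 0).
Proof. by []. Qed.

Lemma cofree_dvE p q q' (e : q = q' + 1) (x : cofree p q) :
  dv cofree e x = (dv M e x.1, - dv M e x.2).
Proof. by []. Qed.

Definition cofree_counit : vmor cofree M.
Proof.
by refine (@Vmor k cofree M (fun p q => fst : {linear cofree_obj p q -> M p q}) _).
Defined.

Variable A : bicomplex k.

Lemma cofree_lift_linear (f : vmor A M) p q :
  linear (fun a : A p q => (f p q a, f (p - 1) q (dh A (predK p) a)) : cofree p q).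
Proof. by move=> c x y; rewrite !linearP. Qed.

Definition cofree_lift (f : vmor A M) : bimor A cofree.
Proof.
refine (@Bimor k A cofree (fun p q => _) (cofree_lift_linear f) _ _).
- move=> p p' q e x; rewrite cofree_dhE dhdh linear0; congr (_, _).
  have pE := pred_eq e; subst p'.
  by rewrite /= hcast_id (eq_irrelevance e (predK p)).
- move=> p q q' e x; rewrite cofree_dvE !vmap_dv /=; congr (_, _).
  rewrite -vmap_dv -linearN; congr (f _ _ _).
  exact: dh_dv.
Defined.

Lemma cofree_liftE (f : vmor A M) p q x :
  cofree_lift f p q x = (f p q x, f (p - 1) q (dh A (predK p) x)).
Proof. by []. Qed.

(** The second component of u x is the first component of d_h (u x) = u (d_h x). *)
Lemma cofree_unique (u v : bimor A cofree) :
  (forall p q x, (u p q x).1 = (v p q x).1) -> u = v.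
Proof.
move=> uv; apply: bimor_eq => p q x.
have h (w : bimor A cofree) : w p q x = ((w p q x).1, (w _ _ (dh A (predK p) x)).1).
  by rewrite bmap_dh cofree_dhE /= hcast_id; case: (w p q x).
by rewrite h [RHS]h !uv.
Qed.
End Cofree.

Section CofreeFibration.
Variables (k : comPzRingType) (M N : bicomplex k) (e : vmor M N).

Definition cofree_map : bimor (cofree M) (cofree N) :=
  cofree_lift (vcomp e (cofree_counit M)).

Lemma cofree_mapE p q x :
  cofree_map p q x = (e p q x.1, e (p - 1) q x.2).
Proof.
by rewrite /cofree_map cofree_liftE /= hcast_id.
Qed.

(** The kernel of d_h in column p is the first factor L_p, which is hit by the second factor of
    column p + 1. *)
Lemma cofree_hor_exact (L : bicomplex k) p p1 pm q (e1 : p1 = p + 1)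
    (em : p = pm + 1) (x : cofree L p q) :
  dh _ em x = 0 -> exists z, x = dh _ e1 z.
Proof.
case: x => x x'; rewrite cofree_dhE => -[] /= h.
have {}h : x' = 0.
  have pE := pred_eq em; subst pm.
  by move: h; rewrite hcast_id.
rewrite h; subst p1; have pE : p = p + 1 - 1 by rewrite addrK.
by exists (0, hcast L q pE x); rewrite /= hcastK.
Qed.

Lemma cofree_E2_exact (L : bicomplex k) p p1 pm q q1 qm (e1 : p1 = p + 1)
    (em : p = pm + 1) (d1 : q1 = q + 1) (dm : q = qm + 1)
    (x : cofree L p q) (y : cofree L pm q1) :
  dv _ dm x = 0 -> dh _ em x = dv _ d1 y ->
  exists z w, dv _ dm z = 0 /\ x = dh _ e1 z + dv _ d1 w.
Proof.
case: x => x x'; rewrite cofree_dvE => -[/= dx _].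
move=> -[hx _].
have pE := pred_eq em; subst pm; rewrite hcast_id in hx.
subst p1; have pE : p = p + 1 - 1 by rewrite addrK.
(* The second component x' of the element is d_v y.1; the minus sign compensates the one in d_v on
   the second factor. *)
exists (0, hcast L q pE x), (0, - y.1); split.
  by rewrite /= linear0 -hcast_dv dx linear0 oppr0.
apply: injective_projections; rewrite /=.
  by rewrite linear0 addr0 hcastK.
by rewrite linearN opprK hx add0r.
Qed.

Lemma cofree_map_fib : vepi e -> CE_fib cofree_map.
Proof.
move=> [eS eZ]; split.
- move=> p q [y y']; have [x hx] := eS _ _ y; have [x' hx'] := eS _ _ y'.
  by exists (x, x'); rewrite cofree_mapE /= hx hx'.
- move=> p q _ [[y y'] yP]; have := eqP yP.
  rewrite -[cd _ _ _]/(dv (cofree N) (predK q) (y, y')) cofree_dvE.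
  move=> -[/= dy /eqP]; rewrite oppr_eq0 => /eqP dy'.
  have [x [dx hx]] := eZ _ _ _ _ _ dy; have [x' [dx' hx']] := eZ _ _ _ _ _ dy'.
  have xP : ((x, x') : cofree M p q) \in is_cycle (col (cofree M) p) q.
    apply/eqP; rewrite -[LHS]/(dv (cofree M) (predK q) (x, x')) cofree_dvE.
    by rewrite /= dx dx' oppr0.
  exists (Cycle xP); apply: val_inj.
  by apply: etrans (cofree_mapE _) _; rewrite /= hx hx'.
- apply/Hh_map_bijP; split=> p p1 pm q e1 em.
    by move=> x _ hx _; apply: (cofree_hor_exact _ hx).
  move=> y /(cofree_hor_exact e1) [z ->]; exists 0, z.
  by rewrite !linear0 add0r.
Qed.

Lemma cofree_map_weq : CE_weq cofree_map.
Proof.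
apply/CE_weqP; split=> p p1 pm q q1 qm e1 em d1 dm.
  by move=> x y _ _ dx hx _ _; apply: (cofree_E2_exact e1 dx hx).
move=> y v dy /(cofree_E2_exact e1 dy) [z [w [dz ->]]].
by exists 0, 0, z, w; rewrite !linear0 add0r.
Qed.
End CofreeFibration.

Section VerticalUniversal.
Variable k : comPzRingType.

(** Transpose the square along the adjunction: its right leg becomes [cofree_map e], a trivial
    fibration, and the counit turns the lift back into a vertical map. *)
Lemma cof_vertical_lift (A B M N : bicomplex k) (f : bimor A B) (e : vmor M N)
    (u : vmor A M) (v : vmor B N) :
  CE_cof f -> vepi e ->
  (forall p q x, e p q (u p q x) = v p q (f p q x)) ->
  exists h : vmor B M, (forall p q x, h p q (f p q x) = u p q x) /\
    (forall p q x, e p q (h p q x) = v p q x).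
Proof.
move=> fC eE uv.
have sq : bcomp (cofree_map e) (cofree_lift u) = bcomp (cofree_lift v) f.
  apply: cofree_unique => p q x.
  by rewrite [cofree_map]lock /= -lock cofree_mapE /= uv.
have [h [hf he]] := fC _ _ _ (cofree_map_fib eE) (@cofree_map_weq _ _ _ e) _ _ sq.
exists (vcomp (cofree_counit M) (vert h)); split=> p q x.
  by rewrite -[RHS]/((cofree_lift u p q x).1) -hf.
by rewrite -[RHS]/((cofree_lift v p q x).1) -he.
Qed.

Variables (A B C P : bicomplex k) (f : bimor A B) (g : bimor A C).
Variables (i : bimor B P) (j : bimor C P).
Hypothesis poP : is_pushout f g i j.

(** Vertical maps P -> Q are morphisms from P to the cofree bicomplex on Q, so the pushout property
    holds for vertical maps too; [pushout_vext] is the uniqueness half. *)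
Lemma pushout_vlift (Q : bicomplex k) (u : vmor B Q) (v : vmor C Q) :
  (forall p q x, u p q (f p q x) = v p q (g p q x)) ->
  exists w : vmor P Q, (forall p q x, w p q (i p q x) = u p q x) /\
    (forall p q x, w p q (j p q x) = v p q x).
Proof.
move=> uv; have [_ pU] := poP.
have sq : bcomp (cofree_lift u) f = bcomp (cofree_lift v) g.
  by apply: cofree_unique => p q x; rewrite /= uv.
have [w [[wi wj] _]] := pU _ _ _ sq.
exists (vcomp (cofree_counit Q) (vert w)); split=> p q x.
  by rewrite -[RHS]/((cofree_lift u p q x).1) -wi.
by rewrite -[RHS]/((cofree_lift v p q x).1) -wj.
Qed.

Lemma pushout_vext (Q : bicomplex k) (w w' : vmor P Q) :
  (forall p q x, w p q (i p q x) = w' p q (i p q x)) ->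
  (forall p q x, w p q (j p q x) = w' p q (j p q x)) ->
  forall p q x, w p q x = w' p q x.
Proof.
move=> wi wj p q x; have [ij pU] := poP.
have sq : bcomp (bcomp (cofree_lift w) i) f = bcomp (bcomp (cofree_lift w) j) g.
  apply: bimor_eq => a b c.
  have := congr1 (fun h : bimor A P => h a b c) ij.
  by rewrite [cofree_lift]lock /= => ->.
have [w0 [_ uniq_w]] := pU _ _ _ sq.
have w0E : w0 = cofree_lift w by apply: uniq_w.
have w0E' : w0 = cofree_lift w'.
  by apply: uniq_w; split; apply: cofree_unique => a b c /=; rewrite ?wi ?wj.
by rewrite -[LHS]/((cofree_lift w p q x).1) -w0E w0E'.
Qed.
End VerticalUniversal.

(** * Projective modules and vertically projective bicomplexes *)

Section Projective.
Variable k : comPzRingType.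

(* Asking only that the image of b lie in the image of e, rather than that   *)
(* e be surjective, avoids passing to pullbacks.                             *)
Definition projective (P : lmodType k) : Prop :=
  forall (M N : lmodType k) (e : {linear M -> N}) (b : {linear P -> N}),
  (forall x, exists m, e m = b x) ->
  exists l : {linear P -> M}, forall x, e (l x) = b x.

(* The basis consists of the nonzero elements of V, so that freemod 0 = 0. *)
Definition freemod_adm (V P : lmodType k) (b : V -> P) : Prop := b 0 = 0.

Definition freemod (V : lmodType k) : lmodType k := umod (@freemod_adm V).

Definition freegen (V : lmodType k) (v : V) : freemod V :=
  um_gen (@freemod_adm V) v.

Lemma freegen0 (V : lmodType k) : freegen (0 : V) = 0.
Proof.
have := @um_gen_eq k _ (@freemod_adm V) [:: (1, 0)].
rewrite /um_eval big_seq1 scale1r; apply=> P b b0.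
by rewrite big_seq1 scale1r.
Qed.

Lemma freelift_subproof (V P : lmodType k) (b : V -> P) :
  freemod_adm (fun v => if v == 0 then 0 else b v).
Proof. by rewrite /freemod_adm eqxx. Qed.

Definition freelift (V P : lmodType k) (b : V -> P) : {linear freemod V -> P} :=
  um_lift (freelift_subproof b).

Lemma freeliftE (V P : lmodType k) (b : V -> P) v : v != 0 ->
  freelift b (freegen v) = b v.
Proof. by move=> /negbTE v0; rewrite /freelift /= um_lift_gen v0. Qed.

Lemma freelift0E (V P : lmodType k) (b : V -> P) v : b 0 = 0 ->
  freelift b (freegen v) = b v.
Proof.
move=> b0; have [->|] := eqVneq v 0; last exact: freeliftE.
by rewrite freegen0 linear0.
Qed.

Lemma freemod_ext (V P : lmodType k) (f g : {linear freemod V -> P}) :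
  (forall v, v != 0 -> f (freegen v) = g (freegen v)) -> f =1 g.
Proof.
move=> fg; apply: um_ext => v; have [->|/fg //] := eqVneq v 0.
by rewrite -[um_gen _ _]/(freegen 0) freegen0 !linear0.
Qed.

#[global] Opaque freemod freegen freelift.

(** This makes the projective cover vanish in negative columns, and is the reason for leaving 0 out
    of the basis. *)
Lemma freemod_eq0 (V : lmodType k) (x : freemod V) :
  (forall v : V, v = 0) -> x = 0.
Proof.
move=> V0; apply: (freemod_ext (f := idfun) (g := \0)) => v.
by rewrite (V0 v) eqxx.
Qed.

Lemma projective_free (V : lmodType k) : projective (freemod V).
Proof.
move=> M N e b /(_ (freegen _)) eb; have [m hm] := choice eb.
exists (freelift m) => x.
apply: (freemod_ext (f := e \o freelift m)) => v v0.
by rewrite /= freeliftE ?hm.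
Qed.

Lemma projective_retract (P Q : lmodType k) (i : {linear P -> Q})
    (r : {linear Q -> P}) :
  (forall x, r (i x) = x) -> projective Q -> projective P.
Proof.
move=> ri QP M N e b eb; have [|l hl] := QP M N e (b \o r).
  by move=> x; apply: eb.
by exists (l \o i) => x; rewrite /= hl /= ri.
Qed.

Lemma projective_cover (P : lmodType k) : projective P ->
  exists s : {linear P -> freemod P}, forall x, freelift id (s x) = x.
Proof.
move=> PP; have [|s hs] := PP _ _ (freelift (@id P)) idfun.
  by move=> x; exists (freegen x); rewrite freelift0E.
by exists s.
Qed.

Lemma inl_linear (U V : lmodType k) : linear (fun x : U => (x, 0 : V)).
Proof.
by move=> a x y; apply: injective_projections; rewrite //= scaler0 addr0.
Qed.

Lemma inr_linear (U V : lmodType k) : linear (fun x : V => (0 : U, x)).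
Proof.
by move=> a x y; apply: injective_projections; rewrite //= scaler0 addr0.
Qed.

Lemma projective_pair (U V : lmodType k) :
  projective U -> projective V -> projective (U * V)%type.
Proof.
move=> UP VP M N e b eb.
have [|l hl] := UP _ _ e (b \o linear_of (@inl_linear U V)).
  by move=> x; apply: eb.
have [|m hm] := VP _ _ e (b \o linear_of (@inr_linear U V)).
  by move=> x; apply: eb.
exists ((l \o fst) \+ (m \o snd)) => -[x y] /=.
rewrite linearD hl hm /= -linearD; congr (b _).
by apply: injective_projections; rewrite /= ?addr0 ?add0r.
Qed.

Lemma projective_dsum (I : choiceType) (M : I -> lmodType k) :
  (forall i, projective (M i)) -> projective (dsum M).
Proof.
move=> MP A N e b eb.
have H i : {l : {linear M i -> A} | forall x, e (l x) = b (dsum_in x)}.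
  by apply/cid/(MP i _ _ e (b \o @dsum_in _ _ _ i)) => x; apply: eb.
exists (dsum_lift (fun i => projT1 (H i))) => x.
apply: (dsum_ext (f := e \o dsum_lift (fun i => projT1 (H i)))) => i {}x /=.
by rewrite dsum_liftE; case: (H i).
Qed.

Section FreeBilinear.
Variables (U V M : lmodType k) (m : U -> V -> M).

Definition free_bilin (x : freemod U) (y : freemod V) : M :=
  freelift (fun u => freelift (m u) y) x.

Lemma free_bilinP : bilinear2 free_bilin.
Proof.
split=> [y|x a y y']; first exact: linearP.
pose g z : {linear freemod U -> M} := freelift (fun u => freelift (m u) z).
apply: (freemod_ext (f := g (a *: y + y')) (g := a \*: g y \+ g y')) => u u0.
by rewrite /g /= !freeliftE // linearP.
Qed.

Lemma free_bilin_gen u v : u != 0 -> v != 0 ->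
  free_bilin (freegen u) (freegen v) = m u v.
Proof. by move=> u0 v0; rewrite /free_bilin !freeliftE. Qed.
End FreeBilinear.

Lemma free_bilin_ext (U V M : lmodType k) (f g : freemod U -> freemod V -> M) :
  bilinear2 f -> bilinear2 g ->
  (forall u v, u != 0 -> v != 0 ->
     f (freegen u) (freegen v) = g (freegen u) (freegen v)) ->
  forall x y, f x y = g x y.
Proof.
move=> [f1 f2] [g1 g2] fg x y.
apply: (freemod_ext (f := linear_of (f2 x)) (g := linear_of (g2 x))) => v v0 /=.
apply: (freemod_ext (f := linear_of (f1 (freegen v)))
  (g := linear_of (g1 (freegen v)))) => u u0 /=.
exact: fg.
Qed.

(** U and V are retracts of free modules. Lifts are chosen for the pure tensors, extended bilinearly
    from pairs of generators, and restricted along the two sections; the result is checked on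
    generators after writing x and y as images of s x and t y. *)
Lemma projective_tensor (U V : lmodType k) :
  projective U -> projective V -> projective (tensor U V).
Proof.
move=> UP VP M N e b eb.
have [s hs] := projective_cover UP; have [t ht] := projective_cover VP.
have H u : exists m : V -> M, forall v, e (m v) = b (tmk u v).
  by have [m hm] := choice (fun v => eb (tmk u v)); exists m.
have {H} [m hm] := choice H.
have [t1 t2] := tmk_bilinear U V.
have [m1 m2] := free_bilinP m.
have lP : bilinear2 (fun x y => free_bilin m (s x) (t y)).
  by split=> [y|x] a z z'; rewrite linearP ?m1 ?m2.
exists (tensor_lift lP) => x.
apply: (tensor_ext (f := e \o tensor_lift lP) (f' := b)) => {}x y /=.
rewrite tensor_liftE -{2}[x]hs -{2}[y]ht.
apply: (free_bilin_ext (f := fun x y => e (free_bilin m x y))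
   (g := fun x y => b (tmk (freelift id x) (freelift id y)))).
- by split=> [z|z] a u u'; rewrite ?m1 ?m2 linearP.
- by split=> [z|z] a u u'; rewrite linearP ?t1 ?t2 linearP.
- by move=> u v u0 v0 /=; rewrite free_bilin_gen // !freeliftE.
Qed.

Lemma projective_regular : projective (k^o : lmodType k).
Proof.
move=> M N e b eb; have [m hm] := eb 1.
have lP : linear (fun x : k^o => x *: m).
  by move=> a x y; rewrite scalerDl scalerA.
exists (linear_of lP) => x; rewrite /= linearZ hm -linearZ.
by congr (b _); rewrite /GRing.scale /= mulr1.
Qed.

Lemma projective_zero_module : projective (zero_module k).
Proof.
move=> M N e b _; exists (\0) => x.
by rewrite (zero_moduleP x) !linear0.
Qed.
End Projective.

(** * Splitting the columns by vertical homotopies *)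

Section VerticallyProjective.
Variable k : comPzRingType.

Definition vraise (X : bicomplex k) : Type :=
  forall p q q', q = q' + 1 -> {linear X p q' -> X p q}.

(* s contracts each column onto a complex with zero differential. *)
Definition vhodge (X : bicomplex k) (s : vraise X) (r : vmor X X) : Prop :=
  [/\ forall p q q' (d : q = q' + 1) x, dv X d (r p q x) = 0,
      forall p q q' (d : q = q' + 1) (x : X p q), r p q' (dv X d x) = 0 &
      forall p q q1 qm (d1 : q1 = q + 1) (dm : q = qm + 1) (x : X p q),
        dv X d1 (s p _ _ d1 x) + s p _ _ dm (dv X dm x) + r p q x = x].

(* Equivalently, the columns are projective relative to the vertical maps    *)
(* that are surjective on elements and on vertical cycles.                   *)
Definition vproj (X : bicomplex k) : Prop :=
  (forall p q, projective (X p q)) /\ exists s r, vhodge (X := X) s r.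

Definition vsplit (A B C : bicomplex k) (f : bimor A B) (c : bimor B C)
    (r : vmor B A) (j : vmor C B) : Prop :=
  [/\ forall p q x, r p q (f p q x) = x, forall p q x, c p q (j p q x) = x,
      forall p q x, f p q (r p q x) + j p q (c p q x) = x &
      forall p q x, c p q (f p q x) = 0].

Lemma vhodge_of_regular (X : bicomplex k) (s : vraise X) :
  (forall p q q' (d : q = q' + 1) (x : X p q),
     dv X d (s p _ _ d (dv X d x)) = dv X d x) ->
  exists r, vhodge s r.
Proof.
move=> sP.
pose r0 p q : {linear X p q -> X p q} :=
  idfun \- (dv X (erefl (q + 1)) \o s p _ _ (erefl (q + 1)))
        \- (s p _ _ (predK q) \o dv X (predK q)).
have r1 p q q' (d : q = q' + 1) x : dv X d (r0 p q x) = 0.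
  rewrite /r0 /= !linearB /= dvdv subr0; have qE := pred_eq d; subst q'.
  by rewrite (eq_irrelevance (predK q) d) sP subrr.
have r2 p q q' (d : q = q' + 1) (x : X p q) : r0 p q' (dv X d x) = 0.
  by rewrite /r0 /= dvdv linear0 subr0; subst q; rewrite sP subrr.
have r3 p q q' (d : q = q' + 1) (x : X p q) :
    r0 p q' (dv X d x) = dv X d (r0 p q x) by rewrite r1 r2.
exists (Vmor r3); split=> // p q q1 qm d1 dm x.
have qE := pred_eq dm; subst q1 qm.
rewrite (eq_irrelevance dm (predK q)) /= /r0 /=.
by rewrite -[X in _ + X]addrA -opprD subrKC.
Qed.

Lemma vhodge_regular (X : bicomplex k) (s : vraise X) (r : vmor X X) :
  vhodge s r ->
  forall p q q' (d : q = q' + 1) (x : X p q),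
    dv X d (s p _ _ d (dv X d x)) = dv X d x.
Proof.
move=> [dr _ sr] p q q' d x; rewrite -[in RHS](sr _ _ _ _ erefl d x).
by rewrite !linearD /= dvdv add0r dr addr0.
Qed.

Lemma vproj_retract (X Y : bicomplex k) (i : vmor X Y) (r : vmor Y X) :
  (forall p q x, r p q (i p q x) = x) -> vproj Y -> vproj X.
Proof.
move=> ri [YP [s [t /vhodge_regular sP]]]; split=> [p q|].
  exact: (projective_retract (i := i p q) (r := r p q) (ri p q)).
pose s' : vraise X := fun p q q' d => r p q \o (s p q q' d \o i p q').
have [|t' h] := @vhodge_of_regular X s'; last by exists s', t'.
by move=> p q q' d x; rewrite /s' /= -(vmap_dv r) (vmap_dv i) sP -(vmap_dv i) ri.
Qed.
End VerticallyProjective.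

(* A vertically projective bicomplex with a vertical map onto X that is      *)
(* surjective on elements (by the summand on X_q) and on vertical cycles     *)
(* (by the summand on Z_q); the summand on X_{q+1} is the target of d_v.     *)
Section ProjectiveCover.
Variables (k : comPzRingType) (X : bicomplex k).

Definition cover_obj (p q : int) : lmodType k :=
  (freemod (Zv X p q) * (freemod (X p q) * freemod (X p (q + 1)%R)))%type.

Definition cover_shift p q q' (d : q = q' + 1) :
    {linear freemod (X p q) -> freemod (X p (q' + 1))} :=
  match d in _ = q1 return {linear freemod (X p q) -> freemod (X p q1)} with
  | erefl => idfun end.

Definition cover_unshift p q q' (d : q = q' + 1) :
    {linear freemod (X p (q' + 1)) -> freemod (X p q)} :=
  match d in _ = q1 return {linear freemod (X p q1) -> freemod (X p q)} with
  | erefl => idfun end.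

Lemma cover_shiftK p q q' (d : q = q' + 1) x :
  cover_unshift p d (cover_shift p d x) = x.
Proof. by rewrite /cover_unshift /cover_shift; case: _ / d. Qed.

Lemma cover_dv_linear p q q' (d : q = q' + 1) :
  linear (fun x : cover_obj p q =>
    (0, (0, cover_shift p d x.2.1)) : cover_obj p q').
Proof.
move=> a x y; apply: injective_projections; rewrite /= ?scaler0 ?addr0 //.
apply: injective_projections; rewrite /= ?scaler0 ?addr0 //.
exact: linearP.
Qed.

Definition cover_dv p q q' (d : q = q' + 1) := linear_of (@cover_dv_linear p q q' d).

Lemma cover_raise_linear p q q' (d : q = q' + 1) :
  linear (fun x : cover_obj p q' =>
    (0, (cover_unshift p d x.2.2, 0)) : cover_obj p q).
Proof.
move=> a x y; apply: injective_projections; rewrite /= ?scaler0 ?addr0 //.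
apply: injective_projections; rewrite /= ?scaler0 ?addr0 //.
exact: linearP.
Qed.

Definition cover : bicomplex k.
Proof.
(* The cover is used only through vertical maps, so its d_h is taken to be 0. *)
refine (@Bicomplex k cover_obj (fun _ _ _ _ => \0) cover_dv _ _ _ _).
- move=> p q [z [x x']] p0.
  rewrite (freemod_eq0 z) ?(freemod_eq0 x) ?(freemod_eq0 x') // => v.
  + exact: bobj0.
  + exact: bobj0.
  + by apply: val_inj; apply: bobj0.
- by [].
- move=> p q q' q'' d d' x; apply: injective_projections => //=.
  by apply: injective_projections; rewrite //= linear0.
- by move=> p p' q q' e d x; rewrite /= linear0 addr0.
Defined.

Definition cover_raise : vraise cover :=
  fun p q q' d => linear_of (@cover_raise_linear p q q' d).

Definition cover_fun p q (x : cover p q) : X p q :=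
  freelift (@cyc_val k (col X p) q) x.1 + freelift id x.2.1 +
    dv X (erefl (q + 1)) (freelift id x.2.2).

Lemma cover_fun_linear p q : linear (@cover_fun p q).
Proof.
move=> a x y; rewrite /cover_fun !linearP.
by rewrite [X in X + _ = _]addrACA [LHS]addrACA -!scalerDr.
Qed.

Lemma cover_fun_dv p q q' (d : q = q' + 1) (x : cover p q) :
  linear_of (@cover_fun_linear p q') (dv cover d x) =
  dv X d (linear_of (@cover_fun_linear p q) x).
Proof.
have cyc (z : freemod (Zv X p q)) : dv X d (freelift (@cyc_val k (col X p) q) z) = 0.
  apply: (freemod_ext (f := dv X d \o freelift (@cyc_val k (col X p) q))
    (g := \0)) => v v0 /=.
  rewrite freeliftE //; have /eqP := cycP v.
  have qE := pred_eq d; subst q'.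
  by rewrite (eq_irrelevance d (predK q)).
rewrite /= /cover_fun !linearD /= cyc dvdv !linear0 !add0r addr0.
by subst q.
Qed.

Definition cover_map : vmor cover X := Vmor cover_fun_dv.

Lemma cover_map_epi : vepi cover_map.
Proof.
split=> [p q y | p q q' d y dy].
  exists (0, (freegen y, 0)); rewrite /= /cover_fun /= !linear0 add0r addr0.
  by rewrite freelift0E.
have qE := pred_eq d; subst q'; rewrite (eq_irrelevance d (predK q)) in dy *.
have yP : y \in is_cycle (col X p) q by apply/eqP.
exists (freegen (Cycle yP), (0, 0)); split.
  apply: injective_projections => //=.
  by apply: injective_projections; rewrite //= linear0.
by rewrite /= /cover_fun /= !linear0 !addr0 freelift0E.
Qed.

Lemma vproj_cover : vproj cover.
Proof.
split=> [p q|].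
  by do 2?[apply: projective_pair]; apply: projective_free.
have [|r h] := @vhodge_of_regular k cover cover_raise; last by exists cover_raise, r.
move=> p q q' d x; apply: injective_projections => //=.
by apply: injective_projections => //=; rewrite cover_shiftK.
Qed.
End ProjectiveCover.

(** * Structure of cofibrations and trivial fibrations *)

(** Dependent choice over columns: the invariant [G] makes each step possible and [R] links
    consecutive columns. Both are automatic for p < 0, where the family takes the default value
    [t0]. *)
Lemma int_dependent_choice (T : int -> Type) (G : forall p, T p -> Prop)
    (R : forall p p', p = p' + 1 -> T p' -> T p -> Prop) (t0 : forall p, T p) :
  (forall p x, p < 0 -> G p x) ->
  (forall p p' (e : p = p' + 1) x y, p < 0 -> R p p' e x y) ->
  (forall p p' (e : p = p' + 1) x, G p' x -> exists y, G p y /\ R p p' e x y) ->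
  exists h : forall p, T p, (forall p, G p (h p)) /\
    forall p p' (e : p = p' + 1), R p p' e (h p') (h p).
Proof.
move=> G0 R0 step.
have S p p' (e : p = p' + 1) x : G p' x -> {y | G p y /\ R p p' e x y}.
  by move=> /step h; apply: cid.
have e0 : Posz 0 = Negz 0 + 1 by [].
have eS n : Posz n.+1 = Posz n + 1 by rewrite -addn1 PoszD.
(* [Negz 0] is -1: column 0 is built on the default value in column -1. *)
pose a0 := S _ _ e0 _ (G0 (Negz 0) (t0 _) isT).
pose fix a n : {x : T (Posz n) | G _ x} :=
  match n with
  | 0%N => exist _ (projT1 a0) (proj1 (projT2 a0))
  | m.+1 => let b := S _ _ (eS m) _ (projT2 (a m)) in
            exist _ (projT1 b) (proj1 (projT2 b))
  end.
pose h p : T p := match p with Posz n => projT1 (a n) | Negz n => t0 _ end.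
exists h; split=> [[n|n]|[[|n]|n] p' e] /=.
- exact: projT2 (a n).
- exact (G0 (Negz n) _ isT).
- have E : p' = Negz 0 by rewrite (pred_eq e).
  by subst p'; rewrite (eq_irrelevance e e0); apply: (proj2 (projT2 a0)).
- have E : p' = Posz n by rewrite (pred_eq e) eS addrK.
  subst p'; rewrite (eq_irrelevance e (eS n)).
  exact: (proj2 (projT2 (S _ _ _ _ _))).
- exact (R0 (Negz n) p' e _ _ isT).
Qed.

Section CofibrationStructure.
Variable k : comPzRingType.

Lemma bto0_linear (A : bicomplex k) p q : linear (fun _ : A p q => 0 : bzero k p q).
Proof. by move=> a x y; rewrite scaler0 addr0. Qed.

Definition bto0 (A : bicomplex k) : bimor A (bzero k).
Proof.
by refine (@Bimor k A (bzero k) (fun p q _ => 0) (@bto0_linear A) _ _) => *;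
  rewrite linear0.
Defined.

Lemma vsub_dv (A B : bicomplex k) (f : vmor A A) p q q' (e : q = q' + 1)
    (x : A p q) :
  (idfun \- f p q') (dv A e x) = dv A e ((idfun \- f p q) x).
Proof. by rewrite /= vmap_dv linearB. Qed.

(** C is the cokernel of f, obtained as the pushout along A -> 0. The vertical map 1 - f r kills f,
    hence factors through C, and the factor is j. *)
Lemma retract_vsplit (A B : bicomplex k) (f : bimor A B) (r : vmor B A) :
  (forall p q x, r p q (f p q x) = x) ->
  exists C (c : bimor B C) (j : vmor C B), vsplit f c r j.
Proof.
have [C [c [i poP]]] : exists (C : bicomplex k) (c : bimor B C) i,
    is_pushout f (bto0 A) c i.
  by do 3!eexists; apply: bpushoutP.
move=> rf.
have cf p q x : c p q (f p q x) = 0.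
  by rewrite -[LHS]/(bcomp c f p q x) (proj1 poP) /= linear0.
pose u : vmor B B := Vmor (@vsub_dv B B (vcomp (vert f) r)).
have [|j [jc ji]] := pushout_vlift poP (u := u) (v := vzero _ _).
  by move=> p q x; rewrite /= rf subrr.
have {}jc p q x : j p q (c p q x) = x - f p q (r p q x) by rewrite jc.
exists C, c, j; split=> //.
- apply: (pushout_vext poP (w := vcomp (vert c) j) (w' := vert (bid _))).
    by move=> p q x; rewrite /= jc linearB /= cf subr0.
  by move=> p q x; rewrite (zero_moduleP x) !linear0.
- by move=> p q x; rewrite jc subrKC.
Qed.

(** Two vertical lifts are used. Lifting the identity of A against A -> 0 gives r. Lifting c through
    the projective cover of C by a map that kills A, then composing with j, exhibits C as a retract
    of its cover. *)
Lemma cof_vsplit (A B : bicomplex k) (f : bimor A B) : CE_cof f ->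
  exists C (c : bimor B C) r j, vsplit f c r j /\ vproj C.
Proof.
move=> fC.
have [||r [rf _]] := cof_vertical_lift (e := vzero A (bzero k))
    (u := vert (bid A)) (v := vzero _ _) fC.
- split=> [p q y|p q q' d y _].
    by exists 0; rewrite (zero_moduleP y).
  by exists 0; rewrite (zero_moduleP y) linear0.
- by [].
have [C [c [j fS]]] := retract_vsplit rf; exists C, c, r, j; split=> //.
have [_ cj _ cf] := fS.
have [|h [hf hc]] := cof_vertical_lift (u := vzero _ _) (v := vert c) fC
    (@cover_map_epi _ C).
  by move=> p q x; rewrite /= cf -[LHS]/(cover_map C p q 0) linear0.
apply: (vproj_retract (i := vcomp h j) (r := cover_map C) _ (@vproj_cover _ C)).
by move=> p q x; rewrite hc /= cj.
Qed.
End CofibrationStructure.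

(** * Exactness of the kernel of a trivial fibration *)

Section TrivialFibration.
Variables (k : comPzRingType) (X Y : bicomplex k) (f : bimor X Y).
Hypotheses (fF : CE_fib f) (fW : CE_weq f).

Lemma triv_fib_surj p q (y : Y p q) : exists x, f p q x = y.
Proof. by have [fS _ _] := fF; apply: fS. Qed.

(** Only p = 0 needs an argument. There y is a horizontal cycle, so surjectivity on H^h H^v gives y
    = f x + d_h z + d_v w with z a vertical cycle in column 1, where the fibration condition lifts
    it. *)
Lemma triv_fib_cycle p q q' (d : q = q' + 1) (y : Y p q) : dv Y d y = 0 ->
  exists x, dv X d x = 0 /\ f p q x = y.
Proof.
move=> dy.
have pos r (z : Y r q) : 0 < r -> dv Y d z = 0 -> exists x, dv X d x = 0 /\ f r q x = z.
  move=> r0; have qE := pred_eq d; subst q'; rewrite (eq_irrelevance d (predK q)) => dz.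
  have [_ fZ _] := fF; have zP : z \in is_cycle (col Y r) q by apply/eqP.
  have [[x xP] /(congr1 (@cyc_val _ _ _)) /= <-] := fZ _ q r0 (Cycle zP).
  by exists x; split=> //; apply/eqP.
case: (ltrgt0P p) => [/pos|p0|p0]; first exact.
  by exists 0; rewrite !linear0 (bobj0 y p0).
have [_ fS] := (CE_weqP f).1 fW.
have hy : dh Y (predK p) y = dv Y (erefl (q + 1)) 0.
  by rewrite linear0; apply: bobj0; rewrite p0.
have [x [u [z [w [dx _ dz yE]]]]] := fS _ _ _ _ _ _ erefl _ erefl d y 0 dy hy.
have [|z' [dz' z'E]] := pos _ z _ dz; first by rewrite p0.
have [w' w'E] := triv_fib_surj w.
exists (x + dh X erefl z' + dv X erefl w'); split.
  by rewrite !linearD /= dx dv_dh dz' linear0 oppr0 dvdv !addr0.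
by rewrite yE -z'E -w'E !linearD /= !bmap_dh !bmap_dv.
Qed.

Lemma triv_fib_ker_hor p p1 pm q (e1 : p1 = p + 1) (em : p = pm + 1) (x : X p q) :
  f p q x = 0 -> dh X em x = 0 ->
  exists z, f p1 q z = 0 /\ x = dh X e1 z.
Proof.
move=> fx dx; have [_ _ /Hh_map_bijP [fI fS]] := fF.
have [|z zE] := fI _ _ _ _ e1 em x 0 dx; first by rewrite fx linear0.
have [|z1 [y1 [dz1 fz]]] := fS _ _ _ _ (erefl (p1 + 1)) e1 (f _ _ z).
  by rewrite -bmap_dh -zE.
have [x2 x2E] := triv_fib_surj y1.
(* f z is a horizontal cycle; z1 and d_h x2 account for its class and its boundary part, and
   subtracting them leaves d_h z unchanged. *)
exists (z - z1 - dh X erefl x2); split.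
  by rewrite !linearB /= bmap_dh x2E fz; zmod_identity.
by rewrite !linearB /= dz1 dhdh !subr0.
Qed.

(** Injectivity on H^h H^v writes x as d_h z + d_v w in X; z and w are then corrected in turn until
    both lie in the kernel. *)
Lemma triv_fib_ker_E2 p p1 pm q q1 qm (e1 : p1 = p + 1) (em : p = pm + 1)
    (d1 : q1 = q + 1) (dm : q = qm + 1) (x : X p q) (y : X pm q1) :
  f p q x = 0 -> dv X dm x = 0 -> dh X em x = dv X d1 y ->
  exists z w, [/\ f p1 q z = 0, f p q1 w = 0, dv X dm z = 0 &
    x = dh X e1 z + dv X d1 w].
Proof.
move=> fx dx hx; have [fI fS] := (CE_weqP f).1 fW.
have [||z [w [dz xE]]] := fI _ _ _ _ _ _ e1 em d1 dm x y 0 0 dx hx.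
- by rewrite linear0.
- by rewrite !linear0 addr0.
have [||x1 [x2 [y1 [y2 [dx1 hx1 dy1 fz]]]]] :=
    fS _ _ _ _ _ _ (erefl (p1 + 1)) e1 d1 dm (f _ _ z) (- f _ _ w).
- by rewrite -bmap_dv dz linear0.
- by apply/eqP; rewrite linearN -addr_eq0 -bmap_dh -bmap_dv -linearD -xE /= fx.
have [z1 [dz1 z1E]] := triv_fib_cycle dy1.
have [w1 w1E] := triv_fib_surj y2.
(* Since d_h (f z) = - d_v (f w), surjectivity on H^h H^v gives f z = f x1 + d_h y1 + d_v y2; a lift
   of each term is subtracted. *)
pose z' := z - x1 - dh X erefl z1 - dv X d1 w1.
have fz' : f _ _ z' = 0.
    rewrite /z' !linearB /= bmap_dh bmap_dv z1E w1E fz.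
  zmod_identity.
have dz' : dv X dm z' = 0.
  rewrite /z' !linearB /= dz dx1 dvdv.
  by rewrite dv_dh dz1 !linear0; zmod_identity.
pose w2 := w + x2 - dh X e1 w1.
have xE' : x = dh X e1 z' + dv X d1 w2.
  rewrite /z' /w2 xE !linearB !linearD /= dhdh subr0 hx1.
  rewrite (dv_dh e1 d1) opprK.
  zmod_identity.
(* As f x = f z' = 0, f w2 is a vertical cycle, and subtracting a lift of it that is a cycle does
   not change d_v w2. *)
have [|w3 [dw3 w3E]] := triv_fib_cycle (d := d1) (y := f _ _ w2).
  have := congr1 (bmap f) xE'.
  by rewrite fx linearD /= bmap_dh fz' linear0 add0r bmap_dv => <-.
exists z', (w2 - w3); split=> //; first by rewrite linearB /= w3E subrr.
by rewrite (linearB (dv X d1)) /= dw3 subr0.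
Qed.

(** Induction on p. Write x = d_h z + d_v w inside the kernel. Then d_h w is a vertical and
    horizontal cycle one column lower, so d_h w = d_h u with d_v u = 0. Exactness of rows gives w -
    u = d_h w', whence x = d_h (z - d_v w'). *)
Lemma triv_fib_ker_vert_hor p p1 pm q qm (e1 : p1 = p + 1) (em : p = pm + 1)
    (dm : q = qm + 1) (x : X p q) :
  f p q x = 0 -> dv X dm x = 0 -> dh X em x = 0 ->
  exists z, [/\ f p1 q z = 0, dv X dm z = 0 & x = dh X e1 z].
Proof.
pose goal p := forall p1 pm q qm (e1 : p1 = p + 1) (em : p = pm + 1)
    (dm : q = qm + 1) (x : X p q),
  f p q x = 0 -> dv X dm x = 0 -> dh X em x = 0 ->
  exists z, [/\ f p1 q z = 0, dv X dm z = 0 & x = dh X e1 z].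
have goal_neg r : r < 0 -> goal r.
  move=> r0 r1 rm s sm e1' em' dm' x' _ _ _.
  by exists 0; rewrite !linear0 (bobj0 x' r0).
have step r r' : r = r' + 1 -> goal r' -> goal r.
  move=> err' IH r1 rm s sm e1' em' dm' x'.
  have E : r' = rm by apply: (addIr 1); rewrite -err'.
  subst rm => fx dx hx.
  have hx0 : dh X em' x' = dv X (erefl (s + 1)) 0 by rewrite hx linear0.
  have [z [w [fz fw dz xE]]] := triv_fib_ker_E2 e1' fx dx hx0.
  have dhw : dv X erefl (dh X em' w) = 0.
    have : dh X em' x' = 0 := hx.
    by rewrite xE linearD /= dhdh add0r dh_dv => /eqP; rewrite oppr_eq0 => /eqP.
  have fhw : f _ _ (dh X em' w) = 0 by rewrite bmap_dh fw linear0.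
  have [u [fu du wE]] :=
    IH _ _ _ _ em' (predK r') erefl (dh X em' w) fhw dhw (dhdh _ _ _).
  have fwu : f _ _ (w - u) = 0 by rewrite linearB /= fw fu subrr.
  have dwu : dh X em' (w - u) = 0 by rewrite linearB /= wE subrr.
  have [w' [fw' w'E]] := triv_fib_ker_hor e1' fwu dwu.
  exists (z - dv X erefl w'); split.
  - by rewrite linearB /= fz bmap_dv fw' linear0 subrr.
  - by rewrite linearB /= dz dvdv subrr.
  rewrite linearB /= dh_dv opprK -w'E linearB /= du subr0; exact: xE.
have all_goal : goal p.
  have [n pn] : exists n : nat, p < Posz n.
    exists (`|p|%N.+1); rewrite -addn1 PoszD; apply: (@le_lt_trans _ _ `|p|).
      exact: ler_norm.
    by rewrite abszE ltrDl.
  elim: n p pn {x em e1} => [|n IH] r rn; first exact: goal_neg.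
  apply: (step _ _ (predK r)); apply: IH.
  by rewrite ltrBlDr -PoszD addn1.
exact: all_goal.
Qed.
End TrivialFibration.

(** * Vertically split inclusions are cofibrations *)

Section VsplitCof.
Variable k : comPzRingType.

Lemma lpair_linear (U V W : lmodType k) (f : {linear U -> V}) (g : {linear U -> W}) :
  linear (fun x => (f x, g x)).
Proof. by move=> a x y; rewrite !linearP. Qed.

Definition lpair (U V W : lmodType k) (f : {linear U -> V}) (g : {linear U -> W}) :
  {linear U -> (V * W)%type} := linear_of (lpair_linear f g).

Section TrivialFibrationLift.
Variables (X Y : bicomplex k) (g : bimor X Y).
Hypotheses (gF : CE_fib g) (gW : CE_weq g).

(** For any x0 over y the defect x' - d_h x0 is a horizontal cycle of the kernel, hence d_h of a
    kernel element; [triv_fib_cycle_lift] does the same inside the vertical cycles. *)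
Lemma triv_fib_hor_lift p p' q (e : p = p' + 1) (y : Y p q) (x' : X p' q) :
  dh Y e y = g _ _ x' -> dh X (predK p') x' = 0 ->
  exists x, g _ _ x = y /\ dh X e x = x'.
Proof.
move=> hy dx'; have [x0 x0E] := triv_fib_surj gF y.
have gk : g _ _ (x' - dh X e x0) = 0.
  by rewrite linearB /= bmap_dh x0E hy subrr.
have dk : dh X (predK p') (x' - dh X e x0) = 0.
  by rewrite linearB /= dx' dhdh subrr.
have [z [gz zE]] := triv_fib_ker_hor gF e gk dk.
exists (x0 + z); rewrite !linearD /= x0E gz addr0; split=> //.
by rewrite -zE subrKC.
Qed.

Lemma triv_fib_cycle_lift p p' q q' (e : p = p' + 1) (d : q = q' + 1)
    (y : Y p q) (x' : X p' q) :
  dh Y e y = g _ _ x' -> dh X (predK p') x' = 0 ->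
  dv Y d y = 0 -> dv X d x' = 0 ->
  exists x, [/\ g _ _ x = y, dh X e x = x' & dv X d x = 0].
Proof.
move=> hy dx' dy dvx'; have [x0 [dx0 x0E]] := triv_fib_cycle gF gW dy.
have gk : g _ _ (x' - dh X e x0) = 0.
  by rewrite linearB /= bmap_dh x0E hy subrr.
have dk : dh X (predK p') (x' - dh X e x0) = 0.
  by rewrite linearB /= dx' dhdh subrr.
have dvk : dv X d (x' - dh X e x0) = 0.
  by rewrite linearB /= dvx' dv_dh dx0 linear0 oppr0 subrr.
have [z [gz dz zE]] := triv_fib_ker_vert_hor gF gW e gk dvk dk.
exists (x0 + z); rewrite !linearD /= x0E gz dx0 dz !addr0; split=> //.
by rewrite -zE subrKC.
Qed.

Variables (C : bicomplex k) (CP : vproj C) (p p' : int) (e : p = p' + 1).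
Variables (a : forall q, {linear C p q -> Y p q}).
Variables (b : forall q, {linear C p q -> X p' q}).
Hypothesis a_dv : forall q q' (d : q = q' + 1) x, a q' (dv C d x) = dv Y d (a q x).
Hypothesis b_dv : forall q q' (d : q = q' + 1) x, b q' (dv C d x) = - dv X d (b q x).
Hypothesis dh_b : forall q x, dh X (predK p') (b q x) = 0.
Hypothesis dh_a : forall q x, dh Y e (a q x) = g _ _ (b q x).

(* Writing 1 = r' + [d_v, s'] with r' = r^2 and s' = s + s r, lift r' through  *)
(* vertical cycles and s' arbitrarily, and take l = l0 r + [d_v, l1].          *)
Lemma column_lift : exists l : forall q, {linear C p q -> X p q},
  [/\ forall q x, g _ _ (l q x) = a q x,
      forall q x, dh X e (l q x) = b q x &
      forall q q' (d : q = q' + 1) x, l q' (dv C d x) = dv X d (l q x)].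
Proof.
have [Cproj [s [r [dr rd sr]]]] := CP.
have L0 q : {l : {linear C p q -> X p q} | forall x,
    [/\ g _ _ (l x) = a q (r p q x), dh X e (l x) = b q (r p q x) &
        dv X (predK q) (l x) = 0]}.
  apply: cid.
  have [|l hl] := Cproj p q _ _
      (lpair (bmap_lin g p q) (lpair (dh X e) (dv X (predK q))))
      (lpair (a q \o r p q) (lpair (b q \o r p q) \0)); last first.
    by exists l => x; have [h1 h2 h3] := hl x.
  move=> x; have [||||z [gz hz dz]] :=
      @triv_fib_cycle_lift _ _ _ _ e (predK q) (a q (r p q x)) (b q (r p q x)).
  - exact: dh_a.
  - exact: dh_b.
  - by rewrite -a_dv dr linear0.
  - by apply/eqP; rewrite -oppr_eq0 -b_dv dr linear0.
  by exists z; rewrite /= gz hz dz.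
pose s' q q1 (d : q1 = q + 1) : {linear C p q -> C p q1} :=
  s p _ _ d \+ (s p _ _ d \o r p q).
have s'E q q1 qm (d1 : q1 = q + 1) (dm : q = qm + 1) (x : C p q) :
    r p q (r p q x) + dv C d1 (s' _ _ d1 x) + s' _ _ dm (dv C dm x) = x.
  rewrite /s' /= rd linear0 addr0 linearD /=.
  have := sr p q q1 qm d1 dm (r p q x); rewrite dr linear0 addr0 => h.
  rewrite -[in RHS](sr p q q1 qm d1 dm x) -[in RHS]h.
  zmod_identity.
have L1 q q1 (d : q1 = q + 1) : {l : {linear C p q -> X p q1} | forall x,
    g _ _ (l x) = a _ (s' _ _ d x) /\ dh X e (l x) = b _ (s' _ _ d x)}.
  apply: cid.
  have [|l hl] := Cproj p q _ _ (lpair (bmap_lin g p q1) (dh X e))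
      (lpair (a q1 \o s' _ _ d) (b q1 \o s' _ _ d)); last first.
    by exists l => x; have [h1 h2] := hl x.
  move=> x; have [z [gz hz]] := triv_fib_hor_lift (dh_a (s' _ _ d x)) (dh_b (s' _ _ d x)).
  by exists z; rewrite /= gz hz.
pose l0 q := projT1 (L0 q); pose l1 q q1 d := projT1 (L1 q q1 d).
have g0 q x : g _ _ (l0 q x) = a q (r p q x) by case: (projT2 (L0 q) x).
have h0 q x : dh X e (l0 q x) = b q (r p q x) by case: (projT2 (L0 q) x).
have v0 q q' (d : q = q' + 1) x : dv X d (l0 q x) = 0.
  have qE := pred_eq d; subst q'; rewrite (eq_irrelevance d (predK q)).
  by case: (projT2 (L0 q) x).
have g1 q q1 d x : g _ _ (l1 q q1 d x) = a _ (s' _ _ d x).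
  by case: (projT2 (L1 q q1 d) x).
have h1 q q1 d x : dh X e (l1 q q1 d x) = b _ (s' _ _ d x).
  by case: (projT2 (L1 q q1 d) x).
(* Of the two factors in r^2, one turns the data into vertical cycles so that l0 can take values in
   cycles, and the other makes l0 r vanish on the image of d_v. *)
pose l q : {linear C p q -> X p q} :=
  (l0 q \o r p q) \+ (dv X erefl \o l1 q _ erefl) \+ (l1 _ _ (predK q) \o dv C (predK q)).
exists l; split=> [q x|q x|q q' d x].
- rewrite /l /= !linearD /= bmap_dv g0 !g1 -a_dv -!linearD /=.
  by rewrite s'E.
- rewrite /l /= !linearD /= dh_dv h0 !h1 -b_dv -!linearD /=.
  by rewrite s'E.
rewrite /l /= rd linear0 dvdv linear0 addr0 add0r.
rewrite !linearD /= v0 dvdv !add0r.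
have l1E qm (dm : q = qm + 1) :
    l1 _ _ (predK q) (dv C (predK q) x) = l1 _ _ dm (dv C dm x).
  by have qE := pred_eq dm; subst qm; rewrite (eq_irrelevance dm (predK q)).
by rewrite (l1E _ d); subst q.
Qed.
End TrivialFibrationLift.

Lemma vsplit_cof (A B C : bicomplex k) (f : bimor A B) (c : bimor B C)
    (r : vmor B A) (j : vmor C B) :
  vsplit f c r j -> vproj C -> CE_cof f.
Proof.
move=> [rf cj frjc cf] CP X Y g gF gW u v sq.
have gu p q x : g p q (u p q x) = v p q (f p q x).
  exact: (congr1 (fun w : bimor A Y => w p q x) sq).
pose T p := forall q, {linear B p q -> X p q}.
(* The invariant sees column p alone, so compatibility with d_h enters as preservation of horizontal
   cycles; this is what makes the data for the next column horizontally closed. *)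
pose G p (h : T p) :=
  [/\ forall q x, h q (f p q x) = u p q x, forall q x, g p q (h q x) = v p q x,
      forall q q' (d : q = q' + 1) x, h q' (dv B d x) = dv X d (h q x) &
      forall pm (em : p = pm + 1) q x, dh B em x = 0 -> dh X em (h q x) = 0].
pose R p p' (e : p = p' + 1) (h' : T p') (h : T p) :=
  forall q x, dh X e (h q x) = h' q (dh B e x).
have [|||h [hG hR]] := @int_dependent_choice T G R (fun p q => \0).
- move=> p h p0; have X0 q (x y : X p q) : x = y.
    by rewrite (bobj0 x p0) (bobj0 y p0).
  split=> [q x|q x|q q' d x|pm em q x _].
  + exact: X0.
  + by rewrite (bobj0 (g p q _) p0) (bobj0 (v p q x) p0).
  + exact: X0.
  + by rewrite (bobj0 (h q x) p0) linear0.
- move=> p p' e h' h p0 q x.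
  by rewrite (bobj0 x p0) !linear0.
- move=> p p' e h' [h'f gh' h'v h'h].
  have [|||| l [gl hl lv]] := @column_lift X Y g gF gW C CP p p' e
      (fun q => bmap_lin v p q \o j p q) (fun q => h' q \o (dh B e \o j p q)).
  + by move=> q q' d x; rewrite /= vmap_dv bmap_dv.
  + by move=> q q' d x; rewrite /= vmap_dv dh_dv linearN h'v.
  + by move=> q x; apply: h'h; rewrite dhdh.
  + by move=> q x; rewrite /= gh' bmap_dh.
  (* On the summand A the lift is forced to be u. On C it is l, whose prescribed horizontal image is
     h' d_h j because j does not respect d_h. *)
  exists (fun q => (bmap_lin u p q \o r p q) \+ (l q \o bmap_lin c p q)).
  split; [split|] => [q x|q x|q q' d x|pm em q x dx|q x].
  + by rewrite /= rf cf linear0 addr0.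
  + by rewrite linearD /= gu gl /= -linearD frjc.
  + by rewrite /= !vmap_dv !bmap_dv lv linearD.
  + have pE := pred_eq em; have := pred_eq e; rewrite -pE => E; subst p'.
    rewrite (eq_irrelevance em e) in dx *; rewrite linearD /= hl /= -bmap_dh.
    have := h'f q (dh A e (r p q x)); rewrite bmap_dh => <-.
    by rewrite -!linearD frjc dx linear0.
  rewrite linearD /= hl /= -bmap_dh.
  have := h'f q (dh A e (r p q x)); rewrite bmap_dh => <-.
  by rewrite -!linearD frjc.
have h_lin p q : linear (h p q) by exact: linearP.
have h_dh p p' q (e : p = p' + 1) (x : B p q) :
    h p' q (dh B e x) = dh X e (h p q x) by rewrite hR.
have h_dv p q q' (d : q = q' + 1) (x : B p q) :
    h p q' (dv B d x) = dv X d (h p q x) by have [] := hG p.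
exists (@Bimor k B X (fun p q => h p q) h_lin h_dh h_dv).
by split; apply: bimor_eq => p q x /=; have [hf gh _ _] := hG p;
  [apply: hf | apply: gh].
Qed.
End VsplitCof.

(** * Tensor products *)

Lemma ksign_sq (k : comPzRingType) (d : int) : ksign k d * ksign k d = 1.
Proof. by rewrite /ksign -expr2 sqrr_sign. Qed.

Lemma ksign_addl (k : comPzRingType) (m m' n : int) :
  m = m' + 1 -> ksign k (m' + n) = - ksign k (m + n).
Proof. by move=> ->; rewrite addrAC ksignS opprK. Qed.

Lemma ksign_addr (k : comPzRingType) (m n n' : int) :
  n = n' + 1 -> ksign k (m + n') = - ksign k (m + n).
Proof. by move=> ->; rewrite addrA ksignS opprK. Qed.

Section TensorOperators.
Variables (k : comPzRingType).

Section Differentials.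
Variables X Y : bicomplex k.

Lemma tensor_dhE p p' q (e : p = p' + 1) m m' n s s' t (e1 : m + s = p)
    (e2 : n + t = q) (em : m = m' + 1) (es : s = s' + 1) (el : m' + s = p')
    (er : m + s' = p') (x : X m n) (y : Y s t) :
  tdh X Y q e (tpure e1 e2 x y) =
  tpure el e2 (dh X em x) y + ksign k (m + n) *: tpure er e2 x (dh Y es y).
Proof.
have mE := pred_eq em; have sE := pred_eq es; subst m' s'.
rewrite (eq_irrelevance em (predK m)) (eq_irrelevance es (predK s)).
rewrite (tpure_irr el (tidx_predl e1 e) e2 e2) (tpure_irr er (tidx_predr e1 e) e2 e2).
exact: tdhE.
Qed.

Lemma tensor_dvE p q q' (d : q = q' + 1) m n n' s t t' (e1 : m + s = p)
    (e2 : n + t = q) (dn : n = n' + 1) (dt : t = t' + 1) (el : n' + t = q')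
    (er : n + t' = q') (x : X m n) (y : Y s t) :
  tdv X Y p d (tpure e1 e2 x y) =
  tpure e1 el (dv X dn x) y + ksign k (m + n) *: tpure e1 er x (dv Y dt y).
Proof.
have nE := pred_eq dn; have tE := pred_eq dt; subst n' t'.
rewrite (eq_irrelevance dn (predK n)) (eq_irrelevance dt (predK t)).
rewrite (tpure_irr e1 e1 el (tidx_predl e2 d)) (tpure_irr e1 e1 er (tidx_predr e2 d)).
exact: tdvE.
Qed.
End Differentials.

Section VerticalMaps.
Variables (X X' Y Y' : bicomplex k) (f : vmor X X') (g : vmor Y Y').

Lemma vtensor_bilinear p q m n s t (e : m + s = p) (e' : n + t = q) :
  bilinear2 (fun (x : X m n) (y : Y s t) =>
    tpure e e' (f m n x) (g s t y) : btensor X' Y' p q).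
Proof.
by split=> [y a x x'|x a y y']; rewrite linearP ?tpure_linl ?tpure_linr.
Qed.

Definition vtensor_lin p q : {linear btensor X Y p q -> btensor X' Y' p q} :=
  tlift (@vtensor_bilinear p q).

Lemma vtensor_linE p q m n s t (e : m + s = p) (e' : n + t = q) x y :
  vtensor_lin p q (tpure e e' x y) = tpure e e' (f m n x) (g s t y).
Proof. exact: tliftE. Qed.

#[global] Opaque vtensor_lin.

Lemma vtensor_dv p q q' (d : q = q' + 1) (x : btensor X Y p q) :
  vtensor_lin p q' (dv _ d x) = dv _ d (vtensor_lin p q x).
Proof.
apply: (tobj_ext (f := vtensor_lin p q' \o dv (btensor X Y) d)
  (f' := dv (btensor X' Y') d \o vtensor_lin p q)) => m n s t e1 e2 {}x y.
have dn := predK n; have dt := predK t.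
rewrite /= vtensor_linE.
rewrite (tensor_dvE d e1 e2 dn dt (tidx_predl e2 d) (tidx_predr e2 d)).
rewrite (tensor_dvE d e1 e2 dn dt (tidx_predl e2 d) (tidx_predr e2 d)).
by rewrite linearD linearZ /= !vtensor_linE !vmap_dv.
Qed.

Definition vtensor : vmor (btensor X Y) (btensor X' Y') := Vmor vtensor_dv.

Lemma vtensorE p q m n s t (e : m + s = p) (e' : n + t = q) x y :
  vtensor p q (tpure e e' x y) = tpure e e' (f m n x) (g s t y).
Proof. exact: vtensor_linE. Qed.
End VerticalMaps.

Transparent tobj.
Lemma projective_tensor_obj (X Y : bicomplex k) :
  (forall p q, projective (X p q)) -> (forall p q, projective (Y p q)) ->
  forall p q, projective (btensor X Y p q).
Proof.
move=> XP YP p q; apply: projective_dsum => u.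
exact: projective_tensor.
Qed.
Opaque tobj.

Lemma succl (a b c c' : int) : a + b = c' -> c = c' + 1 -> (a + 1) + b = c.
Proof. by move=> <- ->; rewrite addrAC. Qed.

Lemma succr (a b c c' : int) : a + b = c' -> c = c' + 1 -> a + (b + 1) = c.
Proof. by move=> <- ->; rewrite addrA. Qed.

Definition hraise (X : bicomplex k) : Type :=
  forall p p' q, p = p' + 1 -> {linear X p' q -> X p q}.

Section Raise.
Variables X Y : bicomplex k.

Lemma hraisel_bilinear (T : hraise X) p p' q (e : p = p' + 1) m n s t
    (e1 : m + s = p') (e2 : n + t = q) :
  bilinear2 (fun (x : X m n) (y : Y s t) =>
    tpure (succl e1 e) e2 (T _ _ _ (erefl (m + 1)) x) y : btensor X Y p q).
Proof.
by split=> [y a x x'|x a y y']; rewrite ?linearP ?tpure_linl ?tpure_linr.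
Qed.

Definition hraisel (T : hraise X) : hraise (btensor X Y) :=
  fun p p' q e => tlift (@hraisel_bilinear T p p' q e).

Lemma hraiselE (T : hraise X) p p' q (e : p = p' + 1) m m1 n s t
    (e1 : m + s = p') (e2 : n + t = q) (em : m1 = m + 1) (el : m1 + s = p) x y :
  hraisel T q e (tpure e1 e2 x y) = tpure el e2 (T _ _ _ em x) y.
Proof.
by subst m1; rewrite (tpure_irr el (succl e1 e) e2 e2); apply: tliftE.
Qed.

Lemma hraiser_bilinear (T : hraise Y) p p' q (e : p = p' + 1) m n s t
    (e1 : m + s = p') (e2 : n + t = q) :
  bilinear2 (fun (x : X m n) (y : Y s t) =>
    ksign k (m + n) *:
      tpure (succr e1 e) e2 x (T _ _ _ (erefl (s + 1)) y) : btensor X Y p q).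
Proof.
by split=> [y a x x'|x a y y']; rewrite ?linearP ?tpure_linl ?tpure_linr;
  rewrite scalerDr !scalerA [a * _]mulrC.
Qed.

(** This is 1 (x) T with the Koszul sign of an operator of total degree 1. *)
Definition hraiser (T : hraise Y) : hraise (btensor X Y) :=
  fun p p' q e => tlift (@hraiser_bilinear T p p' q e).

Lemma hraiserE (T : hraise Y) p p' q (e : p = p' + 1) m n s s1 t
    (e1 : m + s = p') (e2 : n + t = q) (es : s1 = s + 1) (er : m + s1 = p) x y :
  hraiser T q e (tpure e1 e2 x y) =
    ksign k (m + n) *: tpure er e2 x (T _ _ _ es y).
Proof.
by subst s1; rewrite (tpure_irr er (succr e1 e) e2 e2); apply: tliftE.
Qed.

Lemma vraisel_bilinear (S : vraise X) p q q' (d : q = q' + 1) m n s t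
    (e1 : m + s = p) (e2 : n + t = q') :
  bilinear2 (fun (x : X m n) (y : Y s t) =>
    tpure e1 (succl e2 d) (S _ _ _ (erefl (n + 1)) x) y : btensor X Y p q).
Proof.
by split=> [y a x x'|x a y y']; rewrite ?linearP ?tpure_linl ?tpure_linr.
Qed.

Definition vraisel (S : vraise X) : vraise (btensor X Y) :=
  fun p q q' d => tlift (@vraisel_bilinear S p q q' d).

Lemma vraiselE (S : vraise X) p q q' (d : q = q' + 1) m n n1 s t
    (e1 : m + s = p) (e2 : n + t = q') (dn : n1 = n + 1) (el : n1 + t = q) x y :
  vraisel S p d (tpure e1 e2 x y) = tpure e1 el (S _ _ _ dn x) y.
Proof.
by subst n1; rewrite (tpure_irr e1 e1 el (succl e2 d)); apply: tliftE.
Qed.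

(* The vertical map r is the identity in the tensor product of homotopies    *)
(* and the projection of a vhodge pair in vhodge_tensor.                     *)
Lemma vraiser_bilinear (r : vmor X X) (S : vraise Y) p q q' (d : q = q' + 1)
    m n s t (e1 : m + s = p) (e2 : n + t = q') :
  bilinear2 (fun (x : X m n) (y : Y s t) =>
    ksign k (m + n) *:
      tpure e1 (succr e2 d) (r _ _ x) (S _ _ _ (erefl (t + 1)) y) : btensor X Y p q).
Proof.
by split=> [y a x x'|x a y y']; rewrite ?linearP ?tpure_linl ?tpure_linr;
  rewrite scalerDr !scalerA [a * _]mulrC.
Qed.

Definition vraiser (r : vmor X X) (S : vraise Y) : vraise (btensor X Y) :=
  fun p q q' d => tlift (@vraiser_bilinear r S p q q' d).

Lemma vraiserE (r : vmor X X) (S : vraise Y) p q q' (d : q = q' + 1) m n s t t1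
    (e1 : m + s = p) (e2 : n + t = q') (dt : t1 = t + 1) (er : n + t1 = q) x y :
  vraiser r S p d (tpure e1 e2 x y) =
    ksign k (m + n) *: tpure e1 er (r _ _ x) (S _ _ _ dt y).
Proof.
by subst t1; rewrite (tpure_irr e1 e1 er (succr e2 d)); apply: tliftE.
Qed.

#[global] Opaque hraisel hraiser vraisel vraiser.

(** 1 - r (x) r' = (1 - r) (x) 1 + r (x) (1 - r') = [d_v, s (x) 1 + r (x) s']. The cross terms of s
    (x) 1 with 1 (x) d_v cancel by the sign rule, and those of r (x) s' with d_v (x) 1 vanish since
    d_v r = r d_v = 0. *)
Lemma vhodge_tensor (s : vraise X) (r : vmor X X) (s' : vraise Y) (r' : vmor Y Y) :
  vhodge s r -> vhodge s' r' ->
  vhodge (fun p q q' d => vraisel s p d \+ vraiser r s' p d) (vtensor r r').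
Proof.
move=> [dr rd sr] [dr' rd' sr']; split.
- move=> p q q' d x.
  apply: (tobj_ext (f := dv (btensor X Y) d \o vtensor r r' p q) (f' := \0)).
  move=> m n s0 t e1 e2 {}x y; rewrite /= vtensorE.
  rewrite (tensor_dvE d e1 e2 (predK n) (predK t) (tidx_predl e2 d) (tidx_predr e2 d)).
  by rewrite dr dr' tpure0l tpure0r scaler0 addr0.
- move=> p q q' d x.
  apply: (tobj_ext (f := vtensor r r' p q' \o dv (btensor X Y) d) (f' := \0)).
  move=> m n s0 t e1 e2 {}x y; rewrite /=.
  rewrite (tensor_dvE d e1 e2 (predK n) (predK t) (tidx_predl e2 d) (tidx_predr e2 d)).
  rewrite linearD linearZ /= !vtensor_linE.
  by rewrite rd rd' tpure0l tpure0r scaler0 addr0.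
move=> p q q1 qm d1 dm x.
pose F : {linear btensor X Y p q -> btensor X Y p q} :=
  (dv (btensor X Y) d1 \o (vraisel s p d1 \+ vraiser r s' p d1)) \+
  ((vraisel s p dm \+ vraiser r s' p dm) \o dv (btensor X Y) dm) \+
  vtensor r r' p q.
apply: (tobj_ext (f := F) (f' := idfun)) => m n s0 t e1 e2 {}x y.
rewrite /F [LHS]/= [RHS]/=.
have dn := predK n; have dt := predK t.
rewrite (tensor_dvE dm e1 e2 dn dt (tidx_predl e2 dm) (tidx_predr e2 dm)).
rewrite !linearD !linearZ /=.
have el1 := succl e2 d1; have er1 := succr e2 d1.
have elr : n + 1 + (t - 1) = q by rewrite addrACA subrr addr0.
have erl : n - 1 + (t + 1) = q by rewrite addrACA [- 1 + 1]addrC subrr addr0.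
rewrite (vraiselE s d1 e1 e2 erefl el1) (vraiserE r s' d1 e1 e2 erefl er1).
rewrite (vraiselE s dm e1 _ dn e2) (vraiserE r s' dm e1 _ dt e2).
rewrite (vraiselE s dm e1 _ (erefl (n + 1)) elr).
rewrite (vraiserE r s' dm e1 _ (erefl (t + 1)) erl).
rewrite linearZ /= (tensor_dvE d1 e1 el1 erefl dt e2 elr).
rewrite (tensor_dvE d1 e1 er1 dn erefl erl e2).
rewrite vtensorE dr rd !tpure0l !scaler0 !add0r.
rewrite !scalerA !ksign_sq !scale1r.
rewrite [m + (n + 1)]addrA ksignS scaleNr.
have <- : tpure e1 e2 (dv X erefl (s m (n + 1) n erefl x)) y +
    tpure e1 e2 (s m n (n - 1) dn (dv X dn x)) y + tpure e1 e2 (r m n x) y =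
    tpure e1 e2 x y by rewrite -!tpureDl sr.
have <- : tpure e1 e2 (r m n x) (dv Y erefl (s' s0 (t + 1) t erefl y)) +
    tpure e1 e2 (r m n x) (s' s0 t (t - 1) dt (dv Y dt y)) +
    tpure e1 e2 (r m n x) (r' s0 t y) = tpure e1 e2 (r m n x) y.
  by rewrite -!tpureDr sr'.
zmod_identity.
Qed.
End Raise.

Lemma vproj_tensor (X Y : bicomplex k) : vproj X -> vproj Y -> vproj (btensor X Y).
Proof.
move=> [XP [s [r h]]] [YP [s' [r' h']]]; split.
  exact: projective_tensor_obj.
by do 2!eexists; apply: vhodge_tensor h h'.
Qed.

(* On the vertical homology t is a contracting homotopy for d_h; unlike that *)
(* property, these equations are preserved by tensoring.                     *)
Definition contraction (X : bicomplex k) (t : hraise X) (s : vraise X) : Prop :=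
  (forall p p1 q q' (e : p1 = p + 1) (d : q = q' + 1) (x : X p q),
     dv X d (t _ _ _ e x) + t _ _ _ e (dv X d x) = 0) /\
  (forall p p1 pm q q1 qm (e1 : p1 = p + 1) (em : p = pm + 1)
     (d1 : q1 = q + 1) (dm : q = qm + 1) (x : X p q),
     dh X e1 (t _ _ _ e1 x) + t _ _ _ em (dh X em x) +
     dv X d1 (s _ _ _ d1 x) + s _ _ _ dm (dv X dm x) = x).

Definition contractible (X : bicomplex k) : Prop :=
  exists t s, contraction (X := X) t s.

Section ContractionTensor.
Variables X Y : bicomplex k.

(** T (x) 1 and S (x) 1 have odd total degree, so they anticommute with 1 (x) d_h and 1 (x) d_v;
    what remains is the contraction of X tensored with the identity. *)
Lemma contractible_tensorl : contractible X -> contractible (btensor X Y).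
Proof.
move=> [T [S [TS TSX]]].
exists (@hraisel X Y T), (@vraisel X Y S); split.
- move=> p p1 q q' e d x.
  pose F : {linear btensor X Y p q -> btensor X Y p1 q'} :=
    (dv (btensor X Y) d \o @hraisel X Y T _ _ q e) \+
    (@hraisel X Y T _ _ q' e \o dv (btensor X Y) d).
  apply: (tobj_ext (f := F) (f' := \0)) => m n s t e1 e2 {}x y.
  rewrite /F /=; have dn := predK n; have dt := predK t.
  rewrite (tensor_dvE d e1 e2 dn dt (tidx_predl e2 d) (tidx_predr e2 d)).
  rewrite linearD linearZ /= !(hraiselE T e e1 _ erefl (succl e1 e)).
  rewrite (tensor_dvE d _ e2 dn dt (tidx_predl e2 d) (tidx_predr e2 d)).
  rewrite (@ksign_addl k (m + 1) m n erefl) scaleNr.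
  have -> z : tpure (p := p1) (q := q') (succl e1 e) (tidx_predl e2 d)
      (T _ _ _ erefl (dv X dn x)) z =
      - tpure (succl e1 e) (tidx_predl e2 d) (dv X dn (T _ _ _ erefl x)) z.
    by apply/eqP; rewrite -addr_eq0 addrC -tpureDl TS tpure0l.
  zmod_identity.
move=> p p1 pm q q1 qm e1 em d1 dm x.
pose F : {linear btensor X Y p q -> btensor X Y p q} :=
  (dh (btensor X Y) e1 \o @hraisel X Y T _ _ q e1) \+
  (@hraisel X Y T _ _ q em \o dh (btensor X Y) em) \+
  (dv (btensor X Y) d1 \o @vraisel X Y S p _ _ d1) \+
  (@vraisel X Y S p _ _ dm \o dv (btensor X Y) dm).
apply: (tobj_ext (f := F) (f' := idfun)) => m n s t i1 i2 {}x y.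
rewrite /F /=; have dn := predK n; have dt := predK t.
have dm' := predK m; have ds := predK s.
rewrite (tensor_dhE em i1 i2 dm' ds (tidx_predl i1 em) (tidx_predr i1 em)).
rewrite (tensor_dvE dm i1 i2 dn dt (tidx_predl i2 dm) (tidx_predr i2 dm)).
rewrite !linearD !linearZ /=.
have elh : m + 1 + (s - 1) = p by rewrite addrACA subrr addr0.
have elv : n + 1 + (t - 1) = q by rewrite addrACA subrr addr0.
rewrite (hraiselE T e1 i1 i2 erefl (succl i1 e1)).
rewrite (hraiselE T em _ i2 dm' i1) (hraiselE T em _ i2 erefl elh).
rewrite (vraiselE S d1 i1 i2 erefl (succl i2 d1)).
rewrite (vraiselE S dm i1 _ dn i2) (vraiselE S dm i1 _ erefl elv).
rewrite (tensor_dhE e1 _ i2 erefl ds i1 elh).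
rewrite (tensor_dvE d1 i1 _ erefl dt i2 elv).
rewrite (@ksign_addl k (m + 1) m n erefl) [m + (n + 1)]addrA [m + n + 1]addrAC.
rewrite !scaleNr.
have <- : tpure i1 i2 (dh X erefl (T _ _ _ (erefl (m + 1)) x)) y +
    tpure i1 i2 (T _ _ _ dm' (dh X dm' x)) y +
    tpure i1 i2 (dv X erefl (S _ _ _ (erefl (n + 1)) x)) y +
    tpure i1 i2 (S _ _ _ dn (dv X dn x)) y = tpure i1 i2 x y.
  by rewrite -!tpureDl TSX.
zmod_identity.
Qed.

Lemma contractible_tensorr : contractible Y -> contractible (btensor X Y).
Proof.
move=> [T [S [TS TSX]]]; pose i := vert (bid X).
exists (@hraiser X Y T), (@vraiser X Y i S); split.
- move=> p p1 q q' e d x.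
  pose F : {linear btensor X Y p q -> btensor X Y p1 q'} :=
    (dv (btensor X Y) d \o @hraiser X Y T _ _ q e) \+
    (@hraiser X Y T _ _ q' e \o dv (btensor X Y) d).
  apply: (tobj_ext (f := F) (f' := \0)) => m n s t e1 e2 {}x y.
  rewrite /F /=; have dn := predK n; have dt := predK t.
  rewrite (tensor_dvE d e1 e2 dn dt (tidx_predl e2 d) (tidx_predr e2 d)).
  rewrite linearD linearZ /= !(hraiserE T e e1 _ erefl (succr e1 e)).
  rewrite linearZ /=.
  rewrite (tensor_dvE d _ e2 dn dt (tidx_predl e2 d) (tidx_predr e2 d)).
  rewrite (ksign_addr k m dn) scaleNr scalerDr !scalerA !ksign_sq !scale1r.
  have -> z : tpure (p := p1) (q := q') (succr e1 e) (tidx_predr e2 d) z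
      (T _ _ _ erefl (dv Y dt y)) =
      - tpure (succr e1 e) (tidx_predr e2 d) z (dv Y dt (T _ _ _ erefl y)).
    by apply/eqP; rewrite -addr_eq0 addrC -tpureDr TS tpure0r.
  zmod_identity.
move=> p p1 pm q q1 qm e1 em d1 dm x.
pose F : {linear btensor X Y p q -> btensor X Y p q} :=
  (dh (btensor X Y) e1 \o @hraiser X Y T _ _ q e1) \+
  (@hraiser X Y T _ _ q em \o dh (btensor X Y) em) \+
  (dv (btensor X Y) d1 \o @vraiser X Y i S p _ _ d1) \+
  (@vraiser X Y i S p _ _ dm \o dv (btensor X Y) dm).
apply: (tobj_ext (f := F) (f' := idfun)) => m n s t i1 i2 {}x y.
rewrite /F /=; have dn := predK n; have dt := predK t.
have dm' := predK m; have ds := predK s.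
rewrite (tensor_dhE em i1 i2 dm' ds (tidx_predl i1 em) (tidx_predr i1 em)).
rewrite (tensor_dvE dm i1 i2 dn dt (tidx_predl i2 dm) (tidx_predr i2 dm)).
rewrite !linearD !linearZ /=.
have erh : m - 1 + (s + 1) = p by rewrite addrACA [- 1 + 1]addrC subrr addr0.
have erv : n - 1 + (t + 1) = q by rewrite addrACA [- 1 + 1]addrC subrr addr0.
rewrite (hraiserE T e1 i1 i2 erefl (succr i1 e1)).
rewrite (hraiserE T em _ i2 ds i1) (hraiserE T em _ i2 erefl erh).
rewrite (vraiserE i S d1 i1 i2 erefl (succr i2 d1)).
rewrite (vraiserE i S dm i1 _ dt i2) (vraiserE i S dm i1 _ erefl erv).
rewrite !linearZ /=.
rewrite (tensor_dhE e1 _ i2 dm' erefl erh i1).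
rewrite (tensor_dvE d1 i1 _ dn erefl erv i2).
rewrite (ksign_addr k m dn) (ksign_addl k n dm').
rewrite !scaleNr !scalerDr !scalerA !ksign_sq !scale1r.
have <- : tpure i1 i2 x (dh Y erefl (T _ _ _ (erefl (s + 1)) y)) +
    tpure i1 i2 x (T _ _ _ ds (dh Y ds y)) +
    tpure i1 i2 x (dv Y erefl (S _ _ _ (erefl (t + 1)) y)) +
    tpure i1 i2 x (S _ _ _ dt (dv Y dt y)) = tpure i1 i2 x y.
  by rewrite -!tpureDr TSX.
zmod_identity.
Qed.
End ContractionTensor.
End TensorOperators.

(** * Acyclicity and contractions *)

Section Acyclic.
Variable k : comPzRingType.

Definition E2_acyclic (X : bicomplex k) : Prop :=
  forall (p p1 pm q q1 qm : int) (e1 : p1 = p + 1) (em : p = pm + 1)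
    (d1 : q1 = q + 1) (dm : q = qm + 1) (x : X p q) (y : X pm q1),
  dv X dm x = 0 -> dh X em x = dv X d1 y ->
  exists z w, dv X dm z = 0 /\ x = dh X e1 z + dv X d1 w.

Lemma contractible_acyclic (X : bicomplex k) : contractible X -> E2_acyclic X.
Proof.
move=> [t [s [ts tsE]]] p p1 pm q q1 qm e1 em d1 dm x y dx hx.
(* The second witness absorbs t d_h x = t d_v y = - d_v t y. *)
exists (t _ _ _ e1 x), (s _ _ _ d1 x - t _ _ _ em y); split.
  by have := ts _ _ _ _ e1 dm x; rewrite dx linear0 addr0.
have := tsE _ _ _ _ _ _ e1 em d1 dm x; rewrite dx linear0 addr0 hx => E.
rewrite linearB /= -[LHS]E.
have := ts _ _ _ _ em d1 y => /eqP; rewrite addrC addr_eq0 => /eqP ->.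
zmod_identity.
Qed.

Section VsplitWeq.
Variables (A B C : bicomplex k) (f : bimor A B) (c : bimor B C).
Variables (r : vmor B A) (j : vmor C B).
Hypothesis fS : vsplit f c r j.

Lemma vsplit_ker p q (y : B p q) : c p q y = 0 -> y = f p q (r p q y).
Proof. by have [_ _ frjc _] := fS => cy; rewrite -{1}(frjc _ _ y) cy linear0 addr0. Qed.

(** The vertical splitting makes H^v short exact, and this is the resulting long exact sequence of
    H^h, chased on elements. *)
Lemma vsplit_weq : E2_acyclic C -> CE_weq f.
Proof.
have [rf cj frjc cf] := fS => CA; apply/CE_weqP.
split=> p p1 pm q q1 qm e1 em d1 dm.
  move=> x y z w dx hx dz fx.
  have [||z1 [w1 [dz1 czE]]] :=
      CA _ _ _ _ _ _ (erefl (p1 + 1)) e1 d1 dm (c _ _ z) (- c _ _ w).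
  - by rewrite -bmap_dv dz linear0.
  - rewrite linearN -bmap_dh -bmap_dv; apply/eqP; rewrite -addr_eq0 -linearD /=.
    by rewrite -fx cf.
  (* The corrections make c z' = 0, so that z' comes from A, and they change d_h z only by a
     vertical boundary. *)
  pose z' := z - dh B erefl (j _ _ z1) - dv B d1 (j _ _ w1).
  have z'E : z' = f _ _ (r _ _ z').
    apply: vsplit_ker; rewrite /z' !linearB /= czE bmap_dh bmap_dv !cj.
    zmod_identity.
  have dz' : dv B dm z' = 0.
    rewrite /z' !linearB /= dz dvdv dv_dh -vmap_dv dz1 !linear0.
    zmod_identity.
  exists (r _ _ z'), (r _ _ (w - dh B e1 (j _ _ w1))); split.
    by rewrite -vmap_dv dz' linear0.
  rewrite -vmap_dv -[LHS]rf fx.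
  have hz' : dh B e1 z' = dh B e1 z + dv B d1 (dh B e1 (j _ _ w1)).
    by rewrite /z' !linearB /= dhdh dh_dv; zmod_identity.
  (* In general r does not commute with d_h; it does on the image of f, where z' lies. *)
  have -> : dh A e1 (r _ _ z') = r _ _ (dh B e1 z').
    by rewrite [in RHS]z'E -bmap_dh rf.
  rewrite -linearD hz' linearB /=; congr (r _ _ _).
  zmod_identity.
move=> y v dy hy.
have [||z [w1 [dz cyE]]] := CA _ _ _ _ _ _ e1 em d1 dm (c _ _ y) (c _ _ v).
- by rewrite -bmap_dv dy linear0.
- by rewrite -bmap_dh -bmap_dv hy.
pose y' := y - dh B e1 (j _ _ z) - dv B d1 (j _ _ w1).
have y'E : y' = f _ _ (r _ _ y').
  apply: vsplit_ker; rewrite /y' !linearB /= cyE bmap_dh bmap_dv !cj.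
  zmod_identity.
have dy' : dv B dm y' = 0.
  rewrite /y' !linearB /= dy dvdv dv_dh -vmap_dv dz !linear0.
  zmod_identity.
exists (r _ _ y'), (r _ _ (v + dh B em (j _ _ w1))), (j _ _ z), (j _ _ w1); split.
- by rewrite -vmap_dv dy' linear0.
- have -> : dh A em (r _ _ y') = r _ _ (dh B em y').
    by rewrite [in RHS]y'E -bmap_dh rf.
  rewrite -vmap_dv; congr (r _ _ _).
  by rewrite /y' !linearB linearD /= dhdh hy dh_dv; zmod_identity.
- by rewrite -vmap_dv dz linear0.
by rewrite -y'E /y'; zmod_identity.
Qed.

(** The connecting class of x becomes zero in B, hence is zero in A; so j x can be corrected by an
    element of A to an E2 cycle of B, which comes from A up to boundaries. *)
Lemma vsplit_weq_acyclic : CE_weq f -> E2_acyclic C.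
Proof.
have [rf cj frjc cf] := fS => /CE_weqP [fI fSu].
move=> p p1 pm q q1 qm e1 em d1 dm x y dx hx.
(* This represents the image of x under the connecting homomorphism. *)
pose b := dh B em (j _ _ x) - dv B d1 (j _ _ y).
pose a := r _ _ b.
have fa : b = f _ _ a.
  apply: vsplit_ker; rewrite /b linearB /= bmap_dh bmap_dv !cj hx subrr //.
have db : dv B dm b = 0.
  by rewrite /b linearB /= dv_dh dvdv -vmap_dv dx !linear0; zmod_identity.
have da : dv A dm a = 0 by rewrite /a -vmap_dv db linear0.
have ha : dh A (predK pm) a = dv A d1 (r _ _ (dh B (predK pm) (j _ _ y))).
  rewrite -vmap_dv -[LHS]rf bmap_dh -fa; congr (r _ _ _).
  by rewrite /b linearB /= dhdh dh_dv; zmod_identity.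
have [||z [w [dz aE]]] := 
    fI _ _ _ _ _ _ em (predK pm) d1 dm a _ (j _ _ x) (- j _ _ y) da ha.
- by rewrite -vmap_dv dx linear0.
- by rewrite -fa /b linearN.
have [||x' [u [z' [w' [dx' hx' dz' xE]]]]] := fSu _ _ _ _ _ _ e1 em d1 dm
    (j _ _ x - f _ _ z) (j _ _ y + f _ _ w).
- by rewrite linearB /= -bmap_dv dz linear0 -vmap_dv dx linear0 subrr.
- rewrite linearB linearD /= -!bmap_dh -!bmap_dv.
  have := fa; rewrite aE linearD /= /b => /eqP; rewrite subr_eq => /eqP ->.
  by zmod_identity.
exists (c _ _ z'), (c _ _ w'); split; first by rewrite -bmap_dv dz' linear0.
have := congr1 (bmap c) xE; rewrite !linearB !linearD /= cj !cf !bmap_dh !bmap_dv.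
by rewrite subr0 add0r.
Qed.
End VsplitWeq.

(** * From acyclicity to a contraction *)

Section ProjectiveContraction.
Variables (X : bicomplex k) (XP : vproj X) (XA : E2_acyclic X).

(** The usual contraction of a bounded below exact complex of projectives, carried out for H^v on
    representatives: r induces the identity there, takes values in cycles and kills boundaries,
    while the lifting itself starts from the projective module X p q. *)
Lemma vproj_horizontal_homotopy : exists t : hraise X,
  [/\ forall p p1 q q' (e : p1 = p + 1) (d : q = q' + 1) (x : X p q),
        dv X d (t _ _ _ e x) = 0,
      forall p p1 q q' (e : p1 = p + 1) (d : q = q' + 1) (x : X p q),
        t _ _ _ e (dv X d x) = 0 &
      forall p p1 pm q q1 qm (e1 : p1 = p + 1) (em : p = pm + 1)
        (d1 : q1 = q + 1) (dm : q = qm + 1) (x : X p q), dv X dm x = 0 ->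
        exists w, x = dh X e1 (t _ _ _ e1 x) + t _ _ _ em (dh X em x) + dv X d1 w].
Proof.
have [Xproj [s [r [dr rd sr]]]] := XP.
pose T p := forall p1 q, p1 = p + 1 -> {linear X p q -> X p1 q}.
(* For horizontally closed x the term t d_h x drops out, so the last clause states the homotopy
   identity within column p alone. *)
pose G p (t : T p) :=
  [/\ forall p1 q q' (e : p1 = p + 1) (d : q = q' + 1) x, dv X d (t _ _ e x) = 0,
      forall p1 q q' (e : p1 = p + 1) (d : q = q' + 1) (x : X p q), 
        t _ _ e (dv X d x) = 0 &
      forall p1 pm q q1 qm (e1 : p1 = p + 1) (em : p = pm + 1)
        (d1 : q1 = q + 1) (dm : q = qm + 1) (x : X p q), dv X dm x = 0 ->
        dh X em x = 0 -> exists w, x = dh X e1 (t _ _ e1 x) + dv X d1 w].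
pose R p p' (e : p = p' + 1) (t' : T p') (t : T p) :=
  forall p1 q q1 qm (e1 : p1 = p + 1)
    (d1 : q1 = q + 1) (dm : q = qm + 1) (x : X p q), dv X dm x = 0 ->
    exists w, x = dh X e1 (t _ _ e1 x) + t' _ _ e (dh X e x) + dv X d1 w.
have [|||t [tG tR]] := @int_dependent_choice T G R (fun p p1 q e => \0); last first.
- exists (fun p p' q e => t p' p q e); split=> [p p1 q q' e d x|p p1 q q' e d x|].
  + by have [h _ _] := tG p; apply: h.
  + by have [_ h _] := tG p; apply: h.
  + by move=> p p1 pm q q1 qm e1 em d1 dm x dx; apply: (tR p pm em _ _ _ _ e1 d1 dm).
- move=> p p' e t' [dt' t'd t'h].
  have L p1 q (e1 : p1 = p + 1) : {l : {linear X p q -> (X p1 q * X p (q + 1)%R)%type} |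
      forall x, dh X e1 (l x).1 + dv X erefl (l x).2 =
          r p q x - t' _ _ e (dh X e (r p q x)) /\ dv X (predK q) (l x).1 = 0}.
    apply: cid.
    have [|l hl] := Xproj p q _ _
      (lpair ((dh X e1 \o fst) \+ (dv X erefl \o snd))
             (dv X (predK q) \o fst) : {linear (X p1 q * X p (q + 1)%R)%type -> _})
      (lpair (r p q \- (t' _ _ e \o (dh X e \o r p q))) \0); last first.
      by exists l => x; have [h1 h2] := hl x.
    move=> x; pose x0 := r p q x - t' _ _ e (dh X e (r p q x)).
    have dhr : dv X (predK q) (dh X e (r p q x)) = 0.
      by rewrite dv_dh dr linear0 oppr0.
    (* Applied to the horizontal cycle d_h r x, the invariant of the previous column shows that d_h
       x0 is a vertical boundary, so acyclicity applies to x0. *)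
    have [w wE] := t'h _ _ _ _ _ e (predK p') (erefl (q + 1)) _ _ dhr (dhdh _ _ _).
    have [||z [w' [dz zE]]] := @XA _ _ _ _ _ _ e1 e (erefl (q + 1)) (predK q) x0 w.
    - by rewrite /x0 linearB /= dr dt' subrr.
    - by rewrite /x0 linearB /= {1}wE; zmod_identity.
    by exists (z, w'); rewrite /= -zE dz.
  (* The additional r makes t vanish on vertical boundaries. *)
  pose t : T p := fun p1 q e1 => fst \o (projT1 (L p1 q e1) \o r p q).
  have tR : R p p' e t' t.
    move=> p1 q q1 qm e1 d1 dm x dx; subst q1.
    have xE : x = r p q (r p q x) + 
        dv X erefl (s p _ _ erefl x + s p _ _ erefl (r p q x)).
      have := sr p _ _ _ (erefl (q + 1)) dm x; rewrite dx linear0 addr0 => {1}<-.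
      have := sr p _ _ _ (erefl (q + 1)) dm (r p q x); rewrite dr linear0 addr0 => {1}<-.
      by rewrite linearD /=; zmod_identity.
    have [h1 _] := projT2 (L p1 q e1) (r p q x).
    set u := s p _ _ erefl x + _ in xE.
    exists ((projT1 (L p1 q e1) (r p q x)).2 + u).
    have h2 : r p q (r p q x) = x - dv X erefl u by rewrite {2}xE addrK.
    have h3 : t' _ _ e (dh X e (dv X erefl u)) = 0 by rewrite dh_dv linearN t'd oppr0.
    rewrite h2 in h1; move: u h1 h3 {xE h2} => u.
    rewrite !linearB /= => h1 h3; rewrite h3 in h1.
    have h4 : dh X e1 (projT1 (L p1 q e1) (r p q x)).1 +
        dv X erefl (projT1 (L p1 q e1) (r p q x)).2 =
        x - dv X erefl u - t' _ _ e (dh X e x) by rewrite h1; zmod_identity.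
    have E : x = x - dv X erefl u - t' _ _ e (dh X e x) + t' _ _ e (dh X e x) +
        dv X erefl u by zmod_identity.
    by apply: (etrans E); rewrite -h4 linearD /=; zmod_identity.
  exists t; split; last exact: tR.
  split=> [p1 q q' e1 d x|p1 q q' e1 d x|].
  + have qE := pred_eq d; subst q'; rewrite (eq_irrelevance d (predK q)).
    by case: (projT2 (L p1 q e1) (r p q x)).
  + by rewrite /t /= rd linear0.
  + move=> p1 pm q q1 qm e1 em d1 dm x dx hx.
    have pE := pred_eq em; have := pred_eq e; rewrite -pE => E; subst p'.
    have [w wE] := tR _ _ _ _ e1 d1 dm x dx; exists w.
    by rewrite {1}wE (eq_irrelevance e em) hx linear0 addr0.
- by move=> p p' e t' t p0 p1 q q1 qm e1 d1 dm x _; exists 0;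
    rewrite (bobj0 x p0) !linear0 !addr0.
- move=> p t p0; split=> [p1 q q' e d x|p1 q q' e d x|p1 pm q q1 qm e1 em d1 dm x _ _].
  + by rewrite (bobj0 x p0) !linear0.
  + by rewrite (bobj0 x p0) !linear0.
  + by exists 0; rewrite (bobj0 x p0) !linear0 addr0.
Qed.

(** Put phi = 1 - [d_h, t]. As t kills boundaries and takes values in cycles, phi d_v = d_v = d_v
    phi, and phi r takes values in boundaries. Expanding phi = phi (d_v s + s d_v + r) gives phi =
    [d_v, s'] with s' = phi s + s phi r. *)
Lemma vproj_contractible : contractible X.
Proof.
have [t [dt td tE]] := vproj_horizontal_homotopy.
have [_ [s [r sr]]] := XP; have sd := vhodge_regular sr.
have [dr rd srE] := sr.
pose phi p q : {linear X p q -> X p q} := idfun \-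
  (dh X (erefl (p + 1)) \o t _ _ _ (erefl (p + 1))) \-
  (t _ _ _ (predK p) \o dh X (predK p)).
have phiE p p1 pm q (e1 : p1 = p + 1) (em : p = pm + 1) (x : X p q) :
    phi p q x = x - dh X e1 (t _ _ _ e1 x) - t _ _ _ em (dh X em x).
  by have pE := pred_eq em; subst p1 pm; rewrite (eq_irrelevance em (predK p)).
have phid p q q' (d : q = q' + 1) (x : X p q) : phi p q' (dv X d x) = dv X d x.
  rewrite /phi /= td linear0 dh_dv linearN td; zmod_identity.
have phir p q q1 (d : q1 = q + 1) (x : X p q) :
    dv X d (s p _ _ d (phi p q (r p q x))) = phi p q (r p q x).
  have [w wE] := tE _ _ _ _ _ _ (erefl (p + 1)) (predK p) d (predK q)
    (r p q x) (dr _ _ _ _ _).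
  have -> : phi p q (r p q x) = dv X d w.
    by rewrite /phi /= {1}wE; zmod_identity.
  exact: sd.
have dphi p q q' (d : q = q' + 1) (x : X p q) : dv X d (phi p q x) = dv X d x.
  by rewrite /phi /= !linearB /= dv_dh !dt linear0; zmod_identity.
move: phi phiE phid phir dphi => phi phiE phid phir dphi.
pose s' : vraise X := fun p q q' d =>
  (phi p q \o s p q q' d) \+ (s p q q' d \o (phi p q' \o r p q')).
exists t, s'; split=> [p p1 q q' e d x|p p1 pm q q1 qm e1 em d1 dm x].
  by rewrite dt td addr0.
have : phi p q x = dv X d1 (s' _ _ _ d1 x) + s' _ _ _ dm (dv X dm x).
  rewrite /s' /= linearD /= dphi phir rd !linear0.
  rewrite -{1}(srE _ _ _ _ d1 dm x) !linearD /= phid.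
  zmod_identity.
by rewrite -addrA => <-; rewrite (phiE _ _ _ _ e1 em); zmod_identity.
Qed.
End ProjectiveContraction.
End Acyclic.

(** * The pushout-product and unit axioms *)

Section WeakEquivalences.
Variable k : comPzRingType.

Lemma CE_weq_id (X : bicomplex k) : CE_weq (bid X).
Proof.
apply/CE_weqP; split=> p p1 pm q q1 qm e1 em d1 dm; first by move=> x y z w; exists z, w.
by move=> y v dy hy; exists y, v, 0, 0; rewrite !linear0 !addr0.
Qed.

Lemma CE_weq_comp (X Y Z : bicomplex k) (g : bimor Y Z) (f : bimor X Y) :
  CE_weq g -> CE_weq f -> CE_weq (bcomp g f).
Proof.
move=> /CE_weqP [gI gS] /CE_weqP [fI fS]; apply/CE_weqP.
split=> p p1 pm q q1 qm e1 em d1 dm.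
  move=> x y z w dx hx dz gfx.
  have [||z1 [w1 [dz1 fx]]] := gI _ _ _ _ _ _ e1 em d1 dm (f _ _ x) (f _ _ y)
     z w _ _ dz gfx.
  - by rewrite -bmap_dv dx linear0.
  - by rewrite -bmap_dh -bmap_dv hx.
  exact: fI _ _ _ _ _ _ e1 em d1 dm x y z1 w1 dx hx dz1 fx.
move=> y v dy hy.
have [x1 [u1 [z1 [w1 [dx1 hx1 dz1 yE]]]]] := gS _ _ _ _ _ _ e1 em d1 dm y v dy hy.
have [x [u [z [w [dx hx dz x1E]]]]] := fS _ _ _ _ _ _ e1 em d1 dm x1 u1 dx1 hx1.
exists x, u, (g _ _ z + z1), (g _ _ w + w1); split=> //.
  by rewrite linearD /= dz1 -bmap_dv dz linear0 addr0.
by rewrite yE x1E !linearD /= !bmap_dh !bmap_dv; zmod_identity.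
Qed.

(** This and [retraction_weq] are the cases of two-out-of-three that the unit axiom uses. *)
Lemma section_weq (X Y : bicomplex k) (e : bimor Y X) (s : bimor X Y) :
  (forall p q x, e p q (s p q x) = x) -> CE_weq e -> CE_weq s.
Proof.
move=> es /CE_weqP [eI eS]; apply/CE_weqP.
split=> p p1 pm q q1 qm e1 em d1 dm.
  move=> x y z w dx hx dz sx; exists (e _ _ z), (e _ _ w).
  rewrite -bmap_dv dz linear0; split=> //.
  by rewrite -[LHS]es sx linearD /= bmap_dh bmap_dv.
move=> y v dy hy.
have [||||z [w [dz yE]]] := eI _ _ _ _ _ _ e1 em d1 dm
  (y - s _ _ (e _ _ y)) (v - s _ _ (e _ _ v)) 0 0.
- by rewrite linearB /= -!bmap_dv dy !linear0; zmod_identity.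
- by rewrite !linearB /= -!bmap_dh -!bmap_dv hy.
- by rewrite linear0.
- by rewrite linearB /= es !linear0; zmod_identity.
exists (e _ _ y), (e _ _ v), z, w; split=> //.
- by rewrite -bmap_dv dy linear0.
- by rewrite -bmap_dh -bmap_dv hy.
by rewrite -addrA -yE subrKC.
Qed.

Lemma retraction_weq (X Y : bicomplex k) (e : bimor Y X) (s : bimor X Y) :
  (forall p q x, e p q (s p q x) = x) -> CE_weq s -> CE_weq e.
Proof.
move=> es /CE_weqP [sI sS]; apply/CE_weqP.
split=> p p1 pm q q1 qm e1 em d1 dm.
  move=> y v z w dy hy dz ey.
  have [x [u [z1 [w1 [dx hx dz1 yE]]]]] := sS _ _ _ _ _ _ e1 em d1 dm y v dy hy.
  exists (s _ _ (z - e _ _ z1) + z1), (s _ _ (w - e _ _ w1) + w1); split.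
    by rewrite linearD /= dz1 -bmap_dv linearB /= dz -bmap_dv dz1 !(linear0, addr0).
  have xE : x = dh X e1 (z - e _ _ z1) + dv X d1 (w - e _ _ w1).
    have := ey; rewrite yE !linearD /= es => E.
    rewrite !linearN /= -!bmap_dh -!bmap_dv.
    apply: (addIr (e _ _ (dh Y e1 z1) + e _ _ (dv Y d1 w1))).
    by rewrite addrA E; zmod_identity.
  by rewrite yE xE !linearD /= !bmap_dh !bmap_dv; zmod_identity.
move=> y v dy hy; exists (s _ _ y), (s _ _ v), 0, 0.
split; rewrite ?linear0 //.
- by rewrite -bmap_dv dy linear0.
- by rewrite -bmap_dh -bmap_dv hy.
by rewrite es !addr0.
Qed.
End WeakEquivalences.

Section VsplitStability.
Variable k : comPzRingType.

Lemma vtensor_ext (X Y W : bicomplex k) (u v : vmor (btensor X Y) W) :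
  (forall p q m n s t (e : m + s = p) (e' : n + t = q) (x : X m n) (y : Y s t),
    u p q (tpure e e' x y) = v p q (tpure e e' x y)) ->
  forall p q x, u p q x = v p q x.
Proof. by move=> uv p q x; apply: (tobj_ext (f := u p q) (f' := v p q)). Qed.

Lemma vsplit_tensorl (A B C Z : bicomplex k) (f : bimor A B) (c : bimor B C)
    (r : vmor B A) (j : vmor C B) :
  vsplit f c r j ->
  vsplit (btensor_map f (bid Z)) (btensor_map c (bid Z))
    (vtensor r (vert (bid Z))) (vtensor j (vert (bid Z))).
Proof.
move=> [rf cj frjc cf].
set F := btensor_map f _; set D := btensor_map c _.
set R := vtensor r _; set J := vtensor j _; split.
- apply: (vtensor_ext (u := vcomp R (vert F)) (v := vert (bid _))).
  by move=> * /=; rewrite (tmapE f (bid Z)) (vtensor_linE r) /= rf.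
- apply: (vtensor_ext (u := vcomp (vert D) J) (v := vert (bid _))).
  by move=> * /=; rewrite (vtensor_linE j) (tmapE c (bid Z)) /= cj.
- apply: (vtensor_ext (u := vadd (vcomp (vert F) R) (vcomp J (vert D)))
    (v := vert (bid _))).
  by move=> * /=; rewrite (vtensor_linE r) (tmapE f (bid Z)) (tmapE c (bid Z))
    (vtensor_linE j) /= -tpureDl frjc.
apply: (vtensor_ext (u := vcomp (vert D) (vert F)) (v := vzero _ _)).
by move=> * /=; rewrite (tmapE f (bid Z)) (tmapE c (bid Z)) /= cf tpure0l.
Qed.

Lemma vsplit_tensorr (A B C Z : bicomplex k) (f : bimor A B) (c : bimor B C)
    (r : vmor B A) (j : vmor C B) :
  vsplit f c r j ->
  vsplit (btensor_map (bid Z) f) (btensor_map (bid Z) c)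
    (vtensor (vert (bid Z)) r) (vtensor (vert (bid Z)) j).
Proof.
move=> [rf cj frjc cf].
set F := btensor_map _ f; set D := btensor_map _ c.
set R := vtensor _ r; set J := vtensor _ j; split.
- apply: (vtensor_ext (u := vcomp R (vert F)) (v := vert (bid _))).
  by move=> * /=; rewrite (tmapE (bid Z) f) (vtensor_linE _ r) /= rf.
- apply: (vtensor_ext (u := vcomp (vert D) J) (v := vert (bid _))).
  by move=> * /=; rewrite (vtensor_linE _ j) (tmapE (bid Z) c) /= cj.
- apply: (vtensor_ext (u := vadd (vcomp (vert F) R) (vcomp J (vert D)))
    (v := vert (bid _))).
  by move=> * /=; rewrite (vtensor_linE _ r) (tmapE (bid Z) f) (tmapE (bid Z) c)
    (vtensor_linE _ j) /= -tpureDr frjc.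
apply: (vtensor_ext (u := vcomp (vert D) (vert F)) (v := vzero _ _)).
by move=> * /=; rewrite (tmapE (bid Z) f) (tmapE (bid Z) c) /= cf tpure0r.
Qed.

(** The cokernel does not change: the new retraction is glued from u r and the identity of X, and
    the new section is v j. *)
Lemma vsplit_pushout (A B C X Y : bicomplex k) (f : bimor A B) (c : bimor B C)
    (r : vmor B A) (j : vmor C B) (u : bimor A X) (v : bimor B Y) (g : bimor X Y) :
  vsplit f c r j -> is_pushout f u v g ->
  exists c' r' j', vsplit (C := C) g c' r' j'.
Proof.
move=> [rf cj frjc cf] poP; have [vfgu poU] := poP.
have vf p q x : v p q (f p q x) = g p q (u p q x).
  exact: (congr1 (fun h : bimor A Y => h p q x) vfgu).
have [r' [r'v r'g]] := pushout_vlift poP (u := vcomp (vert u) r) (v := vert (bid X))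
  (fun p q x => congr1 (bmap u) (rf p q x)).
pose z : bimor X C := bcomp (bzero_mor C) (bto0 X).
have [|c' [[c'v c'g] _]] := poU C c z.
  by apply: bimor_eq => p q x /=; rewrite cf.
have {}c'v p q x : c' p q (v p q x) = c p q x.
  exact: (congr1 (fun h : bimor B C => h p q x) c'v).
have {}c'g p q x : c' p q (g p q x) = 0.
  exact: (congr1 (fun h : bimor X C => h p q x) c'g).
exists c', r', (vcomp (vert v) j); split=> //.
  by move=> p q x /=; rewrite c'v cj.
apply: (pushout_vext poP (w := vadd (vcomp (vert g) r')
  (vcomp (vcomp (vert v) j) (vert c'))) (w' := vert (bid Y))).
  by move=> p q x; rewrite /= r'v c'v /= -vf -linearD frjc.
by move=> p q x; rewrite /= r'g c'g !linear0 addr0.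
Qed.

(** Decompose b (x) x as f r b (x) x + j c b (x) g r' x + j c b (x) j' c' x. The first two terms
    come from P through l and i, which dictates [rw]; the last is the part on C (x) E. *)
Lemma vsplit_pushout_product (A B C K L E P : bicomplex k)
    (f : bimor A B) (c : bimor B C) (r : vmor B A) (j : vmor C B)
    (g : bimor K L) (c' : bimor L E) (r' : vmor L K) (j' : vmor E L)
    (i : bimor (btensor B K) P) (l : bimor (btensor A L) P)
    (w : bimor P (btensor B L)) :
  vsplit f c r j -> vsplit g c' r' j' ->
  is_pushout (btensor_map f (bid K)) (btensor_map (bid A) g) i l ->
  bcomp w i = btensor_map (bid B) g -> bcomp w l = btensor_map f (bid L) ->
  exists rw, vsplit w (btensor_map c c') rw (vtensor j j').
Proof.
move=> [rf cj frjc cf] [rg cj' grjc cg] poP wi wl; have [il _] := poP.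
have {}wi p q x : w p q (i p q x) = btensor_map (bid B) g p q x.
  exact: (congr1 (fun h : bimor _ (btensor B L) => h p q x) wi).
have {}wl p q x : w p q (l p q x) = btensor_map f (bid L) p q x.
  exact: (congr1 (fun h : bimor _ (btensor B L) => h p q x) wl).
have {}il p q x :
    i p q (btensor_map f (bid K) p q x) = l p q (btensor_map (bid A) g p q x).
  exact: (congr1 (fun h : bimor _ P => h p q x) il).
pose rw := vadd (vcomp (vert l) (vtensor r (vert (bid L))))
  (vcomp (vert i) (vtensor (vcomp j (vert c)) r')).
exists rw; split.
- apply: (pushout_vext poP (w := vcomp rw (vert w)) (w' := vert (bid P))).
    apply: (vtensor_ext (u := vcomp (vcomp rw (vert w)) (vert i)) (v := vert i)).
    move=> p q m n s t e e' x y; rewrite [LHS]/= wi /=.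
    rewrite (tmapE (bid B) g) (vtensor_linE r) (vtensor_linE _ r') /= rg.
    rewrite -[in RHS](frjc _ _ x) tpureDl linearD /=.
    by have := il p q (tpure e e' (r _ _ x) y);
      rewrite /= (tmapE f (bid K)) (tmapE (bid A) g) /= => ->.
  apply: (vtensor_ext (u := vcomp (vcomp rw (vert w)) (vert l)) (v := vert l)).
  move=> p q m n s t e e' x y; rewrite [LHS]/= wl /=.
  rewrite (tmapE f (bid L)) (vtensor_linE r) (vtensor_linE _ r') /= rf cf.
  by rewrite linear0 tpure0l linear0 addr0.
- apply: (vtensor_ext (u := vcomp (vert (btensor_map c c')) (vtensor j j'))
    (v := vert (bid _))).
  by move=> * /=; rewrite (vtensor_linE j j') (tmapE c c') /= cj cj'.
- apply: (vtensor_ext (u := vadd (vcomp (vert w) rw)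
    (vcomp (vtensor j j') (vert (btensor_map c c')))) (v := vert (bid _))).
  move=> p q m n s t e e' x y /=.
  rewrite linearD /= wl wi /= (vtensor_linE r) (vtensor_linE _ r') (tmapE c c').
  rewrite (vtensor_linE j j') (tmapE f (bid L)) (tmapE (bid B) g) /=.
  by rewrite -addrA -tpureDr grjc -tpureDl frjc.
pose cw := vcomp (vert (btensor_map c c')) (vert w).
apply: (pushout_vext poP (w := cw) (w' := vzero _ _)).
  apply: (vtensor_ext (u := vcomp cw (vert i)) (v := vzero _ _)).
  by move=> p q m n s t e e' x y; rewrite [LHS]/= wi /=
    (tmapE (bid B) g) (tmapE c c') /= cg tpure0r.
apply: (vtensor_ext (u := vcomp cw (vert l)) (v := vzero _ _)).
by move=> p q m n s t e e' x y; rewrite [LHS]/= wl /=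
  (tmapE f (bid L)) (tmapE c c') /= cf tpure0l.
Qed.
End VsplitStability.

Section MonoidalModelCategory.
Variable k : comPzRingType.

Lemma triv_cof_contractible (A B : bicomplex k) (f : bimor A B) :
  CE_triv_cof f ->
  exists C (c : bimor B C) r j, vsplit f c r j /\ contractible C.
Proof.
move=> [/cof_vsplit [C [c [r [j [fS CP]]]]] fW].
exists C, c, r, j; split=> //.
exact: vproj_contractible CP (vsplit_weq_acyclic fS fW).
Qed.

Lemma CE_pushout_product : pushout_product_axiom k.
Proof.
move=> A B K L f g fC gC P i l poP w wi wl.
have [C [c [r [j [fS CP]]]]] := cof_vsplit fC.
have [E [c' [r' [j' [gS EP]]]]] := cof_vsplit gC.
have [rw wS] := vsplit_pushout_product fS gS poP wi wl.
split; first exact: vsplit_cof wS (vproj_tensor CP EP).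
move=> fgW; apply: (vsplit_weq wS); apply: contractible_acyclic.
case: fgW => [fW|gW].
  by apply/contractible_tensorl/vproj_contractible/(vsplit_weq_acyclic fS).
by apply/contractible_tensorr/vproj_contractible/(vsplit_weq_acyclic gS).
Qed.

Lemma vproj_bunit : vproj (bunit k).
Proof.
split=> [p q|].
  rewrite /= /unit_obj; case: ifP => _; first exact: projective_regular.
  exact: projective_zero_module.
have [|r h] := @vhodge_of_regular k (bunit k) (fun _ _ _ _ => \0).
  by move=> *; rewrite linear0.
by do 2!eexists; apply: h.
Qed.

Lemma CE_cofibrant_bunit : CE_cofibrant (bunit k).
Proof.
apply: (@vsplit_cof _ _ _ _ _ (bid _) (vzero _ _) (vert (bid _)) _ vproj_bunit).
split=> p q x //=; last exact: add0r.
by rewrite (zero_moduleP x).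
Qed.

Lemma CE_unit : unit_axiom k.
Proof.
move=> Q e QC eF eW X _.
have sq : bcomp e (bzero_mor Q) = bcomp (bid (bunit k)) (bzero_mor (bunit k)).
  by apply: bimor_eq => p q x /=; rewrite linear0.
have [s [_ es]] := CE_cofibrant_bunit eF eW sq.
have {}es p q x : e p q (s p q x) = x.
  exact: (congr1 (fun h : bimor _ (bunit k) => h p q x) es).
(* Splitting 0 -> Q makes c a vertical isomorphism from Q to C with inverse j. *)
have QP : vproj Q.
  have [C [c [r [j [[_ _ frjc _] CP]]]]] := cof_vsplit QC.
  apply: (vproj_retract (i := vert c) (r := j) _ CP) => p q x.
  by rewrite -[RHS]frjc /= add0r.
have [K [c [j sS]]] := retract_vsplit (r := vert e) es.
have KC : contractible K.
  apply: vproj_contractible (vsplit_weq_acyclic sS (section_weq es eW)).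
  by apply: (vproj_retract (i := j) (r := vert c) _ QP); have [] := sS.
split.
  apply: (retraction_weq (s := btensor_map s (bid X))).
    apply: (vtensor_ext (u := vcomp (vert (btensor_map e (bid X)))
      (vert (btensor_map s (bid X)))) (v := vert (bid _))).
    by move=> * /=; rewrite (tmapE s (bid X)) (tmapE e (bid X)) /= es.
  by apply/(vsplit_weq (vsplit_tensorl X sS))/contractible_acyclic/contractible_tensorl.
apply: (retraction_weq (s := btensor_map (bid X) s)).
  apply: (vtensor_ext (u := vcomp (vert (btensor_map (bid X) e))
    (vert (btensor_map (bid X) s))) (v := vert (bid _))).
  by move=> * /=; rewrite (tmapE (bid X) s) (tmapE (bid X) e) /= es.
by apply/(vsplit_weq (vsplit_tensorr X sS))/contractible_acyclic/contractible_tensorr.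
Qed.

Lemma pushout_tensor_triv_cof_weq (X Y : bicomplex k) (g : bimor X Y) :
  pushout_of (tensor_with_object (@CE_triv_cof k)) g -> CE_weq g.
Proof.
case=> {X Y g} A B X Y f u v g fT; case: fT u v => {A B f} A B f Z fT u v poP.
have [C [c [r [j [fS CC]]]]] := triv_cof_contractible fT.
have [c' [r' [j' gS]]] := vsplit_pushout (vsplit_tensorl Z fS) poP.
exact/(vsplit_weq gS)/contractible_acyclic/contractible_tensorl.
Qed.
End MonoidalModelCategory.

(** * Transfinite compositions *)

Section DependentProduct.
Variables (k : comPzRingType) (I : Type) (M : I -> lmodType k).

Definition dprod : Type := forall i, M i.
HB.instance Definition _ := gen_eqMixin dprod.
HB.instance Definition _ := gen_choiceMixin dprod.

Definition dprod_add (x y : dprod) : dprod := fun i => x i + y i.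
Definition dprod_opp (x : dprod) : dprod := fun i => - x i.
Definition dprod_scale (a : k) (x : dprod) : dprod := fun i => a *: x i.

Lemma dprod_addA : associative dprod_add.
Proof. by move=> x y z; apply: functional_extensionality_dep => i; apply: addrA. Qed.
Lemma dprod_addC : commutative dprod_add.
Proof. by move=> x y; apply: functional_extensionality_dep => i; apply: addrC. Qed.
Lemma dprod_add0 : left_id (fun i => 0) dprod_add.
Proof. by move=> x; apply: functional_extensionality_dep => i; apply: add0r. Qed.
Lemma dprod_addN : left_inverse (fun i => 0) dprod_opp dprod_add.
Proof. by move=> x; apply: functional_extensionality_dep => i; apply: addNr. Qed.

HB.instance Definition _ :=
  GRing.isZmodule.Build dprod dprod_addA dprod_addC dprod_add0 dprod_addN.

Lemma dprod_scaleA a b u : dprod_scale a (dprod_scale b u) = dprod_scale (a * b) u.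
Proof. by apply: functional_extensionality_dep => i; apply: scalerA. Qed.
Lemma dprod_scale1 : left_id 1 dprod_scale.
Proof. by move=> x; apply: functional_extensionality_dep => i; apply: scale1r. Qed.
Lemma dprod_scaleDr : right_distributive dprod_scale +%R.
Proof. by move=> a x y; apply: functional_extensionality_dep => i; apply: scalerDr. Qed.
Lemma dprod_scaleDl u : {morph dprod_scale^~ u : a b / a + b}.
Proof. by move=> a b; apply: functional_extensionality_dep => i; apply: scalerDl. Qed.

HB.instance Definition _ :=
  GRing.Zmodule_isLmodule.Build k dprod
    dprod_scaleA dprod_scale1 dprod_scaleDr dprod_scaleDl.

Lemma dprodP (x y : dprod) : (forall i, x i = y i) -> x = y.
Proof. exact: functional_extensionality_dep. Qed.
End DependentProduct.

Section ProductBicomplex.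
Variables (k : comPzRingType) (I : Type) (D : I -> bicomplex k).

Definition bprod_obj (p q : int) : lmodType k := dprod (fun i => D i p q).

Lemma bprod_dh_linear p p' q (e : p = p' + 1) :
  linear (fun x : bprod_obj p q => (fun i => dh (D i) e (x i)) : bprod_obj p' q).
Proof. by move=> a x y; apply: dprodP => i; apply: linearP. Qed.

Lemma bprod_dv_linear p q q' (d : q = q' + 1) :
  linear (fun x : bprod_obj p q => (fun i => dv (D i) d (x i)) : bprod_obj p q').
Proof. by move=> a x y; apply: dprodP => i; apply: linearP. Qed.

Definition bprod : bicomplex k.
Proof.
refine (@Bicomplex k bprod_obj
  (fun p p' q e => linear_of (@bprod_dh_linear p p' q e))
  (fun p q q' d => linear_of (@bprod_dv_linear p q q' d)) _ _ _ _).
- by move=> p q x p0; apply: dprodP => i; apply: bobj0.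
- by move=> *; apply: dprodP => i; apply: dhdh.
- by move=> *; apply: dprodP => i; apply: dvdv.
- by move=> *; apply: dprodP => i; apply: dvdh.
Defined.
End ProductBicomplex.

Section QuotientBicomplex.
Variables (k : comPzRingType) (X : bicomplex k).
Variable S : forall p q, submodule (X p q).
Hypothesis S_dh : forall p p' q (e : p = p' + 1) x, S p q x -> S p' q (dh X e x).
Hypothesis S_dv : forall p q q' (d : q = q' + 1) x, S p q x -> S p q' (dv X d x).

Definition bquot_obj p q : lmodType k := quotmod (S p q).

Lemma bquot_class0 p q (x : X p q) : qm_class (S p q) x = 0 <-> S p q x.
Proof. by rewrite -[0](linear0 (qm_class (S p q))) qm_eqP subr0. Qed.

Lemma bquot_dh_subproof p p' q (e : p = p' + 1) x : S p q x ->
  (qm_class (S p' q) \o dh X e) x = 0.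
Proof. by move=> Sx; apply/bquot_class0/S_dh. Qed.

Lemma bquot_dv_subproof p q q' (d : q = q' + 1) x : S p q x ->
  (qm_class (S p q') \o dv X d) x = 0.
Proof. by move=> Sx; apply/bquot_class0/S_dv. Qed.

Definition bquot_dh p p' q (e : p = p' + 1) : {linear bquot_obj p q -> bquot_obj p' q} :=
  qm_lift (@bquot_dh_subproof p p' q e).
Definition bquot_dv p q q' (d : q = q' + 1) : {linear bquot_obj p q -> bquot_obj p q'} :=
  qm_lift (@bquot_dv_subproof p q q' d).

Lemma bquot_dhE p p' q (e : p = p' + 1) x :
  bquot_dh q e (qm_class _ x) = qm_class _ (dh X e x).
Proof. exact: qm_liftE. Qed.

Lemma bquot_dvE p q q' (d : q = q' + 1) x :
  bquot_dv p d (qm_class _ x) = qm_class _ (dv X d x).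
Proof. exact: qm_liftE. Qed.

Definition bquot : bicomplex k.
Proof.
refine (@Bicomplex k bquot_obj bquot_dh bquot_dv _ _ _ _).
- by move=> p q x p0; rewrite -[x]qm_reprK (bobj0 (qm_repr x) p0) linear0.
- by move=> p p' p'' q e e' x; rewrite -[x]qm_reprK !bquot_dhE dhdh linear0.
- by move=> p q q' q'' e e' x; rewrite -[x]qm_reprK !bquot_dvE dvdv linear0.
- move=> p p' q q' e d x; rewrite -[x]qm_reprK bquot_dhE !bquot_dvE bquot_dhE.
  by rewrite -linearD dvdh linear0.
Defined.

Definition bquot_class : bimor X bquot :=
  @Bimor k X bquot (fun p q => qm_class (S p q))
    (fun p q => qm_class_linear (S p q))
    (fun p p' q e x => esym (bquot_dhE e x)) (fun p q q' d x => esym (bquot_dvE d x)).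
End QuotientBicomplex.

(** * Elements of directed colimits *)

Section Colimit.
Variables (k : comPzRingType) (d : Order.disp_t) (W : orderType d).
Variables (D : W -> bicomplex k).
Variable t : forall i j : W, (i <= j)%O -> bimor (D i) (D j).
Hypothesis t_comp : forall i j l (h : (i <= j)%O) (h' : (j <= l)%O)
  (h'' : (i <= l)%O), bcomp (t h') (t h) = t h''.
Variables (P : pred W) (Y : bicomplex k) (c : forall i, P i -> bimor (D i) Y).
Hypothesis cP : is_colimit t c.
Variables (i0 : W) (Pi0 : P i0) (i0_le : forall i, (i0 <= i)%O).

Lemma t_trans i j l (h : (i <= j)%O) (h' : (j <= l)%O) p q x :
  t h' p q (t h p q x) = t (le_trans h h') p q x.
Proof. by rewrite -(t_comp h h' (le_trans h h')). Qed.

Lemma cocone_t i j (h : (i <= j)%O) (hi : P i) (hj : P j) p q x :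
  c hj p q (t h p q x) = c hi p q x.
Proof. by have [cc _] := cP; rewrite -(cc i j h hi hj). Qed.

Lemma max_in i j : P i -> P j ->
  exists l, [/\ P l, (i <= l)%O & (j <= l)%O].
Proof.
by move=> Pi Pj; case: (leP i j) => [ij|/ltW ij]; [exists j | exists i].
Qed.

Definition col_im p q (y : Y p q) : Prop :=
  exists i (hi : P i) x, c hi p q x = y.

Lemma col_im0 p q : col_im (0 : Y p q).
Proof. by exists i0, Pi0, 0; rewrite linear0. Qed.

Lemma col_im_lin p q a (x y : Y p q) : col_im x -> col_im y -> col_im (a *: x + y).
Proof.
move=> [i [Pi [x' <-]]] [j [Pj [y' <-]]]; have [l [Pl il jl]] := max_in Pi Pj.
exists l, Pl, (a *: t il p q x' + t jl p q y').
by rewrite linearP /= !cocone_t.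
Qed.

(** The images of the stages form a subbicomplex. The projection of Y to the quotient by it and the
    zero map agree on the cocone, so by uniqueness the projection is zero. *)
Lemma colimit_generated p q (y : Y p q) : exists i (hi : P i) x, c hi p q x = y.
Proof.
pose S p q := Submodule (@col_im0 p q) (@col_im_lin p q).
have S_dh a a' b (e : a = a' + 1) x : S a b x -> S a' b (dh Y e x).
  by move=> [i [Pi [z <-]]]; exists i, Pi, (dh _ e z); rewrite bmap_dh.
have S_dv a b b' (e : b = b' + 1) x : S a b x -> S a b' (dv Y e x).
  by move=> [i [Pi [z <-]]]; exists i, Pi, (dv _ e z); rewrite bmap_dv.
pose u := bquot_class S_dh S_dv.
have [cc cU] := cP.
have [|w [_ w_uniq]] := cU _ (fun i hi => bcomp u (c hi)).
  move=> i j h hi hj; apply: bimor_eq => a b x.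
  by rewrite -[LHS]/(u _ _ (c hj _ _ (t h _ _ x))) cocone_t.
have wu : w = u by apply: w_uniq.
have w0 : w = bcomp (bzero_mor _) (bto0 Y).
  apply: w_uniq => i hi; apply: bimor_eq => a b x; apply/esym/(@bquot_class0 _ _ S).
  by exists i, hi, x.
apply/(@bquot_class0 _ _ S); rewrite -[LHS]/(u p q y) -wu w0.
by [].
Qed.

(** At indices not above i the value 0 keeps the map linear; such indices do not matter modulo
    eventually zero families. *)
Definition extend_fun i p q (x : D i p q) : bprod D p q :=
  fun j => match pselect (i <= j)%O with
           | left h => t h p q x
           | right _ => 0 end.

Lemma extend_linear i p q : linear (@extend_fun i p q).
Proof.
move=> a x y; apply: dprodP => j; rewrite /extend_fun.
rewrite -[RHS]/(a *: extend_fun x j + extend_fun y j) /extend_fun.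
by case: pselect => [h|_]; [exact: linearP | rewrite scaler0 addr0].
Qed.

Lemma extend_dh i p p' q (e : p = p' + 1) (x : D i p q) :
  extend_fun (dh _ e x) = dh (bprod D) e (extend_fun x).
Proof.
apply: dprodP => j; rewrite -[RHS]/(dh (D j) e (extend_fun x j)) /extend_fun.
by case: pselect => [h|_]; [exact: bmap_dh | rewrite linear0].
Qed.

Lemma extend_dv i p q q' (e : q = q' + 1) (x : D i p q) :
  extend_fun (dv _ e x) = dv (bprod D) e (extend_fun x).
Proof.
apply: dprodP => j; rewrite -[RHS]/(dv (D j) e (extend_fun x j)) /extend_fun.
by case: pselect => [h|_]; [exact: bmap_dv | rewrite linear0].
Qed.

Definition extend i : bimor (D i) (bprod D) :=
  Bimor (@extend_linear i) (@extend_dh i) (@extend_dv i).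

Lemma extendE i j (h : (i <= j)%O) p q x : extend i p q x j = t h p q x.
Proof.
rewrite /= /extend_fun; case: pselect => [h'|/(_ h) //].
by rewrite (bool_irrelevance h' h).
Qed.

Definition evzero p q (x : bprod D p q) : Prop :=
  exists2 j, P j & forall l, (j <= l)%O -> x l = 0.

Lemma evzero0 p q : evzero (0 : bprod D p q).
Proof. by exists i0. Qed.

Lemma evzero_lin p q a (x y : bprod D p q) :
  evzero x -> evzero y -> evzero (a *: x + y).
Proof.
move=> [i Pi xi] [j Pj yj]; have [l [Pl il jl]] := max_in Pi Pj.
exists l => // m lm; rewrite -[LHS]/(a *: x m + y m).
by rewrite xi ?yj ?(le_trans _ lm) // scaler0 addr0.
Qed.

(* Tested against the cocone to the product of the D_j modulo eventually     *)
(* zero families.                                                            *)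
Lemma colimit_zero i (hi : P i) p q (x : D i p q) : c hi p q x = 0 ->
  exists j (h : (i <= j)%O), P j /\ t h p q x = 0.
Proof.
pose S p q := Submodule (@evzero0 p q) (@evzero_lin p q).
have S_dh a a' b (e : a = a' + 1) y : S a b y -> S a' b (dh _ e y).
  by move=> [j Pj yj]; exists j => // l jl; rewrite -[LHS]/(dh _ e (y l)) yj ?linear0.
have S_dv a b b' (e : b = b' + 1) y : S a b y -> S a b' (dv _ e y).
  by move=> [j Pj yj]; exists j => // l jl; rewrite -[LHS]/(dv _ e (y l)) yj ?linear0.
pose u := bquot_class S_dh S_dv.
have [cc cU] := cP; have [|w [wc _] cx] := cU _ (fun i hi => bcomp u (extend i)).
  move=> a b h ha hb; apply: bimor_eq => m n y.
  apply/qm_eqP; exists b => // l bl.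
  rewrite -[LHS]/(extend b m n (t h m n y) l - extend a m n y l).
  by rewrite (extendE bl) (extendE (le_trans h bl)) t_trans subrr.
have : u p q (extend i p q x) = 0.
  by have := congr1 (fun h : bimor (D i) (bquot S_dh S_dv) => h p q x) (wc i hi);
    rewrite /= cx linear0 => <-.
move=> /(@bquot_class0 _ _ S) [j Pj xj]; have [l [Pl il jl]] := max_in hi Pj.
by exists l, il; split=> //; rewrite -(extendE il) xj.
Qed.

Lemma colimit_zero2 i (hi : P i) p q p' q' (x : D i p q) (y : D i p' q') :
  c hi p q x = 0 -> c hi p' q' y = 0 ->
  exists j (h : (i <= j)%O), [/\ P j, t h p q x = 0 & t h p' q' y = 0].
Proof.
move=> /colimit_zero [j [ij [Pj xj]]] /colimit_zero [l [il [Pl yl]]].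
have [m [Pm jm lm]] := max_in Pj Pl; exists m, (le_trans ij jm); split=> //.
  by rewrite -t_trans xj linear0.
by rewrite (bool_irrelevance (le_trans ij jm) (le_trans il lm)) -t_trans yl linear0.
Qed.

Lemma colimit_generated2 p q p' q' (y : Y p q) (y' : Y p' q') :
  exists i (hi : P i) x x', c hi p q x = y /\ c hi p' q' x' = y'.
Proof.
have [i [Pi [x <-]]] := colimit_generated y.
have [j [Pj [x' <-]]] := colimit_generated y'.
have [l [Pl il jl]] := max_in Pi Pj.
by exists l, Pl, (t il _ _ x), (t jl _ _ x'); rewrite !cocone_t.
Qed.

(** Each condition involves finitely many elements and equations, all of which live at one stage j;
    there D i0 -> D j is a weak equivalence by assumption. *)
Lemma colimit_weq :
  (forall j (h : (i0 <= j)%O), P j -> CE_weq (t h)) -> CE_weq (c Pi0).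
Proof.
move=> tW; apply/CE_weqP; split=> p p1 pm q q1 qm e1 em d1 dm.
  move=> x y z w dx hx dz cx.
  have [i [Pi [z' [w' [zE wE]]]]] := colimit_generated2 z w.
  have h0 := i0_le i.
  have [||j [ij [Pj dz'' xE]]] := colimit_zero2 (hi := Pi) (x := dv _ dm z')
      (y := t h0 _ _ x - dh _ e1 z' - dv _ d1 w').
  - by rewrite bmap_dv zE.
  - by rewrite !linearB /= cocone_t cx bmap_dh bmap_dv zE wE; zmod_identity.
  have [tI _] := (CE_weqP _).1 (tW j (le_trans h0 ij) Pj).
  apply: (tI _ _ _ _ _ _ e1 em d1 dm x y (t ij _ _ z') (t ij _ _ w') dx hx).
    by rewrite -bmap_dv.
  rewrite -t_trans; move: xE; rewrite !linearB /= !bmap_dh !bmap_dv => /eqP.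
  by rewrite !subr_eq add0r addrC => /eqP.
move=> y v dy hy.
have [i [Pi [y' [v' [yE vE]]]]] := colimit_generated2 y v.
have [||j [ij [Pj dy' hy']]] := colimit_zero2 (hi := Pi) (x := dv _ dm y')
    (y := dh _ em y' - dv _ d1 v').
- by rewrite bmap_dv yE.
- by rewrite linearB /= bmap_dh bmap_dv yE vE hy subrr.
have [_ tS] := (CE_weqP _).1 (tW j (i0_le j) Pj).
have [||x [u [z [w [dx hx dz xE]]]]] := tS _ _ _ _ _ _ e1 em d1 dm
    (t ij _ _ y') (t ij _ _ v').
- by rewrite -bmap_dv.
- move: hy'; rewrite linearB /= bmap_dh bmap_dv => /eqP.
  by rewrite subr_eq0 => /eqP.
exists x, u, (c Pj _ _ z), (c Pj _ _ w); split=> //.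
  by rewrite -bmap_dv dz linear0.
rewrite -yE -(cocone_t ij Pi Pj) xE !linearD /= cocone_t.
by rewrite bmap_dh bmap_dv.
Qed.
End Colimit.

(** Well-founded induction on j; at a limit stage [colimit_weq] is applied to the segment of indices
    below j. *)
Lemma transfinite_weq (k : comPzRingType) (d : Order.disp_t) (W : orderType d)
    (D : W -> bicomplex k)
    (t : forall i j : W, (i <= j)%O -> bimor (D i) (D j)) (S : mclass k) (i0 : W) :
  (forall X Y (f : bimor X Y), S X Y f -> CE_weq f) ->
  transfinite_sequence t S -> (forall i, (i0 <= i)%O) ->
  forall j (h : (i0 <= j)%O), CE_weq (t i0 j h).
Proof.
move=> SW [wf t_id t_comp t_succ t_lim] i0_le.
apply: (well_founded_ind wf) => j IH h.
have [ij0|] := eqVneq i0 j.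
  by subst j; rewrite t_id; apply: CE_weq_id.
rewrite eq_sym => ji0; have i0j : (i0 < j)%O by rewrite lt_neqAle eq_sym ji0 h.
have [[i ij]|no_pred] := pselect (exists i, is_succ i j).
  have ltij := proj1 ij.
  rewrite -(t_comp _ _ _ (i0_le i) (ltW ltij) h).
  apply: CE_weq_comp; first by apply: SW; apply: t_succ.
  exact: IH.
have lim_j : is_limit j.
  by split; [exists i0 | move=> i ij; apply: no_pred; exists i].
rewrite (bool_irrelevance h (ltW i0j)).
apply: (colimit_weq t_comp (t_lim j lim_j) i0j i0_le) => i hi ltij.
exact: IH.
Qed.

Lemma CE_monoid_axiom (k : comPzRingType) : monoid_axiom k.
Proof.
move=> X Y g [d W D t Z c i0 tS i0_le cP].
apply: (colimit_weq (ts_comp tS) cP isT i0_le) => j h _.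
apply: (transfinite_weq _ tS i0_le) => A B f.
exact: pushout_tensor_triv_cof_weq.
Qed.

Theorem proposition4p2 (k : comPzRingType) :
  pushout_product_axiom k /\ unit_axiom k /\
  CE_cofibrant (bunit k) /\ monoid_axiom k.
Proof.
split; first exact: CE_pushout_product.
split; first exact: CE_unit.
split; first exact: CE_cofibrant_bunit.
exact: CE_monoid_axiom.
Qed.
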